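(* Let $[n]$ be equipped with its usual order and let $Q\subset\mathbb R^n$ be a g-matroid. The following statements are equivalent: (1) $Q$ is a g-positroid; (2) there exist a unique non-crossing partition $[n]=S_1\sqcup\dots\sqcup S_k\sqcup T$ such that no $S_i$ surrounds $T$, and a decomposition $Q=P_1\times\dots\times P_k\times Q_0$ such that each $P_i$ is a full-dimensional positroid polytope in $\mathbb R^{S_i}$ and $Q_0$ is a full-dimensional g-positroid in $\mathbb R^T$; (3) $Q$ contains no two-dimensional face with vertices of the form $\{e_{Xij},e_{Xjk},e_{Xk},e_{Xi}\}$ with $\{i,j,k\}\subseteq[n]\setminus X$ and $i<j<k$, and no two-dimensional face with vertices of the form $\{e_{Xij},e_{Xjk},e_{Xkl},e_{Xli}\}$ with $\{i,j,k,l\}\subseteq[n]\setminus X$ and $i<j<k<l$.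
   Context: Notation: $e_J=\sum_{i\in J}e_i$; $Xij=X\cup\{i,j\}$ etc.; $x(S)=\sum_{i\in S}x_i$. For a finite totally ordered set $N$, a strong pair is a pair $f,g:2^N\to\mathbb R$ with $f(\emptyset)=g(\emptyset)=0$, $g\le f$, $f$ submodular, $g$ supermodular, and $f(B)-f(B\setminus A)\ge g(A)-g(A\setminus B)$ for all $A,B\subseteq N$. The generalized polymatroid (g-polymatroid) of the pair is $Q(f,g)=\{x\in\mathbb R^N:g(A)\le x(A)\le f(A)\ \forall A\subseteq N\}$ (the pair is uniquely determined by the polyhedron). It is a g-polypositroid if $Q(f,g)=\{x\in\mathbb R^N:g(J)\le x(J)\le f(J)\text{ for all intervals }J\text{ of }N\}$, where an interval is a set of consecutive elements of $N$. A g-matroid is a g-polymatroid all of whose vertices lie in $\{0,1\}^N$. A g-positroid is a polyhedron that is both a g-polypositroid and a g-matroid. A base polyhedron is a g-polymatroid $Q(f,g)$ with $g(A)=f(N)-f(N\setminus A)$ for all $A$ (so $x(N)=f(N)$ on it). A positroid polytope is a g-positroid that is a base polyhedron (equivalently, the base polytope of a positroid on the ordered set $N$). A subset $S_i$ or $T$ of $[n]$ carries the order inherited from $[n]$. Full-dimensional: a g-polymatroid in $\mathbb R^N$ is full-dimensional if it has dimension $|N|$; a base polyhedron (in particular a positroid polytope) in $\mathbb R^N$ is full-dimensional if it has dimension $|N|-1$. A partition of $[n]$ into blocks is non-crossing if there are no two distinct blocks $N_1,N_2$ and $a<b<c<d$ with $a,c\in N_1$, $b,d\in N_2$. A subset $S$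 surrounds a disjoint subset $T$ if there is a partition $S=S'\sqcup S''$ with both parts nonempty such that $\max(S')<\min(T)$ and $\max(T)<\min(S'')$. In (2), $k=0$ or $T=\emptyset$ is allowed (if $T=\emptyset$ no $S_i$ is considered to surround $T$). *)

(* Defs.v *)
From mathcomp Require Import all_boot all_order all_algebra.
From mathcomp Require Import reals.

Set Implicit Arguments.
Unset Strict Implicit.
Unset Printing Implicit Defensive.

Import Order.TTheory GRing.Theory Num.Theory.
Local Open Scope ring_scope.

(* For S a subset of [n] = 'I_n, R^S is identified with the coordinate
   subspace of R^n of the vectors vanishing outside S (see [in_coord]).  A
   finite totally ordered ground set is thus a subset S of 'I_n with the
   inherited order, and each notion below that takes S as an argument is the
   notion in R^S: only the values of f and g on subsets of S matter.  Subsets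
   of R^n are predicates, compared pointwise. *)

Section Points.
Variables (R : realType) (n : nat).
Implicit Types (x v c p : 'rV[R]_n) (P Q F : 'rV[R]_n -> Prop).
Implicit Types (A S T J : {set 'I_n}).

Definition e_ J : 'rV[R]_n := \sum_(i in J) delta_mx ord0 i.

Definition coord_sum x A : R := \sum_(i in A) x ord0 i.

Definition dot c x : R := \sum_(i < n) c ord0 i * x ord0 i.

Definition in_coord S x : Prop := forall i, i \notin S -> x ord0 i = 0.

Definition restr S x : 'rV[R]_n := \row_i (if i \in S then x ord0 i else 0).

(* V is the direction space of the affine hull of P; the empty set has no
   dimension. *)
Definition has_dim P (d : nat) : Prop :=
  exists p (V : {vspace 'rV[R]_n}),
    [/\ P p,
        forall x, P x -> x - p \in V,
        forall W : {vspace 'rV[R]_n},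
          (forall x, P x -> x - p \in W) -> (V <= W)%VS
      & \dim V = d].

Definition is_face P F : Prop :=
  exists c, forall x, F x <-> (P x /\ forall y, P y -> dot c y <= dot c x).

Definition is_vertex P v : Prop := is_face P (fun x => x = v).

End Points.

Section GPolymatroids.
Variables (R : realType) (n : nat).
Implicit Types (f g : {set 'I_n} -> R) (Q P : 'rV[R]_n -> Prop).
Implicit Types (S T J : {set 'I_n}).

Definition submodular S f : Prop :=
  forall A B : {set 'I_n}, A \subset S -> B \subset S ->
    f (A :|: B) + f (A :&: B) <= f A + f B.

Definition supermodular S g : Prop :=
  forall A B : {set 'I_n}, A \subset S -> B \subset S ->
    g A + g B <= g (A :|: B) + g (A :&: B).

Definition strong_pair S f g : Prop :=
  [/\ f set0 = 0 /\ g set0 = 0,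
      forall A : {set 'I_n}, A \subset S -> g A <= f A,
      submodular S f,
      supermodular S g
    & forall A B : {set 'I_n}, A \subset S -> B \subset S ->
        g A - g (A :\: B) <= f B - f (B :\: A)].

Definition gpoly S f g : 'rV[R]_n -> Prop := fun x =>
  in_coord S x /\
  forall A : {set 'I_n}, A \subset S -> g A <= coord_sum x A <= f A.

Definition interval S J : Prop :=
  J \subset S /\
  forall a b c : 'I_n, a \in J -> c \in J -> b \in S ->
    (a < b)%N -> (b < c)%N -> b \in J.

Definition gpoly_interval S f g : 'rV[R]_n -> Prop := fun x =>
  in_coord S x /\
  forall J, interval S J -> g J <= coord_sum x J <= f J.

Definition gpolymatroid S Q : Prop :=
  exists f g, strong_pair S f g /\ (forall x, Q x <-> gpoly S f g x).

Definition gpolypositroid S Q : Prop :=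
  exists f g,
    [/\ strong_pair S f g,
        forall x, Q x <-> gpoly S f g x
      & forall x, Q x <-> gpoly_interval S f g x].

Definition gmatroid S Q : Prop :=
  gpolymatroid S Q /\
  forall v, is_vertex Q v -> forall i, v ord0 i = 0 \/ v ord0 i = 1.

Definition gpositroid S Q : Prop := gpolypositroid S Q /\ gmatroid S Q.

Definition base_polyhedron S Q : Prop :=
  exists f g,
    [/\ strong_pair S f g,
        forall x, Q x <-> gpoly S f g x
      & forall A : {set 'I_n}, A \subset S -> g A = f S - f (S :\: A)].

Definition positroid_polytope S Q : Prop :=
  gpositroid S Q /\ base_polyhedron S Q.

(* Full-dimensionality depends on whether the polyhedron is regarded as a
   g-polymatroid or as a base polyhedron; [full_dim_base] is only meant for
   nonempty S. *)
Definition full_dim S Q : Prop := has_dim Q #|S|.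

Definition full_dim_base S Q : Prop := has_dim Q #|S|.-1.

Definition is_product (SS : {set {set 'I_n}}) T
    (P : {set 'I_n} -> 'rV[R]_n -> Prop) (Q0 Q : 'rV[R]_n -> Prop) : Prop :=
  forall x, Q x <->
    ((forall S, S \in SS -> P S (restr S x)) /\ Q0 (restr T x)).

Definition decomposes Q (SS : {set {set 'I_n}}) T : Prop :=
  exists (P : {set 'I_n} -> 'rV[R]_n -> Prop) (Q0 : 'rV[R]_n -> Prop),
    [/\ forall S, S \in SS ->
          positroid_polytope S (P S) /\ full_dim_base S (P S),
        gpositroid T Q0 /\ full_dim T Q0
      & is_product SS T P Q0 Q].

Definition has_2face_with_vertices Q (L : seq {set 'I_n}) : Prop :=
  exists F, [/\ is_face Q F, has_dim F 2
    & forall v, is_vertex F v <-> exists2 J, J \in L & v = e_ R J].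

End GPolymatroids.

Section Partitions.
Variable n : nat.
Implicit Types (S T : {set 'I_n}) (SS : {set {set 'I_n}}).

Definition noncrossing SS : Prop :=
  forall N1 N2, N1 \in SS -> N2 \in SS -> N1 != N2 ->
    ~ exists a b c d : 'I_n,
        [/\ (a < b)%N, (b < c)%N & (c < d)%N] /\
        [/\ a \in N1, c \in N1, b \in N2 & d \in N2].

(* The S_i are the (nonempty) elements of SS; T may be empty. *)
Definition noncrossing_partition SS T : Prop :=
  partition SS (~: T) /\ noncrossing (T |: SS).

Definition surrounds S T : Prop :=
  T != set0 /\
  exists S1 S2 : {set 'I_n},
    [/\ S = S1 :|: S2, [disjoint S1 & S2], S1 != set0 /\ S2 != set0,
        forall a t : 'I_n, a \in S1 -> t \in T -> (a < t)%N
      & forall t b : 'I_n, t \in T -> b \in S2 -> (t < b)%N].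

End Partitions.

(* Main.v *)
Require Import Defs.
From mathcomp Require Import all_boot all_order all_algebra.
From mathcomp Require Import reals.
From mathcomp Require Import boolp ring lra.

(* Adding the coordinate x_0 = - x([n]) turns a g-polymatroid into the base
   polytope of a submodular function on the cyclically ordered set {0, ..., n},
   intervals of [n] becoming cyclic intervals up to complement.  At a point x,
   write a -> b if every tight set containing a contains b, i.e. if a small
   exchange x + e (e_a - e_b) stays in the polytope; the classes of the induced
   equivalence are the connected components of the face of x.

   (3) => (1).  If some face has two crossing components, a minimal such face has
   components {i, k}, {j, l} and singletons: otherwise a facet of it splits some
   component in two and still has crossing components.  Such a face is a forbidden
   square.  If no face has crossing components and y satisfies all the interval
   inequalities, then y lies in the affine hull, since a component is the
   complement of cyclic intervals that are unions of components; and if y is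
   outside the polytope, a facet separating it splits a component C into A and
   C - A, and the cyclic interval cut by C - A that contains A is tight on this
   facet and violated by y.

   (1) => (2).  The blocks are the components at a relative interior point, T being
   that of 0.  If e_i - e_k and e_j - e_l with i < j < k < l are two-way feasible
   and the polytope is cut out by intervals, then so is e_i - e_j; hence the
   components do not cross.

   (2) => (3).  At the centre of a forbidden square the same exchange argument,
   inside one factor, gives a third independent direction in the face. *)

Set Implicit Arguments.
Unset Strict Implicit.
Unset Printing Implicit Defensive.

Import Order.TTheory GRing.Theory Num.Theory.

(** * Base polytopes and tight sets *)

Section BasePolytope.
Local Open Scope ring_scope.
Variables (R : realFieldType) (E : finType) (F : {set E} -> R).
Implicit Types (x y z p d : E -> R) (a b c : E) (A B C D : {set E}).

(** Faces never appear as objects: a face is represented by a point of its relative interior, that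
    is, by the finite family of sets tight there, and larger families mean smaller faces. Extremal
    faces are then found by minimising or maximising a number of tight sets. The obstacle is that a
    set tight on a facet may cut many components at once. It is localised to one component by
    intersecting with, then adding, sets that are already tight. The element 0 also merges the cases
    of the statement: a square on i < j < k is a square on 0 < i < j < k, and a block surrounding T
    is a component crossing that of 0. The 0/1 vertices turn the minimal crossing face, a priori
    only a rectangle, into a unit square. Uniqueness in (2) comes from linear algebra: a functional
    constant on Q has equal coefficients on each block and zero coefficients on T. *)

Definition sm x A : R := \sum_(c in A) x c.

Definition in_base x : Prop := (forall A, sm x A <= F A) /\ sm x setT = F setT.

Definition tight x : {set {set E}} := [set A | sm x A == F A].

Definition adv x t d : E -> R := fun c => x c + t * d c.

Definition dlt a b : E -> R := fun c => (c == a)%:R - (c == b)%:R.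

Lemma sm0 x : sm x set0 = 0.
Proof. by rewrite /sm big_set0. Qed.

Lemma sm_adv x t d A : sm (adv x t d) A = sm x A + t * sm d A.
Proof. by rewrite /sm /adv big_split /= mulr_sumr. Qed.

Lemma sm_dlt a b A : sm (dlt a b) A = (a \in A)%:R - (b \in A)%:R.
Proof.
have ind e : \sum_(c in A) (c == e)%:R = (e \in A)%:R :> R.
  case: (boolP (e \in A)) => eA.
    rewrite (bigD1 e) //= eqxx big1 ?addr0 // => c /andP[_ /negPf -> //].
  by apply: big1 => c cA; case: eqP => // ce; rewrite -ce cA in eA.
by rewrite /sm /dlt sumrB !ind.
Qed.

Lemma sm_UI x A B : sm x (A :|: B) + sm x (A :&: B) = sm x A + sm x B.
Proof.
rewrite /sm (big_setID A) /= setUK setDUl setDv set0U -addrA; congr (_ + _).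
by rewrite (big_setID A (A := B)) /= setIC addrC.
Qed.

Lemma sm_subD x A B : A \subset B -> sm x (B :\: A) = sm x B - sm x A.
Proof.
by move=> sAB; rewrite /sm (big_setID A (A := B)) /= (setIidPr sAB); ring.
Qed.

Lemma in_tight x A : (A \in tight x) = (sm x A == F A).
Proof. by rewrite inE. Qed.

Definition arr x a b : bool :=
  [forall A : {set E}, (A \in tight x) ==> (a \in A) ==> (b \in A)].

Definition eqv x a b : bool := arr x a b && arr x b a.

Lemma arrP x a b :
  reflect (forall A, A \in tight x -> a \in A -> b \in A) (arr x a b).
Proof.
apply: (iffP forallP) => [h A tA aA | h A].
  by have /implyP/(_ tA)/implyP := h A; apply.
by apply/implyP => tA; apply/implyP; apply: h.
Qed.

Lemma arr_refl x a : arr x a a.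
Proof. exact/arrP. Qed.

Lemma arr_trans x b a c : arr x a b -> arr x b c -> arr x a c.
Proof. by move=> /arrP ab /arrP bc; apply/arrP => A tA /(ab _ tA)/(bc _ tA). Qed.

Lemma eqv_refl x a : eqv x a a.
Proof. by rewrite /eqv arr_refl. Qed.

Lemma eqv_sym x a b : eqv x a b = eqv x b a.
Proof. exact: andbC. Qed.

Lemma eqv_trans x b a c : eqv x a b -> eqv x b c -> eqv x a c.
Proof.
move=> /andP[ab ba] /andP[bc cb].
by rewrite /eqv (arr_trans ab bc) (arr_trans cb ba).
Qed.

Lemma eqv_mem x a b A : eqv x a b -> A \in tight x -> (a \in A) = (b \in A).
Proof.
by case/andP=> /arrP ab /arrP ba tA; apply/idP/idP; [apply: ab | apply: ba].
Qed.

Lemma arr_sub x y a b : tight x \subset tight y -> arr y a b -> arr x a b.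
Proof. by move=> /subsetP s /arrP h; apply/arrP => A /s; apply: h. Qed.

Lemma eqv_sub x y a b : tight x \subset tight y -> eqv y a b -> eqv x a b.
Proof. by move=> s /andP[ab ba]; rewrite /eqv !(arr_sub s). Qed.

Lemma narrP x a b :
  ~~ arr x a b -> exists2 D, D \in tight x & (a \in D) && (b \notin D).
Proof.
case/forallPn=> D; rewrite !negb_imply => /andP[tD ab]; by exists D.
Qed.

Hypothesis F0 : F set0 = 0.
Hypothesis Fsub : forall A B, F (A :|: B) + F (A :&: B) <= F A + F B.

Lemma tight0 x : set0 \in tight x.
Proof. by rewrite in_tight sm0 F0. Qed.

Section Point.
Variable x : E -> R.
Hypothesis Bx : in_base x.

Let leF A : sm x A <= F A. Proof. exact: Bx.1. Qed.

Lemma tightT : setT \in tight x.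
Proof. by rewrite in_tight Bx.2. Qed.

Lemma tightUI A B : A \in tight x -> B \in tight x ->
  A :|: B \in tight x /\ A :&: B \in tight x.
Proof.
rewrite !in_tight => /eqP tA /eqP tB.
have := sm_UI x A B; have := Fsub A B.
have := leF (A :|: B); have := leF (A :&: B); rewrite tA tB => *.
by split; apply/eqP; lra.
Qed.

Lemma tightU A B : A \in tight x -> B \in tight x -> A :|: B \in tight x.
Proof. by move=> tA tB; case: (tightUI tA tB). Qed.

Lemma tightI A B : A \in tight x -> B \in tight x -> A :&: B \in tight x.
Proof. by move=> tA tB; case: (tightUI tA tB). Qed.

(** Birkhoff duality: tight sets form a lattice of sets containing the empty and the full set. The
    elements reachable from a form the intersection of the tight sets containing a, and a closed set
    is a union of such intersections. Tightness is proved below by checking closure. *)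
Lemma tight_closed A :
  (forall a b, a \in A -> arr x a b -> b \in A) -> A \in tight x.
Proof.
move=> clA.
have tdn a : [set b | arr x a b] \in tight x.
  have -> : [set b | arr x a b]
      = \bigcap_(D in tight x | a \in D) D.
    apply/setP => b; rewrite inE; apply/arrP/bigcapP => [h D /andP[]|h D tD aD].
      exact: h.
    by apply: h; rewrite tD.
  elim/big_ind: _ => [|D D' tD tD'|D /andP[] //]; [exact: tightT | exact: tightI].
have -> : A = \bigcup_(a in A) [set b | arr x a b].
  apply/setP => b; apply/idP/bigcupP => [bA | [a aA]].
    by exists b; rewrite ?inE ?arr_refl.
  by rewrite inE; apply: clA.
by elim/big_ind: _ => // [|D D' tD tD']; [exact: tight0 | exact: tightU].
Qed.

Definition down a := [set b | arr x a b].
(** Makes a class the difference of two nested tight sets, so that its sum is the same at all points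
    of the face. *)
Definition sdown a := [set b | arr x a b && ~~ arr x b a].
Definition cls a := [set b | eqv x a b].

Lemma tight_down a : down a \in tight x.
Proof.
by apply: tight_closed => b c; rewrite !inE => ab bc; apply: arr_trans bc.
Qed.

Lemma tight_sdown a : sdown a \in tight x.
Proof.
apply: tight_closed => b c; rewrite !inE => /andP[ab nba] bc.
rewrite (arr_trans ab bc) /=; apply: contra nba; exact: arr_trans.
Qed.

Lemma cls_down a : cls a = down a :\: sdown a.
Proof. by apply/setP => b; rewrite !inE /eqv; case: arr; case: arr. Qed.

Lemma sdown_sub a : sdown a \subset down a.
Proof. by apply/subsetP => b; rewrite !inE => /andP[]. Qed.

Lemma slack : exists2 e, 0 < e & forall A, A \notin tight x -> sm x A + e < F A.
Proof.
(* The value 1 at tight sets is a dummy that keeps the minimum positive; the halving makes the final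
   inequality strict. *)
pose s A := if A \in tight x then 1 else (F A - sm x A) / 2.
pose e := s [arg min_(D < set0) s D]%O; exists e.
  rewrite /e /s; case: ifP => // /negbT; rewrite in_tight.
  case: arg_minP => // D _ _ ne; have := leF D.
  rewrite le_eqVlt (negPf ne) /= => *; lra.
rewrite /e; case: arg_minP => // D _ minD A ntA.
have := minD A isT; rewrite /s (negPf ntA).
have: sm x A < F A by rewrite lt_neqAle -in_tight ntA leF.
case: ifP => _ *; lra.
Qed.

(** A step within the uniform slack makes no new set tight, and [arr x a b] rules out the tight sets
    whose sum would grow. The tight sets that are lost contain b but not a. *)
Lemma exchange_step a b : arr x a b -> exists2 e, 0 < e & in_base (adv x e (dlt a b)) /\
  tight (adv x e (dlt a b)) = [set D in tight x | (a \in D) == (b \in D)].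
Proof.
move=> /arrP ab; have [e e0 sl] := slack; exists e => //.
have key A : (sm (adv x e (dlt a b)) A <= F A) /\
    ((sm (adv x e (dlt a b)) A == F A)
      = (A \in tight x) && ((a \in A) == (b \in A))).
  rewrite sm_adv sm_dlt; case: (boolP (A \in tight x)) => tA /=.
    move: (tA); rewrite in_tight => /eqP ->.
    have := ab A tA; case: (a \in A); case: (b \in A) => //= h.
    - by rewrite subrr mulr0 addr0 lexx eqxx.
    - by have := h isT.
    - by split; [lra | apply/eqP => ?; lra].
    - by rewrite subrr mulr0 addr0 lexx eqxx.
  have := sl A tA; case: (a \in A); case: (b \in A) => /= ? ;
    (split; [lra | apply/eqP => ?; lra]).
split; last by apply/setP => A; rewrite !inE (key A).2 in_tight.
split; first by move=> A; case: (key A).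
by rewrite sm_adv sm_dlt !inE subrr mulr0 addr0 Bx.2.
Qed.

(** The ratio test of linear programming; [D0] only guarantees that some set bounds the step. *)
Lemma exit_point d D0 : sm d setT = 0 -> 0 < sm d D0 ->
  exists2 t, 0 <= t & in_base (adv x t d) /\
    exists2 D, D \in tight (adv x t d) & 0 < sm d D.
Proof.
move=> dT dD0; pose q D := (F D - sm x D) / sm d D.
case: (@arg_minP _ _ _ D0 (fun D => 0 < sm d D) q dD0) => D dD minD.
exists (q D); first by rewrite divr_ge0 ?subr_ge0 ?(ltW dD).
split; last first.
  exists D => //; rewrite in_tight sm_adv /q divfK ?lt0r_neq0 //.
  by rewrite addrC subrK.
split; last by rewrite sm_adv dT mulr0 addr0 Bx.2.
move=> A; rewrite sm_adv; case: (ltP 0 (sm d A)) => dA.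
  have := minD A dA; rewrite /q ler_pdivlMr // => h; lra.
have: 0 <= q D by rewrite divr_ge0 ?subr_ge0 ?(ltW dD).
move=> q0; have := mulr_ge0_le0 q0 dA; have := leF A => *; lra.
Qed.

End Point.

Lemma cls_sum p z a : in_base p -> in_base z -> tight p \subset tight z ->
  sm z (cls p a) = sm p (cls p a).
Proof.
move=> Bp Bz /subsetP s.
rewrite cls_down !sm_subD ?sdown_sub //.
have := s _ (tight_down Bp a); have := s _ (tight_sdown Bp a).
have := tight_down Bp a; have := tight_sdown Bp a.
by rewrite !in_tight => /eqP-> /eqP-> /eqP-> /eqP->.
Qed.

Lemma sum_cls p x A : (forall a b, eqv p a b -> (a \in A) = (b \in A)) ->
  (forall a, sm x (cls p a) = 0) -> sm x A = 0.
Proof.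
move=> satA x0; pose S := [set cls p a | a in A].
have eqR : {in A & &, equivalence_rel (eqv p)}.
  move=> a b c _ _ _; split; first exact: eqv_refl.
  move=> ab; apply/idP/idP; last exact: eqv_trans.
  by apply: eqv_trans; rewrite eqv_sym.
have parA := equivalence_partitionP eqR.
rewrite /sm -(cover_partition parA) big_trivIset; last by case/and3P: parA.
apply: big1 => _ /imsetP[a aA ->].
apply: etrans (x0 a); apply: eq_bigl => b; rewrite !inE.
by rewrite andb_idl // => /satA <-.
Qed.

(** z - p has zero sum on every class of p, hence on every union of classes. So a set that is newly
    tight at z must cut a class of p. *)
Lemma mem_tight_sat p z A : in_base p -> in_base z -> tight p \subset tight z ->
  A \in tight z -> (forall a b, eqv p a b -> (a \in A) = (b \in A)) ->
  A \in tight p.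
Proof.
move=> Bp Bz s; rewrite !in_tight => /eqP <- satA.
have: sm (adv z (-1) p) A = 0.
  apply: (sum_cls satA) => a; rewrite sm_adv (cls_sum _ Bp Bz s); ring.
by rewrite sm_adv => h; apply/eqP; lra.
Qed.


(** There are infinitely many points but finitely many values of [#|tight y|]; this replaces a
    theory of the face lattice. *)
Lemma ex_min_tight (P : (E -> R) -> Prop) x : P x ->
  exists2 y, P y & forall z, P z -> (#|tight y| <= #|tight z|)%N.
Proof.
move=> Px; have exn : exists k, `[< exists2 y, P y & #|tight y| = k >].
  by exists #|tight x|; apply/asboolP; exists x.
case: (ex_minnP exn) => k /asboolP[y Py <-] mink; exists y => // z Pz.
by apply: mink; apply/asboolP; exists z.
Qed.

Lemma ex_max_tight (P : (E -> R) -> Prop) x : P x ->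
  exists2 y, P y & forall z, P z -> (#|tight z| <= #|tight y|)%N.
Proof.
move=> Px; have exn : exists k, `[< exists2 y, P y & #|tight y| = k >].
  by exists #|tight x|; apply/asboolP; exists x.
have ub k : `[< exists2 y, P y & #|tight y| = k >] ->
    (k <= #|{: {set E}}|)%N.
  by move=> /asboolP[y _ <-]; apply: max_card.
case: (ex_maxnP exn ub) => k /asboolP[y Py <-] maxk; exists y => // z Pz.
by apply: maxk; apply/asboolP; exists z.
Qed.

(** [z'] has as few tight sets as possible beyond those of p, so it lies inside a facet. That facet
    cuts exactly one class, into two pieces: a finer preorder would allow an exchange that sheds
    some but not all of the new tight sets. [A] is the piece that a tight set can contain without
    the other one. *)
Lemma facet p z : in_base p -> in_base z -> tight p \proper tight z ->
  exists z' A a b,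
    [/\ in_base z', tight p \proper tight z' & tight z' \subset tight z] /\
    [/\ A \subset cls p a, a \notin A, b \in A, ~~ arr z' b a
      & forall c c', eqv z' c c' = eqv p c c' && ((c \in A) == (c' \in A))].
Proof.
move=> Bp Bz pz.
pose P y := [/\ in_base y, tight p \proper tight y & tight y \subset tight z].
have [y [By py yz] miny] := @ex_min_tight P z (And3 Bz pz (subxx _)).
have spy := proper_sub py.
have Ueq D : D \in tight p -> D \in tight y by apply: (subsetP spy).
(* A one-way exchange inside a [p]-class stays in the face of [p] and loses a
   tight set, so by minimality it lands on [p]'s tight sets. *)
have allowed a b : eqv p a b -> arr y a b -> ~~ arr y b a ->
    forall D, D \in tight y -> D \notin tight p -> (b \in D) && (a \notin D).
  move=> eab ab nba D tD ntD.
  suff: (a \in D) != (b \in D).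
    by move: (arrP _ _ _ ab D tD); case: (a \in D) => [->|] //; case: (b \in D).
  apply: contra ntD => sep.
  have [e e0 [Bm tm]] := exchange_step By ab.
  have pm : tight p \subset tight (adv y e (dlt a b)).
    apply/subsetP => D' tD'; rewrite tm inE Ueq //=.
    by apply/eqP; apply: eqv_mem tD'.
  have mD : D \in tight (adv y e (dlt a b)) by rewrite tm inE tD.
  have my : tight (adv y e (dlt a b)) \proper tight y.
    rewrite properE; apply/andP; split.
      by apply/subsetP => D'; rewrite tm inE => /andP[].
    have [D' tD' /andP[bD aD]] := narrP nba.
    by apply/subsetPn; exists D' => //; rewrite tm inE tD' bD (negPf aD).
  case: (eqVneq (tight p) (tight (adv y e (dlt a b)))) => [-> // | ne].
  have: (#|tight y| <= #|tight (adv y e (dlt a b))|)%N.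
    apply: miny; split => //; first by rewrite properEneq ne.
    exact: subset_trans (proper_sub my) yz.
  by rewrite leqNgt (proper_card my).
have [D tD ntD] : exists2 D, D \in tight y & D \notin tight p.
  by case/properP: py => _ [D]; exists D.
have [a0 [b0 [eab a0D b0D]]] : exists a0 b0, [/\ eqv p a0 b0, a0 \in D & b0 \notin D].
  apply: contrapT => nex; case/negP: ntD.
  apply: (mem_tight_sat Bp By spy tD) => a b ab; apply/idP/idP => [aD|bD];
    apply: contrapT => /negP nD; apply: nex; [exists a, b | exists b, a] => //.
  by rewrite eqv_sym.
pose C := cls p a0; pose U := down p a0; pose W := sdown p a0.
have tU : U \in tight p by exact: tight_down.
have tW : W \in tight p by exact: tight_sdown.
have sWU : W \subset U by exact: sdown_sub.
have CUW : C = U :\: W by exact: cls_down.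
have memC c : (c \in C) = eqv p a0 c by rewrite inE.
have clsC c : c \in C -> cls p c = C.
  rewrite memC => a0c; apply/setP => d; rewrite memC inE.
  by apply/idP/idP; apply: eqv_trans => //; rewrite eqv_sym.
clearbody C U W.
(* Agrees with [D'] on [C] and with [W] elsewhere, hence cuts no class of p other than [C]. *)
pose local D' := (D' :&: U) :|: W.
have tlocal D' : D' \in tight y -> local D' \in tight y.
  by move=> tD'; exact: (tightU By (tightI By tD' (Ueq _ tU)) (Ueq _ tW)).
have local_C D' c : c \in C -> (c \in local D') = (c \in D').
  by rewrite CUW in_setD => /andP[/negPf nW cU]; rewrite !inE nW cU andbT orbF.
have local_out D' c c' : c \notin C -> eqv p c c' ->
    (c \in local D') = (c' \in local D').
  move=> cC ecc; have c'C : c' \notin C.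
    apply: contra cC; rewrite !memC => h; apply: eqv_trans h _.
    by rewrite eqv_sym.
  have inW e : e \notin C -> (e \in U) = (e \in W).
    rewrite CUW in_setD negb_and negbK => /orP[eW | /negPf neU]; last first.
      by rewrite neU; symmetry; apply: contraFF neU; apply: (subsetP sWU).
    by rewrite eW (subsetP sWU).
  by rewrite !inE !inW // (eqv_mem ecc tW); case: (c' \in W); rewrite ?orbT ?andbF.
have a0C : a0 \in C by rewrite memC eqv_refl.
have b0C : b0 \in C by rewrite memC.
have [a [b [aC aD bC [bD ab]]]] : exists a b,
    [/\ a \in C, a \notin D, b \in C & b \in D /\ arr y a b].
  apply: contrapT => nex.
  have tUA : (U :\: D) :|: W \in tight y.
    apply: tight_closed => // c c' cUA cc'.
    have [cW|cW] := boolP (c \in W).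
      by rewrite inE (arrP _ _ _ cc' _ (Ueq _ tW) cW) orbT.
    move: cUA; rewrite !inE (negPf cW) orbF => /andP[cD cU].
    have c'U := arrP _ _ _ cc' _ (Ueq _ tU) cU.
    have [c'W|c'W] := boolP (c' \in W); first by rewrite orbT.
    rewrite c'U andbT orbF; apply/negP => c'D; apply: nex; exists c, c'.
    by rewrite !CUW !inE cW cU c'W c'U.
  have tloc := tlocal D tD.
  (* The two sets have union [U] and intersection [W]. Since all four are tight at y, their bounds
     balance; since [U] and [W] are tight at p, the slacks of p on the other two add up to zero, and
     [local D] would be tight at p although it cuts [C]. *)
  have UI : sm p ((U :\: D) :|: W) + sm p (local D) = sm p U + sm p W.
    rewrite -sm_UI; congr (sm p _ + sm p _); apply/setP => c; rewrite !inE.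
      have := subsetP sWU c; case: (c \in W) => [-> //|_]; rewrite ?orbT ?orbF //.
      by case: (c \in D); rewrite ?orbF //= ?andbT.
    by case: (c \in D); case: (c \in U); case: (c \in W).
  have UIy : sm y ((U :\: D) :|: W) + sm y (local D) = sm y U + sm y W.
    rewrite -sm_UI; congr (sm y _ + sm y _); apply/setP => c; rewrite !inE.
      have := subsetP sWU c; case: (c \in W) => [-> //|_]; rewrite ?orbT ?orbF //.
      by case: (c \in D); rewrite ?orbF //= ?andbT.
    by case: (c \in D); case: (c \in U); case: (c \in W).
  have h1 := Bp.1 ((U :\: D) :|: W); have h2 := Bp.1 (local D).
  have: local D \in tight p.
    move: tloc tUA (Ueq _ tU) (Ueq _ tW) (tU) (tW); rewrite !in_tight.
    do 6![move=> /eqP ?]; apply/eqP; lra.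
  move=> /(eqv_mem eab); rewrite !local_C // => e.
  by rewrite -e a0D in b0D.
have nba : ~~ arr y b a.
  by apply/negP => /arrP/(_ D tD bD) h; rewrite h in aD.
have eC c c' : c \in C -> c' \in C -> eqv p c c'.
  by rewrite !memC => h; apply: eqv_trans; rewrite eqv_sym.
have sepD := allowed a b (eC _ _ aC bC) ab nba.
(* A tight set of y that does not separate a from b as [D] does is tight at p, hence a union of
   classes of p. Applied to [down y c], this makes each of the two pieces of [C] a single class of
   y. *)
have big_down c : ~~ (arr y c b) || arr y c a -> down y c \in tight p.
  move=> h; apply: contrapT => /negP ntd.
  have := sepD _ (tight_down By c) ntd; rewrite !inE => /andP[cb nca].
  by rewrite cb (negPf nca) in h.
have inA c : c \in C -> c \in D -> eqv y c b.
  move=> cC cD.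
  have cb : arr y c b.
    apply: contrapT => /negP ncb.
    have td : down y c \in tight p by apply: big_down; rewrite ncb.
    have := eqv_mem (eC _ _ cC bC) td; rewrite !inE arr_refl => /esym h.
    by rewrite h in ncb.
  rewrite /eqv cb /=; apply: contrapT => /negP nbc.
  by have := allowed c b (eC _ _ cC bC) cb nbc D tD ntD; rewrite cD andbF.
have notA c : c \in C -> c \notin D -> eqv y c a.
  move=> cC cD.
  have ac : arr y a c.
    have td : down y a \in tight p by apply: big_down; rewrite arr_refl orbT.
    by have := eqv_mem (eC _ _ cC aC) td; rewrite !inE arr_refl.
  rewrite /eqv ac andbT; apply: contrapT => /negP nca.
  have := allowed a c (eC _ _ aC cC) ac nca D tD ntD.
  by rewrite (negPf cD).
exists y, (D :&: C), a, b; split => //; split => //.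
- by apply/subsetP => c /setIP[_ cC]; rewrite inE eC.
- by rewrite inE (negPf aD).
- by rewrite inE bD.
move=> u v; apply/idP/andP => [euv | [euv /eqP]].
  have e := eqv_sub spy euv; split => //.
  have [uC|uC] := boolP (u \in C).
    have vC : v \in C by move: uC; rewrite !memC => h; apply: eqv_trans e.
    by rewrite !inE uC vC !andbT (eqv_mem euv tD).
  have vC : v \notin C.
    by apply: contra uC; rewrite !memC => h; apply: eqv_trans h _; rewrite eqv_sym.
  by rewrite !inE (negPf uC) (negPf vC) !andbF.
have [uC|uC] := boolP (u \in C).
  have vC : v \in C by move: uC; rewrite !memC => h; apply: eqv_trans euv.
  rewrite !inE uC vC !andbT; have [uD /esym vD|uD /esym/negbT vD] := boolP (u \in D).
    by apply: (eqv_trans (inA u uC uD)); rewrite eqv_sym inA.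
  by apply: (eqv_trans (notA u uC uD)); rewrite eqv_sym notA.
move=> _.
(* Otherwise a tight set cutting another class could be localised away from
   [C], where it would have to separate [a] from [b]. *)
have half u' v' : u' \notin C -> eqv p u' v' -> arr y u' v'.
  move=> u'C e'; apply: contrapT => /negP /narrP[D4 tD4 /andP[u4 v4]].
  pose U' := down p u'; pose W' := sdown p u'.
  have tU' : U' \in tight p by exact: tight_down.
  have tW' : W' \in tight p by exact: tight_sdown.
  have tL : (D4 :&: U') :|: W' \in tight y.
    exact: (tightU By (tightI By tD4 (Ueq _ tU')) (Ueq _ tW')).
  have u'W : u' \notin W' by rewrite inE arr_refl.
  have u'U : u' \in U' by rewrite inE arr_refl.
  have eUW c : c \in C -> (c \in U') = (c \in W').
    move=> cC; rewrite !inE andb_idr // => u'c; apply/negP => cu'.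
    by case/negP: u'C; rewrite -(clsC c cC) inE /eqv cu' u'c.
  clearbody U' W'.
  have ntL : (D4 :&: U') :|: W' \notin tight p.
    apply/negP => /(eqv_mem e').
    by rewrite !inE u4 u'U (negPf v4) /= -(eqv_mem e' tW') (negPf u'W).
  have := sepD _ tL ntL.
  rewrite ![in X in X -> _]inE !eUW //.
  rewrite (eqv_mem (eC _ _ bC aC) tW').
  by case: (_ \in W'); rewrite ?orbT ?andbF.
rewrite /eqv half //= half //; last by rewrite eqv_sym.
by apply: contra uC; rewrite !memC => h; apply: eqv_trans h _; rewrite eqv_sym.
Qed.

End BasePolytope.

(** * Splitting the components of a face *)

Section Faces.
Local Open Scope ring_scope.
Variables (R : realFieldType) (E : finType) (F : {set E} -> R).
Implicit Types (x y z p d : E -> R) (a b c : E) (A B C D : {set E}).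
Hypothesis F0 : F set0 = 0.
Hypothesis Fsub : forall A B, F (A :|: B) + F (A :&: B) <= F A + F B.

Local Notation in_base := (in_base F).
Local Notation tight := (tight F).
Local Notation arr := (arr F).
Local Notation eqv := (eqv F).
Local Notation cls := (cls F).

Lemma cls_eq p a b : eqv p a b -> cls p a = cls p b.
Proof.
move=> ab; apply/setP => c; rewrite !inE; apply/idP/idP; last exact: eqv_trans.
by apply: eqv_trans; rewrite eqv_sym.
Qed.

Lemma tight_adv p t d A : sm d A = 0 -> A \in tight p -> A \in tight (adv p t d).
Proof. by move=> d0; rewrite !in_tight sm_adv d0 mulr0 addr0. Qed.

Lemma dlt0 p a b A : eqv p a b -> A \in tight p -> sm (dlt R a b) A = 0.
Proof. by move=> ab tA; rewrite sm_dlt (eqv_mem ab tA) subrr. Qed.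

Lemma tight_adv_dlt p t a b : eqv p a b -> tight p \subset tight (adv p t (dlt R a b)).
Proof.
by move=> ab; apply/subsetP => A tA; apply: tight_adv => //; apply: dlt0 tA.
Qed.

(** The set blocking the move contains a but not b, so it was not tight at p; this forces a positive
    step. *)
Lemma extent p a b : in_base p -> eqv p a b -> a != b ->
  exists2 t, 0 < t & in_base (adv p t (dlt R a b)) /\
    exists2 D, D \in tight (adv p t (dlt R a b)) & (a \in D) && (b \notin D).
Proof.
move=> Bp ab anb; have [||t t0 [Bz [D tD dD]]] := @exit_point _ _ _ _ Bp (dlt R a b) [set a].
- by rewrite sm_dlt !inE subrr.
- by rewrite sm_dlt !inE eqxx eq_sym (negPf anb) subr0.
have sepD : (a \in D) && (b \notin D).
  by move: dD; rewrite sm_dlt; case: (a \in D); case: (b \in D) => //= ?; lra.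
exists t; last by split => //; exists D.
rewrite lt_neqAle t0 andbT; apply/eqP => t00; move: tD.
rewrite in_tight sm_adv -t00 mul0r addr0 -in_tight => /(eqv_mem ab).
by case/andP: sepD => ->; case: (b \in D).
Qed.

Lemma split_class p a b : in_base p -> eqv p a b -> a != b ->
  exists z A, [/\ in_base z, tight p \proper tight z, A \subset cls p a,
      (a \in A) != (b \in A)
    & forall c c', eqv z c c' = eqv p c c' && ((c \in A) == (c' \in A))].
Proof.
move=> Bp ab anb; have [t t0 [Bz [D tD sepD]]] := extent Bp ab anb.
have pz : tight p \proper tight (adv p t (dlt R a b)).
  rewrite properE tight_adv_dlt //=; apply/subsetPn; exists D => //.
  by apply/negP => /(eqv_mem ab); case/andP: sepD => ->; case: (b \in D).
have [z [A [a' [b' [[Bz' pz' z'z] [sA _ _ _ eqz]]]]]] := facet F0 Fsub Bp Bz pz.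
(* If a and b stayed together, the sets tight at z would have the same sum at p as at the end of the
   move, where they are tight; so they would all be tight at p. *)
have sepA : (a \in A) != (b \in A).
  have [_ [D' tD' ntD']] := properP pz'.
  apply: contra ntD' => /eqP eA.
  have ez : eqv z a b by rewrite eqz ab eA eqxx.
  move: (subsetP z'z _ tD'); rewrite !in_tight sm_adv sm_dlt (eqv_mem ez tD').
  by rewrite subrr mulr0 addr0.
exists z, A; split => //.
suff a'a : eqv p a' a by rewrite -(cls_eq a'a).
have [aA|aA] := boolP (a \in A); first by have := subsetP sA _ aA; rewrite inE.
have bA : b \in A by move: sepA; rewrite (negPf aA); case: (b \in A).
have := subsetP sA _ bA; rewrite inE => /eqv_trans; apply; by rewrite eqv_sym.
Qed.

(** A set tight at a midpoint is tight at both ends, so the smallest number of tight sets gives the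
    smallest family. There [arr] is symmetric, since a one-way exchange would lose one more tight
    set. *)
Lemma min_point x : in_base x -> exists p, [/\ in_base p,
  forall y, in_base y -> tight p \subset tight y & forall a b, arr p a b -> arr p b a].
Proof.
move=> Bx; have [p Bp minp] := ex_min_tight F Bx; exists p; split => //.
  move=> y By; pose d c := y c - p c; pose q := adv p (1 / 2) d.
  have qA A : sm q A = (sm p A + sm y A) / 2.
    by rewrite /q sm_adv [sm d A]sumrB -!/(sm _ A); lra.
  have Bq : in_base q.
    split=> [A|]; rewrite qA; last by rewrite Bp.2 By.2; lra.
    by have := Bp.1 A; have := By.1 A; lra.
  have tq A : A \in tight q -> (A \in tight p) && (A \in tight y).
    rewrite !in_tight qA => /eqP h; have := Bp.1 A; have := By.1 A => *.
    by apply/andP; split; apply/eqP; lra.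
  have sqp : tight q \subset tight p by apply/subsetP => A /tq/andP[].
  have /eqP <- : tight q == tight p by rewrite eqEcard sqp minp.
  by apply/subsetP => A /tq/andP[].
move=> a b ab; apply: contrapT => /negP /narrP[D tD /andP[bD aD]].
have [e e0 [Bm tm]] := exchange_step Bp ab.
have := minp _ Bm; rewrite leqNgt => /negP; apply; apply: proper_card.
rewrite properE tm; apply/andP; split; first by apply/subsetP => A /setIdP[].
by apply/subsetPn; exists D => //; rewrite inE tD bD (negPf aD).
Qed.

(** Where the number of tight sets is largest, no class can be split further; these points will be
    the vertices. *)
Lemma no_nontrivial_class x : in_base x ->
  exists2 q, in_base q & forall a b, eqv q a b -> a = b.
Proof.
move=> Bx; have [q Bq maxq] := ex_max_tight F Bx; exists q => // a b ab.
apply/eqP; apply: contrapT => /negP anb.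
have [z [A [Bz qz _ _ _]]] := split_class Bq ab anb.
by have := maxq _ Bz; rewrite leqNgt (proper_card qz).
Qed.

(** The conditions say that d lives on [U] with sum zero and that e vanishes on [U]. Where [U] is
    tight the polytope is a product of a factor on [U] and one off [U], so the moves combine freely.
    A set tight after the first move is cut down to [U], one tight after the second is enlarged by
    [U], so that the other move does not affect it. *)
Lemma product_move p d e U : in_base p -> U \in tight p ->
  (forall A, sm d (A :|: U) = 0) -> (forall A, sm e (A :&: U) = 0) ->
  in_base (adv p 1 d) -> in_base (adv p 1 e) ->
  [/\ in_base (adv (adv p 1 d) 1 e),
      forall D, D \in tight (adv p 1 d) -> D :&: U \in tight (adv (adv p 1 d) 1 e)
    & forall D, D \in tight (adv p 1 e) -> D :|: U \in tight (adv (adv p 1 d) 1 e)].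
Proof.
move=> Bp tU dU eU Bd Be.
have dU0 : sm d U = 0 by have := dU set0; rewrite set0U.
have eU0 : sm e U = 0 by have := eU setT; rewrite setTI.
have tUd : U \in tight (adv p 1 d) by exact: tight_adv.
have tUe : U \in tight (adv p 1 e) by exact: tight_adv.
split.
- split=> [A|].
    have := sm_UI (adv (adv p 1 d) 1 e) A U.
    have := Bd.1 (A :&: U); have := Be.1 (A :|: U); have := Fsub A U.
    move: tU; rewrite in_tight !sm_adv dU eU dU0 eU0 => /eqP tU *; lra.
  by have := Be.2; rewrite !sm_adv; have := dU setT; rewrite setTU => ->; lra.
- move=> D tD; have [_] := tightUI Fsub Bd tD tUd; exact: tight_adv.
move=> D tD; have [+ _] := tightUI Fsub Be tD tUe.
by rewrite !in_tight !sm_adv dU mulr0 addr0.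
Qed.

Lemma adv_dlt p t a b : adv p t (dlt R a b) = adv p 1 (fun c => t * dlt R a b c).
Proof. by apply/funext => c; rewrite /adv mul1r. Qed.

Lemma sm_dltM t a b A :
  sm (fun c => t * dlt R a b c) A = t * ((a \in A)%:R - (b \in A)%:R).
Proof. by rewrite -sm_dlt /sm mulr_sumr. Qed.

Lemma product_dlt p s t i k j l : in_base p ->
  eqv p i k -> eqv p j l -> ~~ eqv p i j ->
  in_base (adv p s (dlt R i k)) -> in_base (adv p t (dlt R j l)) ->
  let y := adv (adv p s (dlt R i k)) t (dlt R j l) in
  [/\ in_base y,
    forall D, D \in tight (adv p s (dlt R i k)) -> (i \in D) && (k \notin D) ->
      exists2 D', D' \in tight y & [&& i \in D', k \notin D' & (j \in D') == (l \in D')]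
  & forall D, D \in tight (adv p t (dlt R j l)) -> (j \in D) && (l \notin D) ->
      exists2 D', D' \in tight y & [&& j \in D', l \notin D' & (i \in D') == (k \in D')]].
Proof.
move=> Bp ik jl nij; rewrite !adv_dlt => Bd Be /=.
(* Inequivalence does not tell which of the two classes the separating tight set contains; the cases
   are mirror images. *)
have sep : exists U, U \in tight p /\ ((i \in U) && (j \notin U) \/ (j \in U) && (i \notin U)).
  move: nij; rewrite negb_and => /orP[] /narrP[U tU h]; exists U; split => //.
    by left. by right.
case: sep => U [tU [] /andP[]].
  move=> iU jU; have kU : k \in U by rewrite -(eqv_mem ik tU).
  have lU : l \notin U by rewrite -(eqv_mem jl tU).
  have dU A : sm (fun c => s * dlt R i k c) (A :|: U) = 0.
    by rewrite sm_dltM !inE iU kU !orbT subrr mulr0.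
  have eU A : sm (fun c => t * dlt R j l c) (A :&: U) = 0.
    by rewrite sm_dltM !inE (negPf jU) (negPf lU) !andbF subrr mulr0.
  have [By h1 h2] := product_move Bp tU dU eU Bd Be.
  split => // D tD sepD.
    by exists (D :&: U); rewrite ?h1 // !inE iU (negPf jU) (negPf lU) !andbF /= !andbT kU andbT.
  by exists (D :|: U); rewrite ?h2 // !inE iU kU (negPf jU) (negPf lU) !orbT !orbF eqxx andbT.
move=> jU iU; have lU : l \in U by rewrite -(eqv_mem jl tU).
have kU : k \notin U by rewrite -(eqv_mem ik tU).
have dU A : sm (fun c => t * dlt R j l c) (A :|: U) = 0.
  by rewrite sm_dltM !inE jU lU !orbT subrr mulr0.
have eU A : sm (fun c => s * dlt R i k c) (A :&: U) = 0.
  by rewrite sm_dltM !inE (negPf iU) (negPf kU) !andbF subrr mulr0.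
have [By h1 h2] := product_move Bp tU dU eU Be Bd.
have -> : adv (adv p 1 (fun c => s * dlt R i k c)) 1 (fun c => t * dlt R j l c)
    = adv (adv p 1 (fun c => t * dlt R j l c)) 1 (fun c => s * dlt R i k c).
  by apply/funext => c; rewrite /adv; ring.
split => // D tD sepD.
  by exists (D :|: U); rewrite ?h2 // !inE jU lU (negPf iU) (negPf kU) !orbT !orbF eqxx andbT.
by exists (D :&: U); rewrite ?h1 // !inE jU (negPf iU) (negPf kU) !andbF /= !andbT lU andbT.
Qed.

Lemma adv_dltN p t a b : adv p (- t) (dlt R a b) = adv p t (dlt R b a).
Proof. by apply/funext => c; rewrite /adv /dlt; ring. Qed.

(** Fixed class sums leave two free parameters, and [product_dlt] makes their bounds independent.
    The last clause identifies the corners as vertices. *)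
Lemma rectangle p i j k l : in_base p -> i != k -> j != l ->
  cls p i = [set i; k] -> cls p j = [set j; l] -> ~~ eqv p i j ->
  (forall c, c \notin cls p i -> c \notin cls p j -> cls p c = [set c]) ->
  let pt s t := adv (adv p s (dlt R i k)) t (dlt R j l) in
  exists s0 s1 t0 t1, [/\ [&& 0 < s0, 0 < s1, 0 < t0 & 0 < t1],
    forall x, in_base x /\ tight p \subset tight x <->
      exists s t, -s0 <= s <= s1 /\ -t0 <= t <= t1 /\ x = pt s t
    & forall s t x, s = - s0 \/ s = s1 -> t = - t0 \/ t = t1 ->
        in_base x -> tight (pt s t) \subset tight x -> x = pt s t].
Proof.
move=> Bp nik njl ci cj nij cc pt.
have ik : eqv p i k by have : k \in cls p i; [rewrite ci !inE eqxx orbT | rewrite inE].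
have jl : eqv p j l by have : l \in cls p j; [rewrite cj !inE eqxx orbT | rewrite inE].
have ki : eqv p k i by rewrite eqv_sym.
have lj : eqv p l j by rewrite eqv_sym.
have [s1 s1p [Bs1 [Ds1 tDs1 sDs1]]] := extent Bp ik nik.
have [t1 t1p [Bt1 [Dt1 tDt1 sDt1]]] := extent Bp jl njl.
have nki : k != i by rewrite eq_sym.
have nlj : l != j by rewrite eq_sym.
have [s0 s0p [Bs0 [Ds0 tDs0 sDs0]]] := extent Bp ki nki.
have [t0 t0p [Bt0 [Dt0 tDt0 sDt0]]] := extent Bp lj nlj.
have ncls a b : a \in cls p i -> b \in cls p j -> ~~ eqv p a b.
  rewrite !inE => ia jb; apply: contra nij => ab.
  by apply: eqv_trans ia _; apply: eqv_trans ab _; rewrite eqv_sym.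
have ii : i \in cls p i by rewrite inE eqv_refl.
have kk : k \in cls p i by rewrite inE.
have jj : j \in cls p j by rewrite inE eqv_refl.
have ll : l \in cls p j by rewrite inE.
have neq a b : a \in cls p i -> b \in cls p j -> (a == b) = false.
  by move=> ia jb; apply/eqP => ab; have := ncls _ _ ia jb; rewrite ab eqv_refl.
have tp s t : tight p \subset tight (pt s t).
  apply/subsetP => A tA; apply: tight_adv; first exact: dlt0 jl tA.
  by apply: tight_adv => //; apply: dlt0 ik tA.
have line a b u v w : 0 < u -> 0 < v -> in_base (adv p u (dlt R a b)) ->
    in_base (adv p v (dlt R b a)) -> - v <= w <= u -> in_base (adv p w (dlt R a b)).
  move=> u0 v0 Bu Bv vwu; split=> [A|]; last first.
    by rewrite sm_adv sm_dlt !inE subrr mulr0 addr0 Bp.2.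
  have := Bu.1 A; have := Bv.1 A; rewrite !sm_adv !sm_dlt.
  by case: (a \in A); case: (b \in A) => /=; lra.
have inside s t : -s0 <= s <= s1 -> -t0 <= t <= t1 -> in_base (pt s t).
  move=> hs ht; have [] // := @product_dlt p s t i k j l Bp ik jl nij.
    exact: line Bs1 Bs0 hs.
  exact: line Bt1 Bt0 ht.
have plane x : in_base x -> tight p \subset tight x ->
    x = pt (x i - p i) (x j - p j).
  move=> Bx px; have sum a := cls_sum F0 Fsub a Bp Bx px.
  have two a b : a != b -> x a + x b = sm x [set a; b].
    by move=> ab; rewrite /sm big_setU1 ?big_set1 // inE.
  have two' a b : a != b -> p a + p b = sm p [set a; b].
    by move=> ab; rewrite /sm big_setU1 ?big_set1 // inE.
  have ei : x i + x k = p i + p k by rewrite two // two' // -ci sum.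
  have ej : x j + x l = p j + p l by rewrite two // two' // -cj sum.
  apply/funext => c; rewrite /pt /adv /dlt.
  have [cI|cI] := boolP (c \in cls p i).
    rewrite (neq c j) // (neq c l) // subrr mulr0 addr0.
    move: cI; rewrite ci !inE => /orP[] /eqP ->.
      by rewrite eqxx (negPf nik) /=; lra.
    by rewrite eqxx (negPf nki) /=; lra.
  have [cJ|cJ] := boolP (c \in cls p j).
    rewrite (eq_sym c i) (eq_sym c k) (neq i c) // (neq k c) // subrr mulr0 addr0.
    move: cJ; rewrite cj !inE => /orP[] /eqP ->.
      by rewrite eqxx (negPf njl) /=; lra.
    by rewrite eqxx (negPf nlj) /=; lra.
  have := sum c; rewrite cc // /sm !big_set1 => ->.
  move: cI cJ; rewrite ci cj !inE !negb_or => /andP[/negPf-> /negPf->].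
  by move=> /andP[/negPf-> /negPf->] /=; lra.
have sm_plane x D : in_base x -> tight p \subset tight x -> sm x D
    = sm p D + (x i - p i) * ((i \in D)%:R - (k \in D)%:R)
      + (x j - p j) * ((j \in D)%:R - (l \in D)%:R).
  move=> Bx px; have /= := congr1 (fun f => sm f D) (plane x Bx px).
  by rewrite !sm_adv !sm_dlt.
(* Each corner carries two tight sets, each separating one pair and not the other, so each bounds
   one parameter alone. The orientations of the pairs encode the four sign choices. *)
have corner a b a' b' u v s t :
    ((a = i /\ b = k) /\ s = u) \/ ((a = k /\ b = i) /\ s = - u) ->
    ((a' = j /\ b' = l) /\ t = v) \/ ((a' = l /\ b' = j) /\ t = - v) ->
    in_base (adv p u (dlt R a b)) -> in_base (adv p v (dlt R a' b')) ->
    (exists2 D, D \in tight (adv p u (dlt R a b)) & (a \in D) && (b \notin D)) ->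
    (exists2 D, D \in tight (adv p v (dlt R a' b')) & (a' \in D) && (b' \notin D)) ->
    (exists2 D, D \in tight (pt s t) & [&& a \in D, b \notin D & (j \in D) == (l \in D)])
    /\ (exists2 D, D \in tight (pt s t) & [&& a' \in D, b' \notin D & (i \in D) == (k \in D)]).
  move=> hab hab' Bu Bv [D tD sD] [D' tD' sD'].
  have eab : eqv p a b by case: hab => [[[-> ->] _]|[[-> ->] _]].
  have eab' : eqv p a' b' by case: hab' => [[[-> ->] _]|[[-> ->] _]].
  have nab : ~~ eqv p a a'.
    by case: hab => [[[-> _] _]|[[-> _] _]]; case: hab' => [[[-> _] _]|[[-> _] _]]; apply: ncls.
  have [_ /(_ D tD sD) h1 /(_ D' tD' sD') h2] := @product_dlt p u v a b a' b' Bp eab eab' nab Bu Bv.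
  have ept : adv (adv p u (dlt R a b)) v (dlt R a' b') = pt s t.
    rewrite /pt; case: hab => [[[-> ->] ->]|[[-> ->] ->]];
    by case: hab' => [[[-> ->] ->]|[[-> ->] ->]]; rewrite ?adv_dltN.
  rewrite ept in h1 h2; split.
    case: h1 => D1 tD1 h; exists D1 => //.
    by case: hab' h => [[[-> ->] _]|[[-> ->] _]] //; rewrite (eq_sym (_ \in _) (_ \in _)).
  case: h2 => D1 tD1 h; exists D1 => //.
  by case: hab h => [[[-> ->] _]|[[-> ->] _]] //; rewrite (eq_sym (_ \in _) (_ \in _)).
exists s0, s1, t0, t1; split.
- by rewrite s0p s1p t0p t1p.
- move=> x; split=> [[Bx px] | [s [t [hs [ht ->]]]]]; last by split; [exact: inside|].
  exists (x i - p i), (x j - p j); rewrite -plane //.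
  (* Two opposite corners already supply all four bounds of the rectangle. *)
  have [[D1 tD1 hD1] [D2 tD2 hD2]] := corner i k j l s1 t1 s1 t1
    (or_introl (conj (conj erefl erefl) erefl)) (or_introl (conj (conj erefl erefl) erefl))
    Bs1 Bt1 (ex_intro2 _ _ Ds1 tDs1 sDs1) (ex_intro2 _ _ Dt1 tDt1 sDt1).
  have [[D3 tD3 hD3] [D4 tD4 hD4]] := corner k i l j s0 t0 (-s0) (-t0)
    (or_intror (conj (conj erefl erefl) erefl)) (or_intror (conj (conj erefl erefl) erefl))
    Bs0 Bt0 (ex_intro2 _ _ Ds0 tDs0 sDs0) (ex_intro2 _ _ Dt0 tDt0 sDt0).
  have key D u v : D \in tight (pt u v) ->
      (x i - p i) * ((i \in D)%:R - (k \in D)%:R) + (x j - p j) * ((j \in D)%:R - (l \in D)%:R)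
      <= u * ((i \in D)%:R - (k \in D)%:R) + v * ((j \in D)%:R - (l \in D)%:R).
    rewrite in_tight !sm_adv !sm_dlt => /eqP h; have := Bx.1 D.
    by rewrite (sm_plane x) //; lra.
  move: (key _ _ _ tD1) (key _ _ _ tD2) (key _ _ _ tD3) (key _ _ _ tD4).
  case/and3P: hD1 => -> /negPf -> /eqP ->; case/and3P: hD2 => -> /negPf -> /eqP ->.
  case/and3P: hD3 => -> /negPf -> /eqP ->; case/and3P: hD4 => -> /negPf -> /eqP -> /=.
  rewrite !subrr !mulr0 !subr0 !sub0r !mulr1 !addr0 !add0r !mulrN1 => *.
  split; [lra | split=> //; lra].
move=> s t x hs ht Bx ytx; have px := subset_trans (tp s t) ytx.
have [a [b [u [hab [Bu hu]]]]] : exists a b u,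
  (((a = i /\ b = k) /\ s = u) \/ ((a = k /\ b = i) /\ s = - u)) /\
  in_base (adv p u (dlt R a b)) /\
  (exists2 D, D \in tight (adv p u (dlt R a b)) & (a \in D) && (b \notin D)).
  case: hs => hs; [exists k, i, s0 | exists i, k, s1].
    by split; [right | split => //; exists Ds0].
  by split; [left | split => //; exists Ds1].
have [a' [b' [v [hab' [Bv hv]]]]] : exists a b u,
  (((a = j /\ b = l) /\ t = u) \/ ((a = l /\ b = j) /\ t = - u)) /\
  in_base (adv p u (dlt R a b)) /\
  (exists2 D, D \in tight (adv p u (dlt R a b)) & (a \in D) && (b \notin D)).
  case: ht => ht; [exists l, j, t0 | exists j, l, t1].
    by split; [right | split => //; exists Dt0].
  by split; [left | split => //; exists Dt1].
have [[D1 tD1 hD1] [D2 tD2 hD2]] := corner _ _ _ _ _ _ _ _ hab hab' Bu Bv hu hv.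
have key D : D \in tight (pt s t) ->
    (x i - p i) * ((i \in D)%:R - (k \in D)%:R) + (x j - p j) * ((j \in D)%:R - (l \in D)%:R)
    = s * ((i \in D)%:R - (k \in D)%:R) + t * ((j \in D)%:R - (l \in D)%:R).
  move=> tD; have := subsetP ytx _ tD; move: tD.
  by rewrite !in_tight (sm_plane x) // !sm_adv !sm_dlt => /eqP h /eqP; lra.
rewrite [LHS]plane //; move: (key _ tD1) (key _ tD2).
case/and3P: hD1 => h1 /negPf h2 /eqP ->; case/and3P: hD2 => h3 /negPf h4 /eqP ->.
rewrite !subrr !mulr0 !addr0 !add0r => e1 e2; congr (pt _ _).
  by move: h1 h2 e1; case: hab => [[[-> ->] _]|[[-> ->] _]] -> -> /= h; clear -h; lra.
by move: h3 h4 e2; case: hab' => [[[-> ->] _]|[[-> ->] _]] -> -> /= h; clear -h; lra.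
Qed.

End Faces.

(** * Crossing components and cyclic intervals *)

Section Crossings.
Local Open Scope ring_scope.
Variables (R : realFieldType) (n : nat).
Local Notation E := 'I_n.+1.
Variable F : {set E} -> R.
Implicit Types (x y z p d : E -> R) (a b c : E) (A B C D G : {set E}).
Hypothesis F0 : F set0 = 0.
Hypothesis Fsub : forall A B, F (A :|: B) + F (A :&: B) <= F A + F B.

Local Notation in_base := (in_base F).
Local Notation tight := (tight F).
Local Notation arr := (arr F).
Local Notation eqv := (eqv F).
Local Notation cls := (cls F).

Definition crossing x : Prop := exists i j k l : E,
  [&& (i < j)%N, (j < k)%N & (k < l)%N] /\ [/\ eqv x i k, eqv x j l & ~~ eqv x i j].

Lemma max_crossing x : in_base x -> crossing x ->
  exists p (i j k l : E),
    [/\ in_base p, [&& (i < j)%N, (j < k)%N & (k < l)%N], ~~ eqv p i j,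
      cls p i = [set i; k] /\ cls p j = [set j; l]
    & forall c, c \notin cls p i -> c \notin cls p j -> cls p c = [set c]].
Proof.
move=> Bx cx; have [p [Bp cp] maxp] :=
  @ex_max_tight _ _ F (fun y => in_base y /\ crossing y) _ (conj Bx cx).
case: (cp) => i [j [k [l [/and3P[ij jk kl] [ik jl nij]]]]].
(* By maximality a facet that separates a from b destroys every crossing; the cases below exhibit
   one that would survive. *)
have nocross a b : eqv p a b -> a != b -> exists A : {set E},
    [/\ A \subset cls p a, (a \in A) != (b \in A)
      & forall i' j' k' l' : E, (i' < j')%N -> (j' < k')%N -> (k' < l')%N ->
        eqv p i' k' -> eqv p j' l' -> ~~ eqv p i' j' ->
        (i' \in A) = (k' \in A) -> (j' \in A) = (l' \in A) -> False].
  move=> ab nab; have [z [A [Bz pz sA sepA eqz]]] := split_class F0 Fsub Bp ab nab.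
  exists A; split => // i' j' k' l' h1 h2 h3 h4 h5 h6 h7 h8.
  have: crossing z.
    exists i', j', k', l'; rewrite h1 h2 h3; split => //.
    rewrite !eqz h4 h5 h7 h8 !eqxx; split => //.
    by apply: contra h6 => /andP[].
  by move=> cz; have := maxp z (conj Bz cz); rewrite leqNgt (proper_card pz).
have njl a b : eqv p i a -> eqv p j b -> ~~ eqv p a b.
  move=> ia jb; apply: contra nij => ab.
  by apply: eqv_trans ia _; apply: eqv_trans ab _; rewrite eqv_sym.
have njl' a b : eqv p i a -> eqv p j b -> ~~ eqv p b a.
  by move=> ia jb; rewrite eqv_sym njl.
have ii := eqv_refl F p i; have jj := eqv_refl F p j.
have notin (A : {set E}) a c : A \subset cls p a -> ~~ eqv p a c -> (c \in A) = false.
  move=> sA nac; apply/negP => /(subsetP sA); rewrite inE => ac.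
  by rewrite ac in nac.
have bool3 (a b c : bool) : a != b -> c = a \/ c = b.
  by case: a; case: b; case: c => //; [left | right | right | left].
have neqP a c : eqv p i a -> eqv p j c -> (a : nat) <> c.
  by move=> ia jc /val_inj ac; have := njl _ _ ia jc; rewrite ac eqv_refl.
have lt (a b : E) : (a <= b)%N -> (a : nat) <> b -> (a < b)%N.
  by move=> h /eqP ne; rewrite ltn_neqAle ne.
exists p, i, j, k, l; split => //; first by rewrite ij jk kl.
- split; apply/setP => c; rewrite !inE; apply/idP/idP; last 2 first.
  (* The chord from i to k has j and l on different arcs. A third member c shares an arc with one of
     them and is split from that one; the other end stays with one of the two, and either pair still
     crosses i, k. *)
  + move=> jc; apply: contrapT => /negP; rewrite negb_or => /andP[cj cl].
    have sym a b : eqv p j a -> eqv p j b -> eqv p a b.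
      by move=> ja; apply: eqv_trans; rewrite eqv_sym.
    have ci := neqP _ _ ii jc; have ck := neqP _ _ ik jc.
    case: (ltnP i c) => ic; last first.
      have [A [sA sepA NC]] := nocross c l (sym _ _ jc jl) cl.
      have iA := notin A c i sA (njl' _ _ ii jc).
      have kA := notin A c k sA (njl' _ _ ik jc).
      have [e|e] := bool3 _ _ (j \in A) sepA.
        by apply: (NC c i j k (lt _ _ ic (nesym ci)) ij jk (sym _ _ jc jj) ik (njl' _ _ ii jc));
          rewrite ?iA ?kA.
      by apply: (NC i j k l ij jk kl ik jl nij); rewrite ?iA ?kA.
    case: (ltnP c k) => kc.
      have [A [sA sepA NC]] := nocross c j (sym _ _ jc jj) cj.
      have iA := notin A c i sA (njl' _ _ ii jc).
      have kA := notin A c k sA (njl' _ _ ik jc).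
      have [e|e] := bool3 _ _ (l \in A) sepA.
        by apply: (NC i c k l ic kc kl ik (sym _ _ jc jl) (njl _ _ ii jc)); rewrite ?iA ?kA.
      by apply: (NC i j k l ij jk kl ik jl nij); rewrite ?iA ?kA.
    have [A [sA sepA NC]] := nocross c l (sym _ _ jc jl) cl.
    have iA := notin A c i sA (njl' _ _ ii jc).
    have kA := notin A c k sA (njl' _ _ ik jc).
    have [e|e] := bool3 _ _ (j \in A) sepA.
      by apply: (NC i j k c ij jk (lt _ _ kc ck) ik jc nij); rewrite ?iA ?kA.
    by apply: (NC i j k l ij jk kl ik jl nij); rewrite ?iA ?kA.
  + by case/orP => /eqP ->.
  + move=> ic; apply: contrapT => /negP; rewrite negb_or => /andP[ci ck].
    have sym a b : eqv p i a -> eqv p i b -> eqv p a b.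
      by move=> ia; apply: eqv_trans; rewrite eqv_sym.
    have cj := neqP _ _ ic jj; have cl := neqP _ _ ic jl.
    case: (ltnP c j) => jc.
      have [A [sA sepA NC]] := nocross c i (sym _ _ ic ii) ci.
      have jA := notin A c j sA (njl _ _ ic jj).
      have lA := notin A c l sA (njl _ _ ic jl).
      have [e|e] := bool3 _ _ (k \in A) sepA.
        by apply: (NC c j k l jc jk kl (sym _ _ ic ik) jl (njl _ _ ic jj)); rewrite ?jA ?lA.
      by apply: (NC i j k l ij jk kl ik jl nij); rewrite ?jA ?lA.
    case: (ltnP c l) => lc.
      have [A [sA sepA NC]] := nocross c k (sym _ _ ic ik) ck.
      have jA := notin A c j sA (njl _ _ ic jj).
      have lA := notin A c l sA (njl _ _ ic jl).
      have [e|e] := bool3 _ _ (i \in A) sepA.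
        by apply: (NC i j c l ij (lt _ _ jc (nesym cj)) lc ic jl nij); rewrite ?jA ?lA.
      by apply: (NC i j k l ij jk kl ik jl nij); rewrite ?jA ?lA.
    have [A [sA sepA NC]] := nocross c i (sym _ _ ic ii) ci.
    have jA := notin A c j sA (njl _ _ ic jj).
    have lA := notin A c l sA (njl _ _ ic jl).
    have [e|e] := bool3 _ _ (k \in A) sepA.
      by apply: (NC j k l c jk kl (lt _ _ lc (nesym cl)) jl (sym _ _ ik ic) (njl' _ _ ik jj));
        rewrite ?jA ?lA.
    by apply: (NC i j k l ij jk kl ik jl nij); rewrite ?jA ?lA.
  + by case/orP => /eqP ->.
move=> c; rewrite !inE => nic njc; apply/setP => d; rewrite !inE.
apply/idP/idP => [cd | /eqP ->]; last exact: eqv_refl.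
apply: contrapT => /negP ndc.
rewrite eq_sym in ndc; have [A [sA _ NC]] := nocross c d cd ndc.
have out a b : eqv p a b -> ~~ eqv p a c -> (b \in A) = false.
  move=> ab nac; apply: notin sA _; apply: contra nac => cb.
  by apply: eqv_trans ab _; rewrite eqv_sym.
by apply: (NC i j k l ij jk kl ik jl nij); rewrite
  ?(out i i ii nic) ?(out i k ik nic) ?(out j j jj njc) ?(out j l jl njc).
Qed.

(** * Cyclic intervals and the gaps of a class *)

Definition interval0 G := ord0 \notin G /\
  forall a b c, a \in G -> c \in G -> (a < b)%N -> (b < c)%N -> b \in G.

(** An arc through 0 is described by its complement, so only linear intervals of positive elements
    occur; they correspond to the upper and lower bounds on intervals of [n]. *)
Definition cyclic_interval G := interval0 G \/ interval0 (~: G).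

Definition count_below B c : nat := #|[set b in B | (b < c)%N]|.

(* The cyclic intervals into which [B] cuts its complement; the modulus glues the
   initial and the final segment together. *)
Definition gap B (r : nat) : {set E} :=
  [set c | (c \notin B) && (count_below B c %% #|B| == r)%N].

Lemma count_below_le B c : (count_below B c <= #|B|)%N.
Proof. by apply: subset_leq_card; apply/subsetP => b /setIdP[]. Qed.

Lemma count_below_mono B b c : (b <= c)%N -> (count_below B b <= count_below B c)%N.
Proof.
move=> bc; apply: subset_leq_card; apply/subsetP => a; rewrite !inE => /andP[->] /=.
by move=> ab; apply: leq_trans ab bc.
Qed.

Lemma count_below_lt B a c :
  a \in B -> (a < c)%N -> (count_below B a < count_below B c)%N.
Proof.
move=> aB ac; apply: proper_card; rewrite properE; apply/andP; split.
  apply/subsetP => b; rewrite !inE => /andP[->] /= h; exact: ltn_trans ac.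
by apply/subsetPn; exists a; rewrite !inE aB ?ac // ltnn.
Qed.

Lemma count_belowB B c : c \in B -> (count_below B c < #|B|)%N.
Proof.
move=> cB; apply: proper_card; rewrite properE; apply/andP; split.
  by apply/subsetP => b /setIdP[].
by apply/subsetPn; exists c; rewrite ?inE ?ltnn ?andbF.
Qed.

(** A nonempty gap of positive index lies between consecutive elements of [B]. The gap of index 0
    joins what precedes [B] to what follows it, and so contains 0, unless 0 is in [B] and nothing
    precedes it. *)
Lemma gap_cyclic B r : B != set0 -> cyclic_interval (gap B r).
Proof.
rewrite -card_gt0 => B0.
have modE c : (count_below B c %% #|B|
    = if count_below B c == #|B| then 0 else count_below B c)%N.
  case: eqP => [->|ne]; first exact: modnn.
  by rewrite modn_small // ltn_neqAle count_below_le andbT; apply/eqP.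
case: (posnP r) => [-> | r0].
  have [B00|nB0] := boolP (ord0 \in B).
    have full c : c \in gap B 0 -> c \notin B /\ count_below B c = #|B|.
      rewrite inE modE => /andP[cB]; case: (eqVneq (count_below B c) #|B|) => [-> // | _ /eqP c0].
      split => //.
      have : (0 < c)%N.
        by rewrite lt0n; apply: contraNneq cB => c00; rewrite (_ : c = ord0) //; apply: val_inj.
      by move=> /(@count_below_lt B ord0 c B00); rewrite c0.
    left; split; first by rewrite inE B00.
    move=> a b c /full[aB ca] /full[cB cc] ab bc.
    have cb : count_below B b = #|B|.
      apply/eqP; rewrite eqn_leq count_below_le -ca; apply: count_below_mono.
      exact: ltnW.
    rewrite inE modE cb eqxx andbT; apply/negP => bB.
    by have := count_belowB bB; rewrite cb ltnn.
  right; split.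
    rewrite inE negbK inE nB0 modE.
    have -> : count_below B ord0 = 0%N.
      by apply/eqP; rewrite cards_eq0; apply/eqP/setP => b; rewrite !inE andbF.
    by case: ifP.
  have out c : c \in ~: gap B 0 ->
      c \in B \/ (0 < count_below B c)%N /\ (count_below B c < #|B|)%N.
    rewrite !inE modE negb_and negbK => /orP[|h]; first by left.
    right; move: h; case: (eqVneq (count_below B c) #|B|) => // ne c0.
    by rewrite lt0n c0 ltn_neqAle count_below_le ne.
  move=> a b c /out ha /out hc ab bc; rewrite !inE negb_and negbK modE.
  apply/orP; right.
  have b1 : (0 < count_below B b)%N.
    case: ha => [aB | [h _]]; first by apply: leq_ltn_trans (count_below_lt aB ab).
    by apply: leq_trans h (count_below_mono _ (ltnW ab)).
  have b2 : (count_below B b < #|B|)%N.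
    case: hc => [cB | [_ h]].
      by apply: leq_ltn_trans (count_belowB cB); apply/count_below_mono/ltnW.
    by apply: leq_ltn_trans h; apply/count_below_mono/ltnW.
  by rewrite (ltn_eqF b2) -lt0n.
left.
have val c : c \in gap B r -> c \notin B /\ count_below B c = r.
  rewrite inE modE => /andP[cB]; case: (eqVneq (count_below B c) #|B|) => [_ /eqP h | _ /eqP //].
  by rewrite -h in r0.
split.
  apply/negP => /val[_]; have -> : count_below B ord0 = 0%N.
    by apply/eqP; rewrite cards_eq0; apply/eqP/setP => b; rewrite !inE andbF.
  by move=> h; rewrite -h in r0.
move=> a b c aG /val[cB cc] ab bc; have [aB ca] := val _ aG.
have cb : count_below B b = r.
  by apply/eqP; rewrite eqn_leq -{1}cc -ca !count_below_mono // ltnW.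
rewrite inE cb -ca; move: aG; rewrite inE ca => /andP[_ ->]; rewrite andbT.
by apply/negP => bB; have := count_below_lt bB bc; rewrite cb cc ltnn.
Qed.

Lemma sm_gaps d B : B != set0 -> (forall r, sm d (gap B r) = 0) -> sm d (~: B) = 0.
Proof.
rewrite -card_gt0 => B0 h; rewrite /sm.
rewrite (partition_big (fun c => inord (count_below B c %% #|B|) : 'I_(#|E|).+1) xpredT) //=.
apply: big1 => r _; apply: etrans (h r); apply: eq_bigl => c; rewrite !inE.
congr (_ && _); rewrite -val_eqE /= inordK // ltnS.
by apply: leq_trans (max_card B); rewrite ltnW // ltn_mod.
Qed.

(** Equivalent points in different gaps of a class would form a chord with members of that class on
    both sides. *)
Lemma gap_sat x a r c c' : ~ crossing x -> eqv x c c' ->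
  c \in gap (cls x a) r -> c' \in gap (cls x a) r.
Proof.
move=> ncx cc'; set B := cls x a; rewrite !inE => /andP[cB /eqP <-].
have c'B : ~~ eqv x a c'.
  by apply: contra cB => ac'; apply: eqv_trans ac' _; rewrite eqv_sym.
rewrite c'B /= eq_sym.
suff key u v : ~~ eqv x a u -> eqv x u v -> (u < v)%N ->
    (count_below B u %% #|B| == count_below B v %% #|B|)%N.
  case: (ltngtP c c') => [lt|lt|/val_inj -> //]; first exact: key.
  by rewrite eq_sym; apply: key => //; rewrite eqv_sym.
move=> nau uv lt; apply: contrapT => /negP ne; apply: ncx.
have le := count_below_mono B (ltnW lt).
have [b [bB ub bv]] : exists b, [/\ b \in B, (u < b)%N & (b < v)%N].
  apply: contrapT => nex; case/negP: ne; suff -> : count_below B u = count_below B v by [].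
  apply: eq_card => b; rewrite !inE; apply/andP/andP => -[ab h]; split => //.
    exact: ltn_trans lt.
  rewrite ltnNge leq_eqVlt; apply/negP => /orP[/eqP/val_inj ub|ub].
    by rewrite ub ab in nau.
  by apply: nex; exists b; rewrite inE.
have nav : ~~ eqv x a v.
  by apply: contra nau => av; apply: eqv_trans av _; rewrite eqv_sym.
have xB b' : b' \in B -> eqv x b b'.
  by move: bB; rewrite !inE => ab; apply: eqv_trans; rewrite eqv_sym.
have nub b' : b' \in B -> ~~ eqv x u b' /\ ~~ eqv x b' u.
  rewrite inE => ab; have nub' : ~~ eqv x u b'; last by split => //; rewrite eqv_sym.
  apply: contra nau => ub'.
  by apply: eqv_trans ab _; rewrite eqv_sym.
(* If all of [B] lay between u and v, the counts would be 0 and [#|B|], which agree modulo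
   [#|B|]. *)
have [[b' [b'B b'u]] | [b' [b'B vb']]] :
    (exists b', b' \in B /\ (b' < u)%N) \/ (exists b', b' \in B /\ (v < b')%N).
  apply: contrapT => /not_orP[nlo nhi]; case/negP: ne.
  have -> : count_below B u = 0%N.
    apply/eqP; rewrite cards_eq0; apply/eqP/setP => b'; rewrite !inE.
    by apply/negP => /andP[h1 h2]; apply: nlo; exists b'; rewrite inE.
  suff -> : count_below B v = #|B| by rewrite modnn mod0n.
  apply: eq_card => b'; rewrite inE andb_idr // => b'B; rewrite ltnNge leq_eqVlt.
  apply/negP => /orP[/eqP/val_inj vb|vb]; last by apply: nhi; exists b'.
  by move: b'B; rewrite inE -vb (negPf nav).
- exists b', u, b, v; rewrite b'u ub bv; split => //; split => //.
    by rewrite eqv_sym xB.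
  by case: (nub _ b'B).
exists u, b, v, b'; rewrite ub bv vb'; split => //; split => //.
  exact: xB.
by case: (nub _ bB).
Qed.

Lemma cyclic_intervalC G : cyclic_interval G -> cyclic_interval (~: G).
Proof. by case=> h; [right; rewrite setCK | left]. Qed.

Lemma cyclic_inequalities y : (forall x, in_base x -> ~ crossing x) ->
  (exists x, in_base x) -> sm y setT = F setT ->
  (forall G, cyclic_interval G -> sm y G <= F G) -> in_base y.
Proof.
move=> ncr [x0 Bx0] yT yG; split => // D0; rewrite leNgt; apply/negP => yD0.
have [p [Bp minp symp]] := min_point Bx0.
have symE a b : arr p a b -> eqv p a b by move=> ab; rewrite /eqv ab symp.
have tightC A : A \in tight p -> ~: A \in tight p.
  move=> tA; apply: tight_closed => // a b; rewrite !inE => aA /symp/arrP ba.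
  by apply: contra aA; apply: ba.
pose d c := y c - p c.
have smd A : sm d A = sm y A - sm p A by rewrite /sm sumrB.
(* The complement of [G] is also a tight arc. The two bounds on y add up to the total, so both are
   equalities. *)
have dG G : cyclic_interval G -> G \in tight p -> sm d G = 0.
  move=> cG tG; have tG' := tightC _ tG.
  have dT A : sm d A + sm d (~: A) = 0.
    rewrite -sm_UI setUCr setICr sm0 addr0 smd yT Bp.2; ring.
  have := yG _ cG; have := yG _ (cyclic_intervalC cG); have := dT G.
  by move: tG tG'; rewrite !in_tight !smd => /eqP -> /eqP -> *; lra.
have cls0 a : cls p a != set0 by apply/set0Pn; exists a; rewrite inE eqv_refl.
have dT : sm d setT = 0 by rewrite smd yT Bp.2 subrr.
have dcls a : sm d (cls p a) = 0.
  have := sm_UI d (cls p a) (~: cls p a); rewrite setUCr setICr sm0 dT.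
  rewrite [sm d (~: _)]sm_gaps // => [|r]; first by lra.
  apply: dG; first exact: gap_cyclic.
  apply: tight_closed => // c c' cg /symE cc'; exact: gap_sat (ncr _ Bp) cc' cg.
have dt A : A \in tight p -> sm d A = 0.
  by move=> tA; apply: (@sum_cls _ _ F p) => // a b ab; apply: eqv_mem tA.
have dD0 : 0 < sm d D0 by rewrite smd subr_gt0; apply: le_lt_trans (Bp.1 D0) yD0.
have [t t0 [Bz [D tD dD]]] := exit_point Bp dT dD0.
set z := adv p t d in Bz tD.
have pz : tight p \proper tight z.
  rewrite properE minp //=; apply/subsetPn; exists D => //.
  by apply/negP => /dt h; rewrite h ltxx in dD.
have [z' [A [a [b [[Bz' pz' z'z] [sA aA bA nba eqz]]]]]] := facet F0 Fsub Bp Bz pz.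
have bB : b \notin cls z' a.
  by rewrite inE; apply: contra nba => /andP[].
pose G := gap (cls z' a) (count_below (cls z' a) b %% #|cls z' a|)%N.
have bG : b \in G by rewrite inE bB eqxx.
have aG : a \notin G by rewrite !inE eqv_refl.
have cG : cyclic_interval G.
  by apply: gap_cyclic; apply/set0Pn; exists a; rewrite inE eqv_refl.
(* By symmetry at p, an arrow of [z'] stays in a class of p. It can leave a union of classes of [z']
   only between [A] and the rest of the cut class: out of [A] it would give an arrow from b to a,
   and into [A] it starts in [cls z' a], off [G]. *)
have tG : G \in tight z'.
  apply: tight_closed => // c c' cG' cc'.
  have epc := symE _ _ (arr_sub (proper_sub pz') cc').
  have [ez|] := boolP (eqv z' c c'); first exact: gap_sat (ncr _ Bz') ez cG'.
  rewrite eqz epc /=; have [cA|cA] := boolP (c \in A) => c'A.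
    have ac : eqv p a c by have := subsetP sA _ cA; rewrite inE.
    have ab : eqv p a b by have := subsetP sA _ bA; rewrite inE.
    have bc : eqv z' b c.
      by rewrite eqz bA cA eqxx andbT; apply: eqv_trans ac; rewrite eqv_sym.
    have c'a : eqv z' c' a.
      rewrite eqz (negPf aA); move: c'A; case: (c' \in A) => // _; rewrite andbT.
      by rewrite eqv_sym; apply: eqv_trans epc.
    case/negP: nba; case/andP: bc => bc _; case/andP: c'a => c'a _.
    by apply: arr_trans bc _; apply: arr_trans cc' _.
  have c'A' : c' \in A by move: c'A; case: (c' \in A).
  have ac' : eqv p a c' by have := subsetP sA _ c'A'; rewrite inE.
  have : c \in cls z' a.
    rewrite inE eqz (negPf aA) (negPf cA) eqxx andbT.
    by apply: eqv_trans ac' _; rewrite eqv_sym.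
  by move: cG'; rewrite inE => /andP[/negPf ->].
have ntG : G \notin tight p.
  apply/negP => /(eqv_mem (a := a) (b := b)) h.
  have ab : eqv p a b by have := subsetP sA _ bA; rewrite inE.
  by move: (h ab); rewrite bG (negPf aG).
(* Tightness at z gives [t * sm d G] equal to the slack of p on [G], which is positive and at least
   [sm d G]. Hence [t >= 1]: the ray from p passes y before leaving the polytope, against the
   violation at [D0]. *)
have := subsetP z'z _ tG; rewrite in_tight sm_adv => /eqP eG.
have lG : sm p G < F G by rewrite lt_neqAle -in_tight ntG Bp.1.
have yGG := yG _ cG; have dGG := smd G; have dD0' := smd D0.
have := Bz.1 D0; rewrite sm_adv => hD0.
have dGp : 0 < sm d G.
  by rewrite ltNge; apply/negP => dG0; have := mulr_ge0_le0 t0 dG0; lra.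
have t1 : 1 <= t.
  rewrite leNgt; apply/negP => t1.
  by have : t * sm d G < sm d G; [rewrite gtr_pMl | lra].
have : sm d D0 <= t * sm d D0 by rewrite ler_peMl // ltW.
lra.
Qed.

End Crossings.

(** * Greedy point and scalar products *)

Section Greedy.
Local Open Scope ring_scope.
Variables (R : realFieldType) (m : nat) (F : {set 'I_m} -> R).
Hypothesis F0 : F set0 = 0.
Hypothesis Fsub : forall A B, F (A :|: B) + F (A :&: B) <= F A + F B.

Let below (k : nat) : {set 'I_m} := [set j : 'I_m | (j < k)%N].

(** Edmonds' greedy vertex for the natural order, a witness that the base polytope is nonempty. *)
Definition greedy (i : 'I_m) : R := F (below i.+1) - F (below i).

Let below_full : below m = setT.
Proof. by apply/setP => j; rewrite !inE ltn_ord. Qed.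

Let belowS (i : 'I_m) : below i.+1 = i |: below i.
Proof. by apply/setP => j; rewrite !inE ltnS leq_eqVlt. Qed.

Let sm_belowS (i : 'I_m) (A : {set 'I_m}) : i \in A ->
  sm greedy (A :&: below i.+1) = greedy i + sm greedy (A :&: below i).
Proof.
move=> iA; rewrite belowS setIUr (setIidPr _) ?sub1set // /sm big_setU1 //.
by rewrite !inE ltnn andbF.
Qed.

Let belowSN (k : nat) (A : {set 'I_m}) : (forall i : 'I_m, i = k :> nat -> i \notin A) ->
  A :&: below k.+1 = A :&: below k.
Proof.
move=> h; apply/setP => j; rewrite !inE ltnS leq_eqVlt andb_orr.
by case: (boolP (j == k :> nat)) => [/eqP/h /negPf ->|]; rewrite ?andbF.
Qed.

Lemma greedy_base : in_base F greedy.
Proof.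
have step k A : (k <= m)%N -> sm greedy (A :&: below k) <= F (A :&: below k).
  elim: k => [|k IH] km.
    have -> : A :&: below 0 = set0 by apply/setP => j; rewrite !inE andbF.
    by rewrite sm0 F0.
  have {}IH := IH (ltnW km); pose i := Ordinal km.
  have [iA|iA] := boolP (i \in A); last first.
    by rewrite belowSN // => j jk; rewrite (_ : j = i) //; apply: val_inj.
  rewrite -[k in k.+1]/(i : nat) sm_belowS // /greedy.
  have := Fsub (A :&: below i.+1) (below i).
  have -> : A :&: below i.+1 :|: below i = below i.+1.
    rewrite belowS; apply/setP => j; rewrite !inE.
    by case: eqP => [->|_]; rewrite ?iA //=; case: (_ < _)%N; rewrite ?orbT ?andbF.
  have -> : A :&: below i.+1 :&: below i = A :&: below i.
    by apply/setP => j; rewrite belowS !inE; case: (_ < _)%N; rewrite ?orbT ?andbT ?andbF.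
  by move: IH; rewrite -[k]/(i : nat) => *; lra.
split=> [A|]; first by have := step m A (leqnn _); rewrite below_full setIT.
have tel k : (k <= m)%N -> sm greedy (below k) = F (below k).
  elim: k => [|k IH] km.
    have -> : below 0 = set0 by apply/setP => j; rewrite !inE.
    by rewrite sm0 F0.
  pose i := Ordinal km; have := @sm_belowS i setT (in_setT _).
  rewrite !setTI -[k in k.+1]/(i : nat) => ->; rewrite /greedy IH ?(ltnW km) //.
  by rewrite -[k]/(i : nat) subrK.
by rewrite -below_full tel.
Qed.

End Greedy.

Section Dot.
Local Open Scope ring_scope.
Variables (R : realType) (n : nat).
Implicit Types (x y c u v w : 'rV[R]_n).

Lemma dotD c x y : dot c (x + y) = dot c x + dot c y.
Proof. by rewrite /dot -big_split; apply: eq_bigr => i _; rewrite mxE mulrDr. Qed.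

Lemma dotZ c a x : dot c (a *: x) = a * dot c x.
Proof. by rewrite /dot mulr_sumr; apply: eq_bigr => i _; rewrite mxE; ring. Qed.

Lemma dotN c x : dot c (- x) = - dot c x.
Proof. by rewrite -scaleN1r dotZ mulN1r. Qed.

Lemma dot0 c : dot c 0 = 0.
Proof. by rewrite -(scale0r 0) dotZ mul0r. Qed.

Lemma dotC c x : dot c x = dot x c.
Proof. by apply: eq_bigr => i _; rewrite mulrC. Qed.

Lemma dotDl c d x : dot (c + d) x = dot c x + dot d x.
Proof. by rewrite dotC dotD !(dotC x). Qed.

Lemma dotZl a c x : dot (a *: c) x = a * dot c x.
Proof. by rewrite dotC dotZ dotC. Qed.

Lemma dot_delta i x : dot (delta_mx ord0 i) x = x ord0 i.
Proof.
rewrite /dot (bigD1 i) //= mxE !eqxx mul1r big1 ?addr0 // => j ji.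
by rewrite mxE (negPf ji) andbF mul0r.
Qed.

Lemma e_E (J : {set 'I_n}) i : e_ R J ord0 i = (i \in J)%:R.
Proof.
rewrite /e_ summxE; case: (boolP (i \in J)) => iJ.
  rewrite (bigD1 i) //= mxE !eqxx big1 ?addr0 // => j /andP[_ ji].
  by rewrite mxE eq_sym (negPf ji) andbF.
by apply: big1 => j jJ; rewrite mxE eqxx; case: eqP => // ij; rewrite ij jJ in iJ.
Qed.

Lemma dot_span c (X : seq 'rV[R]_n) u :
  (forall v, v \in X -> dot c v = 0) -> u \in <<X>>%VS -> dot c u = 0.
Proof.
move=> cX uX; rewrite (coord_span (X := in_tuple X) uX).
elim/big_ind: _ => [|v w hv hw|i _]; [exact: dot0 | by rewrite dotD hv hw addr0 |].
by rewrite dotZ cX ?mulr0 // mem_nth // size_tuple.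
Qed.

(** Dual vectors certify independence; the spanning families below have their dimension computed by
    writing down such a dual family. *)
Lemma free_dual (T : eqType) (s : seq T) (v c : T -> 'rV[R]_n) : uniq s ->
  (forall a b, a \in s -> b \in s -> dot (c a) (v b) = (a == b)%:R) ->
  free (map v s).
Proof.
elim: s => [_ _|a s IH /= /andP[as_ us] h]; first exact: nil_free.
rewrite free_cons IH //; last by move=> b d bs ds; rewrite h // inE ?bs ?ds orbT.
rewrite andbT; apply/negP => /(dot_span (c := c a)) h0.
have := h0 _; rewrite h ?inE ?eqxx // => h1; have /eqP : (1 : R) = 0.
  apply: h1 => _ /mapP[b bs ->]; rewrite h ?inE ?eqxx ?bs ?orbT //.
  by case: eqP => // ab; rewrite ab bs in as_.
by rewrite oner_eq0.
Qed.

Lemma dim_dual (T : eqType) (s : seq T) (v c : T -> 'rV[R]_n) : uniq s ->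
  (forall a b, a \in s -> b \in s -> dot (c a) (v b) = (a == b)%:R) ->
  \dim <<map v s>>%VS = size s.
Proof. by move=> us h; move: (free_dual us h); rewrite /free => /eqP ->; rewrite size_map. Qed.

(** [cu] and [cw] read off the two parameters, which makes them unique and gives the functionals
    exposing the corners. *)
Lemma unit_rectangle (F : 'rV[R]_n -> Prop) p u w cu cw :
  dot cu u = 1 -> dot cu w = 0 -> dot cw u = 0 -> dot cw w = 1 ->
  (forall x, F x <-> exists s t, 0 <= s <= 1 /\ 0 <= t <= 1 /\ x = p + s *: u + t *: w) ->
  has_dim F 2 /\
  forall v, is_vertex F v <-> v \in [:: p; p + u; p + w; p + u + w].
Proof.
move=> uu uw wu ww FE.
have Fp : F p by apply/FE; exists 0, 0; rewrite !scale0r !addr0 !lexx !ler01.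
have Fu : F (p + u) by apply/FE; exists 1, 0; rewrite scale0r scale1r addr0 !lexx !ler01.
have Fw : F (p + w) by apply/FE; exists 0, 1; rewrite scale0r scale1r addr0 !lexx !ler01.
have Fuw : F (p + u + w) by apply/FE; exists 1, 1; rewrite !scale1r !lexx !ler01.
split.
  exists p, <<map (fun b : bool => if b then u else w) [:: true; false]>>%VS; split => //.
  - move=> x /FE[s [t [_ [_ ->]]]].
    have -> : p + s *: u + t *: w - p = s *: u + t *: w by rewrite addrC !addrA addNr add0r.
    by apply: rpredD; apply: rpredZ; apply: memv_span; rewrite !inE eqxx ?orbT.
  - move=> W hW; apply/span_subvP => v; rewrite !inE => /orP[]/eqP->.
      by have := hW _ Fu; rewrite addrAC subrr add0r.
    by have := hW _ Fw; rewrite addrAC subrr add0r.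
  rewrite (@dim_dual _ _ _ (fun b : bool => if b then cu else cw)) //.
  by move=> [] [] _ _; rewrite ?uu ?uw ?wu ?ww.
have val s t a b : dot (a *: cu + b *: cw) (p + s *: u + t *: w)
    = dot (a *: cu + b *: cw) p + a * s + b * t.
  rewrite !dotDl !dotZl !dotD !dotZ uu uw wu ww; ring.
have inj s t s' t' : p + s *: u + t *: w = p + s' *: u + t' *: w -> s = s' /\ t = t'.
  move=> h; have h1 := val s t 1 0; have h2 := val s t 0 1.
  by rewrite h val in h1; rewrite h val in h2; split; lra.
have corner s t : (s = 0 \/ s = 1) -> (t = 0 \/ t = 1) ->
    is_vertex F (p + s *: u + t *: w).
  (* The coefficient is 1 where the parameter is 1 and -1 where it is 0, so only this corner is a
     maximum. *)
  move=> hs ht; exists ((2 * s - 1) *: cu + (2 * t - 1) *: cw) => x; split=> [->|].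
    split; first by apply/FE; exists s, t; case: hs => ->; case: ht => ->; rewrite !lexx !ler01.
    move=> _ /FE[s' [t' [h1 [h2 ->]]]]; rewrite !val.
    by case: hs => ->; case: ht => ->; lra.
  case=> /FE[s' [t' [h1 [h2 ->]]]] mx.
  have: F (p + s *: u + t *: w).
    by apply/FE; exists s, t; case: hs => ->; case: ht => ->; rewrite !lexx !ler01.
  move/mx; rewrite !val => h.
  have -> : s' = s by case: hs h => ->; case: ht => ->; lra.
  by have -> : t' = t by case: hs h => ->; case: ht => ->; lra.
move=> v; split.
  move=> [c hc]; have [/FE[s [t [s01 [t01 vE]]]] vmax] := (hc v).1 erefl.
  have cE s' t' : dot c (p + s' *: u + t' *: w) = dot c p + s' * dot c u + t' * dot c w.
    by rewrite !dotD !dotZ.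
  have mx s' t' : 0 <= s' <= 1 -> 0 <= t' <= 1 ->
      s' * dot c u + t' * dot c w <= s * dot c u + t * dot c w.
    move=> h1 h2; have := vmax (p + s' *: u + t' *: w).
    rewrite vE !cE => h; suff: F (p + s' *: u + t' *: w) by move/h; lra.
    by apply/FE; exists s', t'.
  have uq s' t' : 0 <= s' <= 1 -> 0 <= t' <= 1 ->
      s' * dot c u + t' * dot c w = s * dot c u + t * dot c w -> s' = s /\ t' = t.
    move=> h1 h2 h; apply: inj; rewrite -vE; apply/hc; split.
      by apply/FE; exists s', t'.
    by move=> y /vmax; rewrite vE !cE; lra.
  have o01 : 0 <= (0 : R) <= 1 by rewrite lexx ler01.
  have i01 : 0 <= (1 : R) <= 1 by rewrite lexx ler01.
  (* At an interior maximum c vanishes along u, and then moving s to 1 gives a second maximiser. *)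
  have hs : s = 0 \/ s = 1.
    have [->|s0] := eqVneq s 0; [by left | right].
    have sp : 0 < s by rewrite lt_neqAle eq_sym s0; case/andP: s01.
    have u0 : 0 <= dot c u by have := mx 0 t o01 t01; rewrite -(pmulr_rge0 _ sp); lra.
    case: (ltrP s 1) => s1; last by apply/eqP; rewrite eq_le s1 andbT; case/andP: s01.
    have u0' : (1 - s) * dot c u <= 0 by have := mx 1 t i01 t01; lra.
    have {}u0 : dot c u = 0.
      by apply/eqP; rewrite eq_le u0 andbT -(pmulr_rle0 _ (_ : 0 < 1 - s)) // subr_gt0.
    by have [] := uq 1 t i01 t01; rewrite ?u0 ?mulr0.
  have ht : t = 0 \/ t = 1.
    have [->|t0] := eqVneq t 0; [by left | right].
    have tp : 0 < t by rewrite lt_neqAle eq_sym t0; case/andP: t01.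
    have w0 : 0 <= dot c w by have := mx s 0 s01 o01; rewrite -(pmulr_rge0 _ tp); lra.
    case: (ltrP t 1) => t1; last by apply/eqP; rewrite eq_le t1 andbT; case/andP: t01.
    have w0' : (1 - t) * dot c w <= 0 by have := mx s 1 s01 i01; lra.
    have {}w0 : dot c w = 0.
      by apply/eqP; rewrite eq_le w0 andbT -(pmulr_rle0 _ (_ : 0 < 1 - t)) // subr_gt0.
    by have [] := uq s 1 s01 i01; rewrite ?w0 ?mulr0.
  by rewrite vE !inE; case: hs => ->; case: ht => ->;
    rewrite ?scale0r ?scale1r ?addr0 eqxx ?orbT.
rewrite !inE => /or4P[]/eqP->.
- by have := corner 0 0; rewrite !scale0r !addr0; apply; left.
- by have := corner 1 0; rewrite scale0r scale1r !addr0; apply; [right | left].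
- by have := corner 0 1; rewrite scale0r scale1r !addr0; apply; [left | right].
- by have := corner 1 1; rewrite !scale1r; apply; right.
Qed.

End Dot.

(** * Lifting g-polymatroids to base polytopes *)

Section Lift.
Local Open Scope ring_scope.
Variables (R : realType) (n : nat).
Implicit Types (x y v : 'rV[R]_n) (J K : {set 'I_n}) (A B : {set 'I_n.+1}).
Implicit Types (a b c : 'I_n.+1) (i : 'I_n).

Notation up i := (lift (@ord0 n) i).

Definition upset J : {set 'I_n.+1} := [set up i | i in J].
Definition dnset A : {set 'I_n} := [set i | up i \in A].

Definition lift_pt x a : R := if unlift ord0 a is Some i then x ord0 i else - \sum_i x ord0 i.

Definition unlift_pt (q : 'I_n.+1 -> R) : 'rV[R]_n := \row_i q (up i).

(** The zero vector at the added element: an exchange with 0 changes a single coordinate of R^n. *)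
Definition unit_vec a : 'rV[R]_n := if unlift ord0 a is Some i then delta_mx ord0 i else 0.

Lemma lift_pt_up x i : lift_pt x (up i) = x ord0 i.
Proof. by rewrite /lift_pt liftK. Qed.

Lemma lift_pt0 x : lift_pt x ord0 = - \sum_i x ord0 i.
Proof. by rewrite /lift_pt unlift_none. Qed.

Lemma unit_vec_up i : unit_vec (up i) = delta_mx ord0 i.
Proof. by rewrite /unit_vec liftK. Qed.

Lemma unit_vec0 : unit_vec ord0 = 0.
Proof. by rewrite /unit_vec unlift_none. Qed.

Lemma upP a : a = ord0 \/ exists i, a = up i.
Proof. by case: (unliftP ord0 a) => [i ->|->]; [right; exists i | left]. Qed.

Lemma up_pos b c : (b < c)%N -> exists i, c = up i.
Proof. by case: (upP c) => [-> //|]. Qed.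

Lemma up_lt (i i' : 'I_n) : (up i < up i')%N = (i < i')%N.
Proof. by rewrite !lift0 ltnS. Qed.

Lemma unit_vecE a i : unit_vec a ord0 i = (a == up i)%:R.
Proof.
case: (upP a) => [-> | [i' ->]]; first by rewrite unit_vec0 mxE (negPf (neq_lift _ _)).
by rewrite unit_vec_up mxE eqxx /= (inj_eq lift_inj) eq_sym.
Qed.

Lemma sum_unit_vec a : \sum_i unit_vec a ord0 i = (a != ord0)%:R.
Proof.
case: (upP a) => [-> | [i' ->]].
  by rewrite unit_vec0 eqxx; apply: big1 => i _; rewrite mxE.
rewrite (bigD1 i') //= unit_vecE eqxx big1 ?addr0 // => i ii'.
by rewrite unit_vecE (inj_eq lift_inj) eq_sym (negPf ii').
Qed.

Lemma sm_liftE x A :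
  sm (lift_pt x) A = \sum_i ((up i \in A)%:R - (ord0 \in A)%:R) * x ord0 i.
Proof.
rewrite /sm big_mkcond big_ord_recl lift_pt0 /=.
have -> : \sum_(i < n) (if up i \in A then lift_pt x (up i) else 0)
    = \sum_i (up i \in A)%:R * x ord0 i.
  by apply: eq_bigr => i _; rewrite lift_pt_up; case: ifP; rewrite ?mul1r ?mul0r.
case: ifP => _.
  rewrite -sumrN -big_split; apply: eq_bigr => i _ /=; ring.
by rewrite add0r; apply: eq_bigr => i _; rewrite subr0.
Qed.

Lemma coord_sumE x J : coord_sum x J = \sum_i (i \in J)%:R * x ord0 i.
Proof.
by rewrite /coord_sum big_mkcond; apply: eq_bigr => i _; case: ifP; rewrite ?mul1r ?mul0r.
Qed.

Lemma sm_lift x A : sm (lift_pt x) A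
  = if ord0 \in A then - coord_sum x (dnset (~: A)) else coord_sum x (dnset A).
Proof.
rewrite sm_liftE !coord_sumE; case: ifP => _; last first.
  by apply: eq_bigr => i _; rewrite inE subr0.
rewrite -sumrN; apply: eq_bigr => i _; rewrite !inE; case: (_ \in _) => /=; ring.
Qed.

Lemma mem_upset i J : (up i \in upset J) = (i \in J).
Proof. exact: mem_imset lift_inj. Qed.

Lemma ord0_upset J : ord0 \in upset J = false.
Proof. by apply/imsetP => -[i _ /eqP]; rewrite (negPf (neq_lift _ _)). Qed.

Lemma upsetK J : dnset (upset J) = J.
Proof. by apply/setP => i; rewrite inE mem_upset. Qed.

Lemma sm_upset x J : sm (lift_pt x) (upset J) = coord_sum x J.
Proof. by rewrite sm_lift ord0_upset upsetK. Qed.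

Lemma coord_sumD x y J : coord_sum (x + y) J = coord_sum x J + coord_sum y J.
Proof. by rewrite /coord_sum -big_split; apply: eq_bigr => i _; rewrite mxE. Qed.

Lemma coord_sumZ t x J : coord_sum (t *: x) J = t * coord_sum x J.
Proof. by rewrite /coord_sum mulr_sumr; apply: eq_bigr => i _; rewrite mxE. Qed.

Lemma lift_ptK x : unlift_pt (lift_pt x) = x.
Proof. by apply/rowP => i; rewrite mxE lift_pt_up. Qed.

Lemma unlift_ptK q : sm q setT = 0 -> lift_pt (unlift_pt q) = q.
Proof.
move=> q0; apply/funext => a; case: (upP a) => [-> | [i ->]]; last first.
  by rewrite lift_pt_up mxE.
rewrite lift_pt0; move: q0; rewrite /sm big_mkcond big_ord_recl !inE.
move/eqP; rewrite addr_eq0 => /eqP ->; congr (- _); apply: eq_bigr => i _.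
by rewrite inE mxE.
Qed.

Lemma lift_pt_adv x t a b :
  lift_pt (x + t *: (unit_vec a - unit_vec b)) = adv (lift_pt x) t (dlt R a b).
Proof.
apply/funext => c; rewrite /adv /dlt; case: (upP c) => [-> | [i ->]]; last first.
  by rewrite !lift_pt_up !mxE !unit_vecE ![_ == up i]eq_sym.
rewrite !lift_pt0.
have -> : \sum_i (x + t *: (unit_vec a - unit_vec b)) ord0 i
    = \sum_i x ord0 i + t * (\sum_i unit_vec a ord0 i - \sum_i unit_vec b ord0 i).
  by rewrite -sumrB mulr_sumr -big_split; apply: eq_bigr => i _; rewrite !mxE.
rewrite !sum_unit_vec ![ord0 == _]eq_sym; case: eqP; case: eqP => _ _ /=; ring.
Qed.

Variables f g : {set 'I_n} -> R.

(** The lifted point has total 0, so its sum over a set through 0 is minus the sum over the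
    complement, and the lower bound g becomes an upper bound. *)
Definition lift_fun A : R := if ord0 \in A then - g (dnset (~: A)) else f (dnset A).

Let dnset0 : dnset set0 = set0.
Proof. by apply/setP => i; rewrite !inE. Qed.

Hypothesis sp : strong_pair [set: 'I_n] f g.

Lemma lift_fun0 : lift_fun set0 = 0.
Proof. by case: sp => -[f0 _] _ _ _ _; rewrite /lift_fun inE dnset0. Qed.

Lemma lift_funT : lift_fun setT = 0.
Proof. by case: sp => -[_ g0] _ _ _ _; rewrite /lift_fun inE setCT dnset0 g0 oppr0. Qed.

(** Submodularity of f, supermodularity of g and the cross inequality are the cases where 0 lies in
    none, both or one of the two sets. *)
Lemma lift_fun_sub A B : lift_fun (A :|: B) + lift_fun (A :&: B) <= lift_fun A + lift_fun B.
Proof.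
case: sp => _ _ subf supg cr.
have mixed (C D : {set 'I_n.+1}) : ord0 \in C -> ord0 \notin D ->
    lift_fun (C :|: D) + lift_fun (C :&: D) <= lift_fun C + lift_fun D.
  move=> C0 /negPf D0; rewrite /lift_fun !inE C0 D0 /=.
  have := cr (dnset (~: C)) (dnset D) (subsetT _) (subsetT _).
  have -> : dnset (~: C) :\: dnset D = dnset (~: (C :|: D)).
    by apply/setP => i; rewrite !inE negb_or andbC.
  have -> : dnset D :\: dnset (~: C) = dnset (C :&: D).
    by apply/setP => i; rewrite !inE negbK.
  lra.
have [A0|A0] := boolP (ord0 \in A); have [B0|B0] := boolP (ord0 \in B).
- rewrite /lift_fun !inE A0 B0 /=.
  have := supg (dnset (~: A)) (dnset (~: B)) (subsetT _) (subsetT _).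
  have -> : dnset (~: A) :|: dnset (~: B) = dnset (~: (A :&: B)).
    by apply/setP => i; rewrite !inE negb_and.
  have -> : dnset (~: A) :&: dnset (~: B) = dnset (~: (A :|: B)).
    by apply/setP => i; rewrite !inE negb_or.
  lra.
- exact: mixed.
- by rewrite setUC setIC [X in _ <= X]addrC; apply: mixed.
rewrite /lift_fun !inE (negPf A0) (negPf B0) /=.
have := subf (dnset A) (dnset B) (subsetT _) (subsetT _).
have -> : dnset A :|: dnset B = dnset (A :|: B) by apply/setP => i; rewrite !inE.
by have -> : dnset A :&: dnset B = dnset (A :&: B) by apply/setP => i; rewrite !inE.
Qed.

Lemma gpoly_base x : gpoly [set: 'I_n] f g x <-> in_base lift_fun (lift_pt x).
Proof.
split=> [[_ h] | [h _]].
  split=> [A|]; rewrite sm_lift /lift_fun.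
    case: ifP => _; first by rewrite lerN2; case/andP: (h (dnset (~: A)) (subsetT _)).
    by case/andP: (h (dnset A) (subsetT _)).
  case: sp => -[_ g0] _ _ _ _; rewrite inE setCT dnset0 g0.
  by rewrite /coord_sum big_set0 oppr0.
split=> [i | J _]; first by rewrite inE.
have := h (upset J); have := h (~: upset J).
rewrite !sm_lift /lift_fun !inE ord0_upset /= setCK upsetK lerN2 => -> ->.
by [].
Qed.

Lemma cyclic_interval_ineq x G : gpoly_interval [set: 'I_n] f g x ->
  cyclic_interval G -> sm (lift_pt x) G <= lift_fun G.
Proof.
have int A : interval0 A -> Defs.interval [set: 'I_n] (dnset A).
  move=> [A0 h]; split; first exact: subsetT.
  move=> i j k; rewrite !inE => iA kA _ ij jk.
  by apply: (h (up i) (up j) (up k)); rewrite ?up_lt.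
move=> [_ h] [] hG; rewrite sm_lift /lift_fun.
  case: (hG) => /negPf -> _; by case/andP: (h _ (int _ hG)).
have G0 : ord0 \in G by case: (hG) => + _; rewrite inE negbK.
by rewrite G0 lerN2; case/andP: (h _ (int _ hG)).
Qed.

Lemma lift_base_point : exists x, in_base lift_fun (lift_pt x).
Proof.
have B := greedy_base lift_fun0 lift_fun_sub.
by exists (unlift_pt (greedy lift_fun)); rewrite unlift_ptK // B.2 lift_funT.
Qed.

Section LiftedPolytope.
Variable Q : 'rV[R]_n -> Prop.
Hypothesis QE : forall x, Q x <-> in_base lift_fun (lift_pt x).
Local Notation tight := (tight lift_fun).

(** The sum of the normals of [TT], with coordinate 0 eliminated, exposes the face. The point p
    shows that all the bounds are attained together, so a maximiser attains each of them. *)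
Lemma tight_face (TT : {set {set 'I_n.+1}}) p : Q p -> TT \subset tight (lift_pt p) ->
  is_face Q (fun x => Q x /\ TT \subset tight (lift_pt x)).
Proof.
move=> Qp /subsetP pT.
pose c : 'rV[R]_n := \row_i \sum_(A in TT) ((up i \in A)%:R - (ord0 \in A)%:R).
have cE x : dot c x = \sum_(A in TT) sm (lift_pt x) A.
  rewrite /dot; under [RHS]eq_bigr => A _ do rewrite sm_liftE.
  rewrite exchange_big; apply: eq_bigr => i _.
  by rewrite mxE mulr_suml; apply: eq_bigr.
exists c => x; split=> [[Qx /subsetP xT] | [Qx mx]]; split => //.
  move=> y /QE[By _]; rewrite !cE; apply: ler_sum => A AT.
  by have := xT A AT; rewrite in_tight => /eqP ->.
have := mx p Qp; rewrite !cE => le.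
have [Bx _] := (QE x).1 Qx.
have sumF : \sum_(A in TT) sm (lift_pt p) A = \sum_(A in TT) lift_fun A.
  by apply: eq_bigr => A AT; have := pT A AT; rewrite in_tight => /eqP.
have z : \sum_(A in TT) (lift_fun A - sm (lift_pt x) A) = 0.
  apply/eqP; rewrite eq_le sumr_ge0 ?andbT; last by move=> A _; rewrite subr_ge0.
  by rewrite sumrB -sumF subr_le0.
apply/subsetP => A AT; rewrite in_tight eq_sym -subr_eq0.
have := psumr_eq0P (P := mem TT) (F := fun A => lift_fun A - sm (lift_pt x) A) _ z.
by move=> ->//; move=> A' _; rewrite subr_ge0.
Qed.

Lemma tight_vertex v : Q v ->
  (forall x, Q x -> tight (lift_pt v) \subset tight (lift_pt x) -> x = v) ->
  is_vertex Q v.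
Proof.
move=> Qv uq; have [c hc] := tight_face Qv (subxx (tight (lift_pt v))).
exists c => x; split=> [-> | /hc[Qx /uq]]; last by apply.
exact/hc.
Qed.

Hypothesis V01 : forall v, is_vertex Q v -> forall i, v ord0 i = 0 \/ v ord0 i = 1.

(** The corners of the minimal crossing face are vertices of Q. Along a side a coordinate moves
    between two distinct values in {0,1}, so the rectangle is a unit square at known coordinates. *)
Lemma square_face : (exists x, Q x /\ crossing lift_fun (lift_pt x)) ->
  (exists (X : {set 'I_n}) (i j k : 'I_n),
     [/\ i \notin X, j \notin X, k \notin X, (i < j)%N && (j < k)%N
      & has_2face_with_vertices Q
          [:: X :|: [set i; j]; X :|: [set j; k]; X :|: [set k]; X :|: [set i]]]) \/
  (exists (X : {set 'I_n}) (i j k l : 'I_n),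
     [/\ i \notin X, j \notin X, k \notin X /\ l \notin X, [&& (i < j)%N, (j < k)%N & (k < l)%N]
      & has_2face_with_vertices Q
          [:: X :|: [set i; j]; X :|: [set j; k]; X :|: [set k; l]; X :|: [set l; i]]]).
Proof.
move=> [x0 [/QE Bx0 cx0]].
have [p [i [j [k [l [Bp /and3P[ij jk kl] nij [ci cj] cc]]]]]] :=
  max_crossing lift_fun0 lift_fun_sub Bx0 cx0.
have nik : i != k by rewrite neq_ltn (ltn_trans ij jk).
have njl : j != l by rewrite neq_ltn (ltn_trans jk kl).
have nil : i != l by rewrite neq_ltn (ltn_trans ij (ltn_trans jk kl)).
have nij' : i != j by rewrite neq_ltn ij.
have njk : j != k by rewrite neq_ltn jk.
have nkl : k != l by rewrite neq_ltn kl.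
have [s0 [s1 [t0 [t1 [/and4P[s0p s1p t0p t1p] Fp corner]]]]] :=
  rectangle lift_fun0 lift_fun_sub Bp nik njl ci cj nij cc.
pose P := unlift_pt p.
have hP : lift_pt P = p by apply: unlift_ptK; rewrite Bp.2 lift_funT.
pose U := unit_vec i - unit_vec k; pose W := unit_vec j - unit_vec l.
pose pt s t := P + s *: U + t *: W.
have hpt s t : lift_pt (pt s t) = adv (adv p s (dlt R i k)) t (dlt R j l).
  by rewrite /pt !lift_pt_adv hP.
have lift_pt_inj x y : lift_pt x = lift_pt y -> x = y.
  by move=> h; rewrite -(lift_ptK x) h lift_ptK.
have inside s t : -s0 <= s <= s1 -> -t0 <= t <= t1 ->
    Q (pt s t) /\ tight p \subset tight (lift_pt (pt s t)).
  by move=> hs ht; rewrite QE hpt; apply/Fp; exists s, t.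
have s01 : - s0 <= - s0 <= s1 by apply/andP; split; lra.
have s11 : - s0 <= s1 <= s1 by apply/andP; split; lra.
have t01 : - t0 <= - t0 <= t1 by apply/andP; split; lra.
have t11 : - t0 <= t1 <= t1 by apply/andP; split; lra.
have vert s t : s = - s0 \/ s = s1 -> t = - t0 \/ t = t1 -> is_vertex Q (pt s t).
  move=> hs ht; apply: tight_vertex => [|x /QE Bx].
    by case: hs => ->; case: ht => ->; apply: (proj1 (inside _ _ _ _)).
  by rewrite hpt => tx; apply: lift_pt_inj; rewrite hpt; apply: corner tx.
have ptE s t c : lift_pt (pt s t) c
    = p c + s * ((c == i)%:R - (c == k)%:R) + t * ((c == j)%:R - (c == l)%:R).
  by rewrite hpt.
have v01 s t c : s = - s0 \/ s = s1 -> t = - t0 \/ t = t1 -> c != ord0 ->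
    lift_pt (pt s t) c = 0 \/ lift_pt (pt s t) c = 1.
  case: (upP c) => [-> | [c' ->]]; first by rewrite eqxx.
  by move=> hs ht _; rewrite lift_pt_up; apply: V01; apply: vert.
have S0 : - s0 = - s0 \/ - s0 = s1 by left.
have S1 : s1 = - s0 \/ s1 = s1 by right.
have T0 : - t0 = - t0 \/ - t0 = t1 by left.
have T1 : t1 = - t0 \/ t1 = t1 by right.
have pos b c : (b < c)%N -> c != ord0.
  by move=> bc; apply: contraTneq bc => ->; rewrite ltn0.
(* The side lengths are read at k and l, which are positive; i may be the added element, whose
   coordinate need not be 0 or 1. *)
have pk : p k = s1 /\ s0 + s1 = 1.
  have := v01 _ _ k S0 T0 (pos _ _ jk); have := v01 _ _ k S1 T0 (pos _ _ jk).
  rewrite !ptE eqxx (eq_sym k i) (negPf nik) (eq_sym k j) (negPf njk) (negPf nkl) /=.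
  by case=> h1; case=> h2; clear -h1 h2 s0p s1p t0p t1p; split; lra.
have pl : p l = t1 /\ t0 + t1 = 1.
  have := v01 _ _ l S0 T0 (pos _ _ kl); have := v01 _ _ l S0 T1 (pos _ _ kl).
  rewrite !ptE eqxx ![l == _]eq_sym (negPf nil) (negPf nkl) (negPf njl) /=.
  by case=> h1; case=> h2; clear -h1 h2 s0p s1p t0p t1p; split; lra.
have pj : p j = t0.
  have := v01 _ _ j S0 T0 (pos _ _ ij); have := v01 _ _ j S0 T1 (pos _ _ ij).
  rewrite !ptE eqxx (eq_sym j i) (negPf nij') (negPf njk) (negPf njl) /=.
  by case=> h1; case=> h2; clear -h1 h2 s0p s1p t0p t1p; lra.
have pi : i != ord0 -> p i = s0.
  move=> i0; have := v01 _ _ i S0 T0 i0; have := v01 _ _ i S1 T0 i0.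
  rewrite !ptE eqxx (negPf nij') (negPf nik) (negPf nil) /=.
  by case=> h1; case=> h2; clear -h1 h2 s0p s1p t0p t1p; lra.
have pc c : c != ord0 -> c \notin [:: i; j; k; l] -> p c = 0 \/ p c = 1.
  move=> c0; rewrite !inE !negb_or => /and4P[/negPf ni /negPf nj /negPf nk /negPf nl].
  have := v01 _ _ c S0 T0 c0; rewrite ptE ni nj nk nl /= !subrr !mulr0 !addr0.
  by [].
have [j' jE] := up_pos ij; have [k' kE] := up_pos jk; have [l' lE] := up_pos kl.
(* The coordinates outside the square are constant on it, hence already 0 or 1 at p. *)
pose X := [set c : 'I_n | (up c \notin [:: i; j; k; l]) && (p (up c) == 1)].
have jX : j' \notin X by rewrite inE -jE !inE eqxx !orbT.
have kX : k' \notin X by rewrite inE -kE !inE eqxx !orbT.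
have lX : l' \notin X by rewrite inE -lE !inE eqxx !orbT.
have ptX s t (J : {set 'I_n}) : (s = - s0 \/ s = s1) -> (t = - t0 \/ t = t1) ->
    (forall c : 'I_n, up c \notin [:: i; j; k; l] -> c \notin J) ->
    (forall c : 'I_n, up c \in [:: i; j; k; l] -> (c \in J) =
       ((s == s1) && (up c == i)) || ((s == - s0) && (up c == k)) ||
       ((t == t1) && (up c == j)) || ((t == - t0) && (up c == l))) ->
    pt s t = e_ R (X :|: J).
  move=> hs ht hJ hJ'; apply/rowP => c; rewrite -lift_pt_up ptE e_E inE [c \in X]inE.
  have [hc|hc] := boolP (up c \in [:: i; j; k; l]); last first.
    rewrite (negPf (hJ _ hc)) orbF /=; case: (pc (up c) _ hc) => [|h|h].
    - by rewrite eq_sym neq_lift.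
    - move: hc; rewrite !inE !negb_or => /and4P[/negPf-> /negPf-> /negPf-> /negPf->].
      by rewrite h eq_sym oner_eq0 /=; ring.
    - move: hc; rewrite !inE !negb_or => /and4P[/negPf-> /negPf-> /negPf-> /negPf->].
      by rewrite h eqxx /=; ring.
  rewrite /= hJ' //.
  have ns : (- s0 == s1) = false by rewrite lt_eqF // (lt_trans _ s1p) ?oppr_lt0.
  have nt : (- t0 == t1) = false by rewrite lt_eqF // (lt_trans _ t1p) ?oppr_lt0.
  have ns' : (s1 == - s0) = false by rewrite eq_sym.
  have nt' : (t1 == - t0) = false by rewrite eq_sym.
  case: pk => pk s01'; case: pl => pl t01'.
  have c0 : up c != ord0 by rewrite eq_sym neq_lift.
  move: hc; rewrite !inE => /or4P[]/eqP cE; move: c0; rewrite cE => c0.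
  - rewrite eqxx (negPf nij') (negPf nik) (negPf nil) pi //.
    by case: hs => ->; rewrite ?eqxx ?ns ?ns' ?andbF ?andbT /=; lra.
  - rewrite eqxx (eq_sym j i) (negPf nij') (negPf njk) (negPf njl) pj //.
    by case: ht => ->; rewrite ?eqxx ?nt ?nt' ?andbF ?andbT /=; lra.
  - rewrite eqxx (eq_sym k i) (negPf nik) (eq_sym k j) (negPf njk) (negPf nkl) pk.
    by case: hs => ->; rewrite ?eqxx ?ns ?ns' ?andbF ?andbT /=; lra.
  rewrite eqxx ![l == _]eq_sym (negPf nil) (negPf nkl) (negPf njl) pl.
  by case: ht => ->; rewrite ?eqxx ?nt ?nt' ?andbF ?andbT /=; lra.
pose F x := Q x /\ tight p \subset tight (lift_pt x).
have faceF : is_face Q F.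
  by have [QP tP] := inside (- s0) (- t0) s01 t01; apply: tight_face QP tP.
have FE x : F x <-> exists s t, 0 <= s <= 1 /\ 0 <= t <= 1 /\
    x = pt (- s0) (- t0) + s *: U + t *: W.
  have shift s t : pt (s - s0) (t - t0) = pt (- s0) (- t0) + s *: U + t *: W.
    by rewrite /pt !scalerDl; apply/rowP => c; rewrite !mxE; ring.
  split.
    move=> [/QE Bx px]; have [s [t [hs [ht xE]]]] := (Fp _).1 (conj Bx px).
    exists (s + s0), (t + t0); split; first by case: pk => _ ?; lra.
    split; first by case: pl => _ ?; lra.
    by rewrite -shift !addrK; apply: lift_pt_inj; rewrite hpt.
  move=> [s [t [hs [ht ->]]]]; rewrite -shift; apply: inside.
    by case: pk => _ ?; lra.
  by case: pl => _ ?; lra.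
have dU (c : 'I_n) : dot (- delta_mx ord0 c) U = (up c == k)%:R - (up c == i)%:R.
  by rewrite dotC dotN dotC dot_delta !mxE !unit_vecE ![_ == up c]eq_sym; ring.
have dW (c : 'I_n) : dot (- delta_mx ord0 c) W = (up c == l)%:R - (up c == j)%:R.
  by rewrite dotC dotN dotC dot_delta !mxE !unit_vecE ![_ == up c]eq_sym; ring.
have [] := @unit_rectangle _ _ F (pt (- s0) (- t0)) U W
  (- delta_mx ord0 k') (- delta_mx ord0 l') _ _ _ _ FE.
- by rewrite dU -kE eqxx eq_sym (negPf nik) subr0.
- by rewrite dW -kE (negPf nkl) eq_sym (negPf njk) subr0.
- by rewrite dU -lE ![l == _]eq_sym (negPf nkl) (negPf nil) subr0.
- by rewrite dW -lE eqxx eq_sym (negPf njl) subr0.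
move=> dimF vF.
have EU : pt (- s0) (- t0) + U = pt s1 (- t0).
  case: pk => _ e; have -> : s1 = - s0 + 1 by rewrite -e addKr.
  by rewrite /pt; apply/rowP => c; rewrite !mxE; ring.
have EW : pt (- s0) (- t0) + W = pt (- s0) t1.
  case: pl => _ e; have -> : t1 = - t0 + 1 by rewrite -e addKr.
  by rewrite /pt; apply/rowP => c; rewrite !mxE; ring.
have EUW : pt (- s0) (- t0) + U + W = pt s1 t1.
  rewrite EU; case: pl => _ e; have -> : t1 = - t0 + 1 by rewrite -e addKr.
  by rewrite /pt; apply/rowP => c; rewrite !mxE; ring.
rewrite EUW EU EW in vF.
have nt : (- t0 == t1) = false by rewrite lt_eqF // (lt_trans _ t1p) ?oppr_lt0.
have ns : (- s0 == s1) = false by rewrite lt_eqF // (lt_trans _ s1p) ?oppr_lt0.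
have nt' : (t1 == - t0) = false by rewrite eq_sym.
have ns' : (s1 == - s0) = false by rewrite eq_sym.
have upE (c c' : 'I_n) : (up c == up c') = (c == c') by rewrite (inj_eq lift_inj).
clear corner vert v01 ptE inside pc pk pl pj pi Fp EU EW EUW FE dU dW hpt.
(* When i is the added element its coordinate disappears, leaving the square on three elements. *)
case: (upP i) => [i0 | [i' iE]].
  left; exists X, j', k', l'; split => //.
    by rewrite -!up_lt -jE -kE -lE jk kl.
  exists F; split => // v; rewrite vF.
  have i0c (c : 'I_n) : (up c == i) = false by rewrite i0 eq_sym (negPf (neq_lift _ _)).
  have -> : pt (- s0) (- t0) = e_ R (X :|: [set k'; l']).
    apply: ptX => // c; rewrite !inE jE kE lE !upE ?i0c ?ns ?nt ?eqxx /=.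
      by rewrite !negb_or => /and3P[_ -> ->].
    by case: (c == j'); case: (c == k'); case: (c == l').
  have -> : pt s1 (- t0) = e_ R (X :|: [set l']).
    apply: ptX => // c; rewrite !inE jE kE lE !upE ?i0c ?ns' ?nt ?eqxx /=.
      by rewrite !negb_or => /and3P[].
    by case: (c == j'); case: (c == k'); case: (c == l').
  have -> : pt (- s0) t1 = e_ R (X :|: [set j'; k']).
    apply: ptX => // c; rewrite !inE jE kE lE !upE ?i0c ?ns ?nt' ?eqxx /=.
      by rewrite !negb_or => /and3P[-> ->].
    by case: (c == j'); case: (c == k'); case: (c == l').
  have -> : pt s1 t1 = e_ R (X :|: [set j']).
    apply: ptX => // c; rewrite !inE jE kE lE !upE ?i0c ?ns' ?nt' ?eqxx /=.
      by rewrite !negb_or => /and3P[].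
    by case: (c == j'); case: (c == k'); case: (c == l').
  rewrite !inE; split.
    by case/or4P => /eqP ->; [exists (X :|: [set k'; l']) | exists (X :|: [set l'])
      | exists (X :|: [set j'; k']) | exists (X :|: [set j'])] => //;
      rewrite !inE eqxx ?orbT.
  by case=> J; rewrite !inE => /or4P[]/eqP -> ->; rewrite eqxx ?orbT.
right; have iX : i' \notin X by rewrite inE -iE !inE eqxx.
exists X, i', j', k', l'; split => //.
  by rewrite -!up_lt -iE -jE -kE -lE ij jk kl.
exists F; split => // v; rewrite vF.
have -> : pt (- s0) (- t0) = e_ R (X :|: [set k'; l']).
  apply: ptX => // c; rewrite !inE iE jE kE lE !upE ?ns ?nt ?eqxx /=.
    by rewrite !negb_or => /and4P[_ _ -> ->].
  by case: (c == i'); case: (c == j'); case: (c == k'); case: (c == l').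
have -> : pt s1 (- t0) = e_ R (X :|: [set l'; i']).
  apply: ptX => // c; rewrite !inE iE jE kE lE !upE ?ns' ?nt ?eqxx /=.
    by rewrite !negb_or => /and4P[-> _ _ ->].
  by case: (c == i'); case: (c == j'); case: (c == k'); case: (c == l').
have -> : pt (- s0) t1 = e_ R (X :|: [set j'; k']).
  apply: ptX => // c; rewrite !inE iE jE kE lE !upE ?ns ?nt' ?eqxx /=.
    by rewrite !negb_or => /and4P[_ -> ->].
  by case: (c == i'); case: (c == j'); case: (c == k'); case: (c == l').
have -> : pt s1 t1 = e_ R (X :|: [set i'; j']).
  apply: ptX => // c; rewrite !inE iE jE kE lE !upE ?ns' ?nt' ?eqxx /=.
    by rewrite !negb_or => /and4P[-> ->].
  by case: (c == i'); case: (c == j'); case: (c == k'); case: (c == l').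
rewrite !inE; split.
  by case/or4P => /eqP ->; [exists (X :|: [set k'; l']) | exists (X :|: [set l'; i'])
    | exists (X :|: [set j'; k']) | exists (X :|: [set i'; j'])] => //;
    rewrite !inE eqxx ?orbT.
by case=> J; rewrite !inE => /or4P[]/eqP -> ->; rewrite eqxx ?orbT.
Qed.

End LiftedPolytope.

End Lift.

(** * Exchanges, restrictions and products *)

Section Exchange.
Local Open Scope ring_scope.
Variables (R : realType) (n : nat).
Implicit Types (x y v z : 'rV[R]_n) (A J K S T : {set 'I_n}).
Implicit Types (f g : {set 'I_n} -> R).

Notation up i := (lift (@ord0 n) i).
Notation hat a := (unit_vec R a).

Lemma restrE S x i : restr S x ord0 i = if i \in S then x ord0 i else 0.
Proof. by rewrite mxE. Qed.

Lemma restr_in_coord S x : in_coord S (restr S x).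
Proof. by move=> i /negPf iS; rewrite restrE iS. Qed.

Lemma restrD S x y : restr S (x + y) = restr S x + restr S y.
Proof. by apply/rowP => i; rewrite !mxE; case: ifP; rewrite ?addr0. Qed.

Lemma restrZ S t x : restr S (t *: x) = t *: restr S x.
Proof. by apply/rowP => i; rewrite !mxE; case: ifP; rewrite ?mulr0. Qed.

Lemma restr_id S x : in_coord S x -> restr S x = x.
Proof. by move=> h; apply/rowP => i; rewrite !mxE; case: ifPn => // /h. Qed.

Lemma restr_disjoint S T x : [disjoint S & T] -> in_coord S x -> restr T x = 0.
Proof.
move=> dST h; apply/rowP => i; rewrite !mxE; case: ifP => // iT.
by rewrite h // (disjointFl dST).
Qed.

Lemma restr_split S x : restr S x + restr (~: S) x = x.
Proof. by apply/rowP => i; rewrite !mxE inE; case: ifP; rewrite ?addr0 ?add0r. Qed.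

Lemma coord_sum_restr S A x : coord_sum (restr S x) A = coord_sum x (A :&: S).
Proof.
rewrite !coord_sumE; apply: eq_bigr => i _; rewrite restrE inE.
by case: (i \in S); rewrite ?andbT // andbF mulr0 mul0r.
Qed.

Lemma coord_sum_move x t (a b : 'I_n.+1) J : coord_sum (x + t *: (hat a - hat b)) J
  = coord_sum x J + t * ((a \in upset J)%:R - (b \in upset J)%:R).
Proof. by rewrite -!sm_upset lift_pt_adv sm_adv sm_dlt. Qed.

(** The ground set of the lift of R^S, so that exchanges with 0 count as moves inside R^S. *)
Definition in_ext S (a : 'I_n.+1) := (a == ord0) || (a \in upset S).

Lemma hat_in_coord S a : in_ext S a -> in_coord S (hat a).
Proof.
move=> Sa i iS; rewrite unit_vecE; case: eqP => // ai; move: Sa.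
by rewrite ai /in_ext eq_sym (negPf (neq_lift _ _)) mem_upset (negPf iS).
Qed.

Lemma hatB_in_coord S a b : in_ext S a -> in_ext S b -> in_coord S (hat a - hat b).
Proof.
move=> Sa Sb i iS; have := hat_in_coord Sa iS; have := hat_in_coord Sb iS.
by rewrite !mxE => -> ->; rewrite subrr.
Qed.

Lemma in_coord_move S x t a b : in_ext S a -> in_ext S b -> in_coord S x ->
  in_coord S (x + t *: (hat a - hat b)).
Proof.
move=> Sa Sb Sx i iS; rewrite mxE Sx // [X in _ + X]mxE (hatB_in_coord Sa Sb iS).
by rewrite mulr0 addr0.
Qed.

(* An interval that contains none or both of [i], [k], and none or both of [j],
   [l], contains none or both of [i], [j]. *)
Lemma interval_exchange S f g z e (i j k l : 'I_n.+1) :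
  (i < j)%N -> (j < k)%N -> (k < l)%N ->
  [&& in_ext S i, in_ext S j, in_ext S k & in_ext S l] -> 0 < e ->
  gpoly_interval S f g z ->
  gpoly_interval S f g (z + e *: (hat i - hat k)) ->
  gpoly_interval S f g (z + e *: (hat k - hat i)) ->
  gpoly_interval S f g (z + e *: (hat j - hat l)) ->
  gpoly_interval S f g (z + e *: (hat l - hat j)) ->
  gpoly_interval S f g (z + e *: (hat i - hat j)) /\
  gpoly_interval S f g (z + e *: (hat j - hat i)).
Proof.
move=> ij jk kl /and4P[Si Sj Sk Sl] e0 [Sz hz] [_ h1] [_ h2] [_ h3] [_ h4].
suff key J : Defs.interval S J ->
    g J <= coord_sum (z + e *: (hat i - hat j)) J <= f J /\
    g J <= coord_sum (z + e *: (hat j - hat i)) J <= f J.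
  by split; (split; first exact: in_coord_move); move=> J /key[].
move=> iJ; have [sJ cJ] := iJ.
have mid (a b c : 'I_n.+1) : (a < b)%N -> (b < c)%N -> in_ext S b ->
    a \in upset J -> c \in upset J -> b \in upset J.
  case: (upP a) => [->|[a' ->]]; first by rewrite ord0_upset.
  case: (upP b) => [->|[b' ->]]; first by rewrite ltn0.
  case: (upP c) => [->|[c' ->]]; first by rewrite ltn0.
  rewrite !up_lt /in_ext eq_sym (negPf (neq_lift _ _)) !mem_upset /=.
  by move=> ab bc Sb aJ cJ'; apply: (cJ a' b' c').
have ikj := mid i j k ij jk Sj; have jlk := mid j k l jk kl Sk.
move: (hz J iJ) (h1 J iJ) (h2 J iJ) (h3 J iJ) (h4 J iJ) => {hz h1 h2 h3 h4 mid}.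
rewrite !coord_sum_move.
case: (i \in _) ikj; case: (j \in _) jlk; case: (k \in _); case: (l \in _) => /= u v;
  try (by have := u isT isT); try (by have := v isT isT);
  by clear -e0; move=> *; split; lra.
Qed.

Lemma strong_pair_sub S f g : strong_pair [set: 'I_n] f g -> strong_pair S f g.
Proof.
move=> [h0 h1 h2 h3 h4]; split=> // [A _|A B _ _|A B _ _|A B _ _].
- by apply: h1; rewrite subsetT.
- by apply: h2; rewrite subsetT.
- by apply: h3; rewrite subsetT.
- by apply: h4; rewrite subsetT.
Qed.

Lemma gpoly_gpoly_interval S f g x : gpoly S f g x -> gpoly_interval S f g x.
Proof. by move=> [Sx h]; split=> // J [sJ _]; apply: h. Qed.

Lemma coord_sum_in_coord S x A : in_coord S x -> coord_sum x A = coord_sum x (A :&: S).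
Proof. by move=> Sx; rewrite -coord_sum_restr restr_id. Qed.

Section Splitting.
Variables f g : {set 'I_n} -> R.
Hypothesis sp : strong_pair [set: 'I_n] f g.

(** The reverse inequalities are sub- and supermodularity, so f and g are additive across [K] and
    the polyhedron is a product. *)
Definition splits K := forall A,
  f (A :&: K) + f (A :\: K) <= f A /\ g A <= g (A :&: K) + g (A :\: K).

(** For f, the cross inequalities for (K, A) and (K \ A, K) add up and g(K \ A) cancels; for g,
    exchange the roles. *)
Lemma tight_splits K : f K = g K -> splits K.
Proof.
case: sp => -[f0 g0] _ _ _ cr fgK A; have c B C := cr B C (subsetT _) (subsetT _).
have e1 : K :\: (K :\: A) = A :&: K by rewrite setDDr setDv set0U setIC.
have e2 : (K :\: A) :\: K = set0.
  by apply/setP => i; rewrite !inE; case: (i \in K); rewrite ?andbF.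
split.
  have := c (K :\: A) K; rewrite e1 e2 g0; have := c K A; lra.
have := c K (K :\: A); rewrite e1 e2 f0; have := c A K; lra.
Qed.

Lemma splitsC K : splits K -> splits (~: K).
Proof.
move=> h A; have := h A; rewrite -setDE.
have -> : A :\: ~: K = A :&: K by rewrite setDE setCK.
lra.
Qed.

Lemma tight_base K A : f K = g K -> A \subset K -> g A = f K - f (K :\: A).
Proof.
move=> fgK AK; case: sp => -[f0 g0] _ _ _ cr.
have c B C := cr B C (subsetT _) (subsetT _).
have e1 : K :\: (K :\: A) = A by rewrite setDDr setDv set0U; apply/setIidPr.
have e2 : (K :\: A) :\: K = set0.
  by apply/setP => i; rewrite !inE; case: (i \in K); rewrite ?andbF.
have e3 : A :\: K = set0 by apply/eqP; rewrite setD_eq0.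
have := c K (K :\: A); have := c A K; rewrite e1 e2 e3 f0 g0; lra.
Qed.

Lemma gpoly_restr K x : gpoly [set: 'I_n] f g x -> gpoly K f g (restr K x).
Proof.
move=> [_ h]; split; first exact: restr_in_coord.
by move=> A AK; rewrite coord_sum_restr (setIidPl AK); apply: h.
Qed.

Lemma glue_sum K x y A : in_coord K y ->
  coord_sum (y + restr (~: K) x) A = coord_sum y (A :&: K) + coord_sum x (A :\: K).
Proof.
by move=> Ky; rewrite coord_sumD coord_sum_restr -setDE -coord_sum_in_coord.
Qed.

Lemma glue K x y : splits K -> gpoly K f g y -> gpoly [set: 'I_n] f g x ->
  gpoly [set: 'I_n] f g (y + restr (~: K) x).
Proof.
move=> sK [Ky hy] [_ hx]; split=> [i|A _]; first by rewrite inE.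
rewrite glue_sum //; have := sK A; have := hy (A :&: K) (subsetIr _ _).
by have := hx (A :\: K) (subsetT _); lra.
Qed.

Lemma glue_interval K x y : splits K -> gpoly_interval K f g y ->
  gpoly [set: 'I_n] f g x -> gpoly_interval [set: 'I_n] f g (y + restr (~: K) x).
Proof.
move=> sK [Ky hy] [_ hx]; split=> [i|J [_ cJ]]; first by rewrite inE.
have iJK : Defs.interval K (J :&: K).
  split=> [|a b c]; first exact: subsetIr.
  rewrite !inE => /andP[aJ _] /andP[cJ' _] bK ab bc; rewrite bK andbT.
  by apply: (cJ a b c); rewrite ?inE.
rewrite glue_sum //; have := sK J; have := hy _ iJK.
by have := hx (J :\: K) (subsetT _); lra.
Qed.

Lemma dot_restr K c x : dot (restr K c) x = dot c (restr K x).
Proof.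
by apply: eq_bigr => i _; rewrite !restrE; case: ifP; rewrite ?mulr0 ?mul0r.
Qed.

(** Vertices of a factor extend to vertices of the whole polyhedron, which transfers the 0/1
    property to the factors. *)
Lemma glue_vertex K v q : splits K -> is_vertex (gpoly K f g) v ->
  is_vertex (gpoly [set: 'I_n] f g) q ->
  is_vertex (gpoly [set: 'I_n] f g) (v + restr (~: K) q).
Proof.
move=> sK [c hc] [d hd]; have [Kv vmax] := (hc v).1 erefl.
have [Qq qmax] := (hd q).1 erefl.
pose Q := gpoly [set: 'I_n] f g.
have rE x y : in_coord K y -> restr K (y + restr (~: K) x) = y
    /\ restr (~: K) (y + restr (~: K) x) = restr (~: K) x.
  move=> Ky; split; apply/rowP => i; rewrite !mxE inE; case: (boolP (i \in K)) => iK.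
  - by rewrite addr0.
  - by rewrite Ky.
  - by [].
  - by rewrite Ky // add0r.
have Kv' := Kv.1.
have dmax x : Q x -> dot d (restr (~: K) x) <= dot d (restr (~: K) q).
  move=> Qx; have := qmax _ (glue sK (gpoly_restr K Qq) Qx).
  by rewrite -[in X in _ <= X](restr_split K q) !dotD lerD2l.
have cmax x : Q x -> dot c (restr K x) <= dot c v.
  by move=> Qx; apply: vmax; apply: gpoly_restr.
exists (restr K c + restr (~: K) d) => x.
have wE y : dot (restr K c + restr (~: K) d) y
    = dot c (restr K y) + dot d (restr (~: K) y) by rewrite dotDl !dot_restr.
have [r1 r2] := rE q v Kv'; split=> [->|[Qx mx]].
  split; first exact: glue.
  by move=> y Qy; rewrite !wE r1 r2 lerD ?cmax ?dmax.
have := mx _ (glue sK Kv Qq); rewrite !wE r1 r2.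
have := cmax _ Qx; have := dmax _ Qx => le1 le2 le3.
have e1 : dot c (restr K x) = dot c v by lra.
have e2 : dot d (restr (~: K) x) = dot d (restr (~: K) q) by lra.
have xv : restr K x = v.
  by apply/hc; split=> [|y /vmax]; [apply: gpoly_restr | rewrite e1].
(* d exposes q only within the whole polyhedron, so the part of x off [K] is tested on a hybrid that
   agrees with q on [K]. *)
have xq : restr K q + restr (~: K) x = q.
  apply/hd; split; first by apply: glue => //; apply: gpoly_restr.
  by move=> y /qmax; rewrite dotD e2 -dotD restr_split.
have [_ r3] := rE x (restr K q) (@restr_in_coord K q).
by rewrite -[x in LHS](restr_split K) xv -[in RHS]xq r3.
Qed.

End Splitting.

(** When all classes are singletons the class sums determine every coordinate of a point of the
    face. *)
Lemma in_base_vertex f g : strong_pair [set: 'I_n] f g ->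
  exists q, is_vertex (gpoly [set: 'I_n] f g) q.
Proof.
move=> sp; have QE x := gpoly_base sp x.
have F0 := lift_fun0 sp; have Fsub := lift_fun_sub sp.
have [x0 Bx0] := lift_base_point sp.
have [q Bq triv] := no_nontrivial_class F0 Fsub Bx0.
have qK : lift_pt (unlift_pt q) = q by apply: unlift_ptK; rewrite Bq.2 lift_funT.
exists (unlift_pt q); apply: (tight_vertex QE); first by rewrite QE qK.
move=> x /QE Bx; rewrite qK => tx; rewrite -(lift_ptK x); congr unlift_pt.
apply/funext => a; have := cls_sum F0 Fsub a Bq Bx tx.
rewrite (_ : cls _ q a = [set a]) /sm ?big_set1 //.
apply/setP => b; rewrite !inE; apply/idP/eqP => [/triv -> //|->].
exact: eqv_refl.
Qed.

Lemma zero_sum_span S r x : r \in S -> in_coord S x -> coord_sum x S = 0 ->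
  x \in <<[seq delta_mx ord0 a - delta_mx ord0 r | a <- enum (S :\ r)]>>%VS.
Proof.
move=> rS Sx x0.
have -> : x = \sum_(a in S :\ r) x ord0 a *: (delta_mx ord0 a - delta_mx ord0 r).
  apply/rowP => i; rewrite summxE.
  have [->|ir] := eqVneq i r.
    have : x ord0 r = - \sum_(a in S :\ r) x ord0 a.
      move: x0; rewrite /coord_sum (big_setD1 r) //= => /eqP; rewrite addr_eq0.
      by move/eqP.
    move->; rewrite -sumrN; apply: eq_bigr => a; rewrite !inE => /andP[ar _].
    by rewrite !mxE !eqxx eq_sym (negPf ar) /=; ring.
  have [iS|iS] := boolP (i \in S); last first.
    rewrite Sx // big1 // => a; rewrite !inE => /andP[ar aS].
    have ia : (i == a) = false by apply: contraNF iS => /eqP->.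
    by rewrite !mxE ia (negPf ir) !andbF subrr mulr0.
  rewrite (big_setD1 i) ?inE ?ir ?iS //= !mxE !eqxx (negPf ir) big1 /=.
    by ring.
  move=> a; rewrite !inE => /andP[ai _]; rewrite !mxE (negPf ir) (eq_sym i a) (negPf ai).
  by rewrite !andbF subrr mulr0.
apply: rpred_sum => a aS; apply: rpredZ; apply: memv_span; apply/mapP.
by exists a; rewrite ?mem_enum.
Qed.

Lemma zero_sum_dim S r : r \in S ->
  \dim <<[seq (delta_mx ord0 a - delta_mx ord0 r : 'rV[R]_n) | a <- enum (S :\ r)]>>%VS
  = #|S|.-1.
Proof.
move=> rS; rewrite (@dim_dual _ _ _ _ _ (fun a => delta_mx ord0 a)) ?enum_uniq //.
  by rewrite -cardE [in RHS](cardsD1 r) rS.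
move=> a b; rewrite !mem_enum !inE => /andP[ar _] _.
by rewrite dot_delta !mxE !eqxx (negPf ar) subr0.
Qed.

Lemma in_coord_span T x : in_coord T x ->
  x \in <<[seq delta_mx ord0 a | a <- enum T]>>%VS.
Proof.
move=> Tx; have -> : x = \sum_(a in T) x ord0 a *: delta_mx ord0 a.
  rewrite {1}(row_sum_delta x) (bigID (mem T)) /= [X in _ + X]big1 ?addr0 //.
  by move=> a /Tx ->; rewrite scale0r.
apply: rpred_sum => a aT; apply: rpredZ; apply: memv_span; apply/mapP.
by exists a; rewrite ?mem_enum.
Qed.

Lemma coord_dim T :
  \dim <<[seq (delta_mx ord0 a : 'rV[R]_n) | a <- enum T]>>%VS = #|T|.
Proof.
rewrite (@dim_dual _ _ _ _ _ (fun a => delta_mx ord0 a)) ?enum_uniq -?cardE //.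
by move=> a b _ _; rewrite dot_delta mxE eqxx.
Qed.

End Exchange.

(** * Decomposition into connected components *)

Section Decomposition.
Local Open Scope ring_scope.
Variables (R : realType) (n : nat).
Implicit Types (x y v z : 'rV[R]_n) (A J K N S : {set 'I_n}).

Notation up i := (lift (@ord0 n) i).
Notation hat a := (unit_vec R a).

Section Moves.
Variable F : {set 'I_n.+1} -> R.

Lemma arr_of_move p e a b : 0 < e -> in_base F p ->
  in_base F (adv p e (dlt R a b)) -> arr F p a b.
Proof.
move=> e0 Bp [h _]; apply/arrP => D; rewrite in_tight => /eqP tD aD.
apply: contrapT => /negP bD; have := h D.
by rewrite sm_adv sm_dlt aD (negPf bD) tD /=; lra.
Qed.

(** Stated for all small e so that two exchanges can use the same e. *)
Lemma small_move p a b : in_base F p -> eqv F p a b -> exists2 e0, 0 < e0 &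
  forall e, 0 < e <= e0 ->
    in_base F (adv p e (dlt R a b)) /\ in_base F (adv p e (dlt R b a)).
Proof.
move=> Bp /andP[/(exchange_step Bp)[e1 e1p [B1 _]] /(exchange_step Bp)[e2 e2p [B2 _]]].
have line c d e e' : 0 < e <= e' -> in_base F (adv p e' (dlt R c d)) ->
    in_base F (adv p e (dlt R c d)).
  move=> ee' [h hT]; split=> [A|]; last first.
    by move: hT; rewrite !sm_adv sm_dlt !inE subrr !mulr0.
  have := h A; have := Bp.1 A; rewrite !sm_adv sm_dlt.
  by case: (c \in A); case: (d \in A) => /=; lra.
exists (Num.min e1 e2); first by rewrite lt_min e1p.
move=> e; rewrite le_min => /and3P[e0 le1 le2].
by split; [apply: line B1 | apply: line B2]; rewrite e0.
Qed.

End Moves.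

Section Blocks.
Variables (f g : {set 'I_n} -> R) (Q : 'rV[R]_n -> Prop).
Hypothesis sp : strong_pair [set: 'I_n] f g.
Hypothesis QE : forall x, Q x <-> gpoly [set: 'I_n] f g x.
Hypothesis QI : forall x, Q x <-> gpoly_interval [set: 'I_n] f g x.
Hypothesis V01 : forall v, is_vertex Q v -> forall i, v ord0 i = 0 \/ v ord0 i = 1.
Local Notation F := (lift_fun f g).
Variable p : 'I_n.+1 -> R.
Hypothesis Bp : in_base F p.
Hypothesis symp : forall a b, arr F p a b -> arr F p b a.

Let P : 'rV[R]_n := unlift_pt p.
Definition conn_T : {set 'I_n} := [set i | eqv F p ord0 (up i)].
Definition conn_SS : {set {set 'I_n}} :=
  equivalence_partition (fun i j => eqv F p (up i) (up j)) (~: conn_T).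
Local Notation T := conn_T.
Local Notation SS := conn_SS.

Let hP : lift_pt P = p.
Proof. by apply: unlift_ptK; rewrite Bp.2 lift_funT. Qed.

Let QP : Q P.
Proof. by apply/QE/(gpoly_base sp); rewrite hP. Qed.

Let Qmove e a b : in_base F (adv p e (dlt R a b)) <-> Q (P + e *: (hat a - hat b)).
Proof. by rewrite QE (gpoly_base sp) lift_pt_adv hP. Qed.

Let F0 := lift_fun0 sp.
Let Fsub := lift_fun_sub sp.

Lemma conn_partition : partition SS (~: T).
Proof.
apply: equivalence_partitionP => a b c _ _ _; split; first exact: eqv_refl.
move=> ab; apply/idP/idP; last exact: eqv_trans.
by apply: eqv_trans; rewrite eqv_sym.
Qed.

Lemma conn_block N i : N \in T |: SS -> i \in N ->
  N = [set j | eqv F p (up i) (up j)].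
Proof.
rewrite !inE => /orP[/eqP -> | /imsetP[k kT ->]].
  rewrite inE => zi; apply/setP => j; rewrite !inE.
  by apply/idP/idP; [apply: eqv_trans; rewrite eqv_sym | apply: eqv_trans].
rewrite !inE => /andP[iT ki]; apply/setP => j; rewrite !inE.
apply/andP/idP => [[_ kj]|ij]; first by apply: eqv_trans kj; rewrite eqv_sym.
split; last exact: eqv_trans ij.
by apply: contra iT => zj; apply: eqv_trans zj _; rewrite eqv_sym.
Qed.

Lemma conn_sub N i j : N \in T |: SS -> i \in N -> j \in N -> eqv F p (up i) (up j).
Proof. by move=> hN iN; rewrite {1}(conn_block hN iN) inE. Qed.

Lemma conn_neq N N' i j : N \in T |: SS -> N' \in T |: SS -> N != N' ->
  i \in N -> j \in N' -> ~~ eqv F p (up i) (up j).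
Proof.
move=> hN hN' ne iN jN'; apply: contra ne => ij.
have : j \in N by rewrite (conn_block hN iN) inE.
by move/(conn_block hN) => eN; rewrite eN (conn_block hN' jN').
Qed.

Lemma conn_neqT S i : S \in SS -> i \in S -> ~~ eqv F p ord0 (up i).
Proof.
move=> hS iS; have := subsetP (partitionS conn_partition hS) _ iS.
by rewrite !inE.
Qed.

Lemma not_crossing : ~ crossing F p.
Proof.
move=> [i [j [k [l [/and3P[ij jk kl] [ik jl nij]]]]]].
have [e1 e1p h1] := small_move Bp ik; have [e2 e2p h2] := small_move Bp jl.
pose e := Num.min e1 e2; have e0 : 0 < e by rewrite lt_min e1p.
have [|B1 B2] := h1 e; first by rewrite e0 ge_min lexx.
have [|B3 B4] := h2 e; first by rewrite e0 ge_min lexx orbT.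
have inT (a : 'I_n.+1) : in_ext [set: 'I_n] a.
  by rewrite /in_ext; case: (upP a) => [->|[a' ->]]; rewrite ?eqxx ?mem_upset ?inE ?orbT.
move: B1 B2 B3 B4 => /Qmove/QI B1 /Qmove/QI B2 /Qmove/QI B3 /Qmove/QI B4.
have hin : [&& in_ext [set: 'I_n] i, in_ext [set: 'I_n] j, in_ext [set: 'I_n] k
  & in_ext [set: 'I_n] l] by rewrite !inT.
have [/QI/Qmove C1 /QI/Qmove C2] :=
  interval_exchange ij jk kl hin e0 ((QI P).1 QP) B1 B2 B3 B4.
by case/negP: nij; rewrite /eqv !(arr_of_move e0 Bp).
Qed.

Lemma conn_noncrossing : noncrossing_partition SS T.
Proof.
split; first exact: conn_partition.
move=> N1 N2 h1 h2 ne [a [b [c [d [[ab bc cd] [a1 c1 b2 d2]]]]]].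
apply: not_crossing; exists (up a), (up b), (up c), (up d); rewrite !up_lt ab bc cd.
by split=> //; split; [apply: conn_sub c1 | apply: conn_sub d2 | apply: (conn_neq h1 h2)].
Qed.

(** T belongs to the component of 0, which precedes everything; members of S on both sides of some t
    in T cross the chord from 0 to t. *)
Lemma conn_surrounds S : S \in SS -> ~ surrounds S T.
Proof.
move=> hS [T0 [S1 [S2 [SE _ [/set0Pn[s1 hs1] /set0Pn[s2 hs2]] h1 h2]]]].
have [t tT] := set0Pn _ T0.
have s1S : s1 \in S by rewrite SE inE hs1.
have s2S : s2 \in S by rewrite SE inE hs2 orbT.
apply: not_crossing; exists ord0, (up s1), (up t), (up s2).
rewrite !up_lt h1 ?h2 //; split => //; split.
- by move: tT; rewrite inE.
- by apply: (conn_sub _ s1S s2S); rewrite inE hS orbT.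
exact: conn_neqT s1S.
Qed.

Lemma saturated_tight (A : {set 'I_n.+1}) : (forall a b, eqv F p a b -> a \in A -> b \in A) ->
  A \in tight F p.
Proof.
move=> h; apply: (tight_closed F0 Fsub Bp) => a b aA ab.
by apply: h aA; rewrite /eqv ab symp.
Qed.

Lemma saturated_eq K : (forall a b, eqv F p a b -> a \in upset K -> b \in upset K) ->
  f K = g K.
Proof.
move=> h; have t1 := saturated_tight h.
have t2 : ~: upset K \in tight F p.
  apply: saturated_tight => a b ab; rewrite !inE; apply: contra.
  by apply: h; rewrite eqv_sym.
have := sm_UI p (upset K) (~: upset K); rewrite setUCr setICr sm0 Bp.2 lift_funT //.
move: t1 t2; rewrite !in_tight => /eqP -> /eqP ->.
by rewrite /lift_fun !inE ord0_upset /= setCK upsetK; lra.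
Qed.

Lemma conn_tight S : S \in SS -> f S = g S.
Proof.
move=> hS; apply: saturated_eq => a b ab /imsetP[i iS ai].
have hS' : S \in T |: SS by rewrite inE hS orbT.
rewrite ai in ab; case: (upP b) => [b0 | [j bj]].
  by move: ab; rewrite b0 eqv_sym (negPf (conn_neqT hS iS)).
by rewrite bj mem_upset (conn_block hS' iS) inE -bj.
Qed.

Lemma conn_splits N : N \in T |: SS -> splits f g N.
Proof.
rewrite !inE => /orP[/eqP -> | /conn_tight]; last exact: tight_splits.
(* T lacks the element 0 of its component, so it need not be saturated in the lift; its complement
   is. *)
rewrite -[T]setCK; apply: splitsC; apply: (tight_splits sp); apply: saturated_eq.
move=> a b ab /imsetP[i + ai]; rewrite !inE => niT.
case: (upP b) => [b0 | [j bj]]; first by rewrite b0 ai eqv_sym (negPf niT) in ab.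
rewrite bj mem_upset !inE; apply: contra niT => zj.
by apply: eqv_trans zj _; rewrite -bj -ai eqv_sym.
Qed.

Lemma conn_cover i : exists2 N, N \in T |: SS & i \in N.
Proof.
have [iT|iT] := boolP (i \in T); first by exists T; rewrite // !inE eqxx.
have : i \in cover SS by rewrite (cover_partition conn_partition) inE.
by case/bigcupP => S hS iS; exists S; rewrite // inE hS orbT.
Qed.

Lemma conn_product : is_product SS T (fun N => gpoly N f g) (gpoly T f g) Q.
Proof.
move=> x; split=> [/QE Qx | [hS hT]].
  by split=> [S _|]; apply: gpoly_restr.
have hN N : N \in T |: SS -> gpoly N f g (restr N x).
  by rewrite !inE => /orP[/eqP->|/hS].
apply/QE; split=> [i|A _]; first by rewrite inE.
(* Peels off the part of A in one block at a time, using additivity of f and g across that block. *)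
move: {2}#|A| (leqnn #|A|) => m; elim: m A => [|m IH] A Am.
  have -> : A = set0 by apply/eqP; rewrite -cards_eq0 -leqn0.
  by case: sp => -[-> ->] _ _ _ _; rewrite /coord_sum big_set0 lexx.
have [->|[i iA]] := set_0Vmem A; first by apply: IH; rewrite cards0.
have [N hN' iN] := conn_cover i.
have AN : (#|A :\: N| <= m)%N.
  rewrite -ltnS; apply: leq_trans Am; apply: proper_card.
  rewrite properE subsetDl; apply/subsetPn; exists i => //; by rewrite inE iN.
have := IH _ AN; have [_ /(_ (A :&: N) (subsetIr _ _))] := hN N hN'.
rewrite coord_sum_restr -setIA setIid; have := conn_splits hN' A.
have -> : coord_sum x A = coord_sum x (A :&: N) + coord_sum x (A :\: N).
  by rewrite /coord_sum (big_setID N).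
lra.
Qed.

(** A point of the factor is completed off [N] by the coordinates of [P], a vertex by those of a
    vertex of Q; the interval description and the 0/1 property then descend. *)
Lemma conn_gpositroid N : N \in T |: SS -> gpositroid N (gpoly N f g).
Proof.
move=> hN; have sN := conn_splits hN; have spN := strong_pair_sub N sp.
have sumE y A : in_coord N y -> A \subset N ->
    coord_sum (y + restr (~: N) P) A = coord_sum y A.
  move=> Ny AN; rewrite glue_sum // (setIidPl AN).
  have -> : A :\: N = set0 by apply/eqP; rewrite setD_eq0.
  by rewrite [X in _ + X]/coord_sum big_set0 addr0.
split.
  exists f, g; split=> // y; split; first exact: gpoly_gpoly_interval.
  move=> hy; have [Ny _] := hy.
  have /QI/QE[_ hx] := glue_interval sN hy ((QE P).1 QP).
  by split=> // A AN; rewrite -sumE //; apply: hx; rewrite subsetT.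
split; first by exists f, g.
move=> v vN i; have [q qv] := in_base_vertex sp.
have [c hc] := vN; have [[Nv _] _] := (hc v).1 erefl.
have [iN|iN] := boolP (i \in N); last by left; apply: Nv.
have [c' hc'] := glue_vertex sN vN qv.
have := @V01 (v + restr (~: N) q); rewrite /is_vertex /is_face => h.
have {}h : (v + restr (~: N) q) ord0 i = 0 \/ (v + restr (~: N) q) ord0 i = 1.
  apply: h; exists c' => x; rewrite hc' QE; split=> -[h1 h2]; split=> // y.
    by move/QE; apply: h2.
  by move=> /QE; apply: h2.
by move: h; rewrite mxE restrE inE iN addr0.
Qed.

Lemma conn_move N a b : N \in T |: SS -> in_ext N a -> in_ext N b -> eqv F p a b ->
  exists2 e, 0 < e & gpoly N f g (restr N P + e *: (hat a - hat b)).
Proof.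
move=> hN Na Nb /andP[/(exchange_step Bp)[e e0 [/Qmove/QE Be _]] _]; exists e => //.
have := gpoly_restr N Be; rewrite restrD restrZ (@restr_id _ _ N (_ - _)) //.
exact: hatB_in_coord.
Qed.

(** Full dimension holds because every exchange inside a component is feasible at [P]; in T the
    exchanges with 0 give all unit vectors. *)
Lemma conn_decomposes : decomposes Q SS T.
Proof.
exists (fun N => gpoly N f g), (gpoly T f g).
have TT : T \in T |: SS by rewrite !inE eqxx.
have scale (W : {vspace 'rV[R]_n}) x e y : 0 < e -> x + e *: y - x \in W -> y \in W.
  move=> e0; rewrite addrAC subrr add0r => h.
  by rewrite -[y]scale1r -(mulVf (lt0r_neq0 e0)) -scalerA rpredZ.
split; last exact: conn_product.
- move=> S hS; have hS' : S \in T |: SS by rewrite inE hS orbT.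
  have gS := conn_tight hS; split.
    split; first exact: conn_gpositroid.
    exists f, g; split=> //; first exact: strong_pair_sub.
    by move=> A AS; apply: (tight_base sp).
  have S0 := partition_neq0 conn_partition hS.
  have [r rS] := set0Pn _ S0.
  exists (restr S P), <<[seq delta_mx ord0 a - delta_mx ord0 r | a <- enum (S :\ r)]>>%VS.
  have [_ pS] := gpoly_restr S ((QE P).1 QP).
  split; last exact: zero_sum_dim.
  + exact: (gpoly_restr S ((QE P).1 QP)).
  + move=> x [Sx hx]; apply: zero_sum_span => // [i iS|].
      by rewrite !mxE Sx // (negPf iS) subr0.
    rewrite -scaleN1r coord_sumD coord_sumZ.
    by have := hx S (subxx S); have := pS S (subxx S); rewrite gS; lra.
  move=> W hW; apply/span_subvP => _ /mapP[a + ->]; rewrite mem_enum !inE => /andP[_ aS].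
  have [||| e e0] := @conn_move S (up a) (up r) hS'.
  + by rewrite /in_ext mem_upset aS orbT.
  + by rewrite /in_ext mem_upset rS orbT.
  + exact: (conn_sub hS').
  by rewrite !unit_vec_up => /hW; apply: scale.
split; first exact: conn_gpositroid.
exists (restr T P), <<[seq delta_mx ord0 a | a <- enum T]>>%VS.
split; last exact: coord_dim.
- exact: (gpoly_restr T ((QE P).1 QP)).
- by move=> x [Tx _]; apply: in_coord_span => i iT; rewrite !mxE Tx // (negPf iT) subr0.
move=> W hW; apply/span_subvP => _ /mapP[a + ->]; rewrite mem_enum => aT.
have [||| e e0] := @conn_move T (up a) ord0 TT.
- by rewrite /in_ext mem_upset aT orbT.
- by rewrite /in_ext eqxx.
- by move: aT; rewrite inE eqv_sym.
by rewrite unit_vec_up unit_vec0 subr0 => /hW; apply: scale.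
Qed.

End Blocks.

(** * Functionals and exchanges forced by a given decomposition *)

Section Product.
Variables (Q : 'rV[R]_n -> Prop) (SS : {set {set 'I_n}}) (T : {set 'I_n}).
Hypothesis part : partition SS (~: T).
Variables (PP : {set 'I_n} -> 'rV[R]_n -> Prop) (Q0 : 'rV[R]_n -> Prop).
Hypothesis PPok : forall S, S \in SS -> positroid_polytope S (PP S) /\ full_dim_base S (PP S).
Hypothesis Q0ok : gpositroid T Q0 /\ full_dim T Q0.
Hypothesis prodQ : is_product SS T PP Q0 Q.

Lemma block_disjointT S : S \in SS -> [disjoint S & T].
Proof.
by move=> hS; rewrite disjoints_subset; apply: (partitionS part).
Qed.

Lemma block_disjoint S S' : S \in SS -> S' \in SS -> S != S' -> [disjoint S & S'].
Proof. by case/and3P: part => _ /trivIsetP h _; apply: h. Qed.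

Lemma block_base S : S \in SS -> exists2 c, 
   (forall x, PP S x -> in_coord S x) & forall x, PP S x -> coord_sum x S = c.
Proof.
move=> /PPok[[_ [f [g [sp PE base]]]] _]; exists (f S) => x /PE[Sx h] //.
have := h S (subxx S); rewrite base // setDv.
by case: sp => -[-> _] _ _ _ _; rewrite subr0 => /andP[h1 h2]; apply/eqP; rewrite eq_le h1 h2.
Qed.

Lemma block_const S : S \in SS -> exists c, forall x, Q x -> coord_sum x S = c.
Proof.
move=> hS; have [c _ hc] := block_base hS; exists c => x /prodQ[/(_ S hS) + _].
by move=> /hc; rewrite coord_sum_restr setIid.
Qed.

Lemma replace_block S x y : S \in SS -> PP S y -> Q x -> Q (y + restr (~: S) x).
Proof.
move=> hS Py /prodQ[hx hT]; have [c Sc _] := block_base hS; have Sy := Sc _ Py.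
have out K : [disjoint S & K] -> restr K (y + restr (~: S) x) = restr K x.
  move=> dSK; rewrite restrD (restr_disjoint dSK Sy) add0r; apply/rowP => i.
  by rewrite !mxE inE; case: ifP => // iK; rewrite (disjointFl dSK).
apply/prodQ; split=> [S' hS'|]; last by rewrite out // block_disjointT.
have [->|ne] := eqVneq S' S; last first.
  by rewrite out; [exact: hx | apply: block_disjoint; rewrite // eq_sym].
rewrite restrD restr_id // (_ : restr S (restr (~: S) x) = 0) ?addr0 //.
by apply/rowP => i; rewrite !mxE inE; case: (i \in S).
Qed.

Lemma replace_T x y : Q0 y -> Q x -> Q (y + restr (~: T) x).
Proof.
move=> Q0y /prodQ[hx _].
have Ty : in_coord T y by case: Q0ok => -[[f [g [_ QE _]]] _] _; case/QE: Q0y.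
apply/prodQ; split=> [S hS|].
  have d : [disjoint T & S] by rewrite disjoint_sym block_disjointT.
  rewrite restrD (restr_disjoint d Ty) add0r.
  have -> : restr S (restr (~: T) x) = restr S x; last exact: hx.
  by apply/rowP => i; rewrite !mxE inE; case: ifP => // iS; rewrite (disjointFl d).
rewrite restrD restr_id // (_ : restr T (restr (~: T) x) = 0) ?addr0 //.
by apply/rowP => i; rewrite !mxE inE; case: (i \in T).
Qed.

Section Constant.
Variable c : 'rV[R]_n.
Hypothesis cQ : forall x y, Q x -> Q y -> dot c x = dot c y.
Variable x0 : 'rV[R]_n.
Hypothesis Qx0 : Q x0.

Let kerc : {vspace 'rV[R]_n} := lker (linfun (mulmxr c^T)).

Let kercP u : (u \in kerc) = (dot c u == 0).
Proof.
rewrite memv_ker lfunE /=; apply/eqP/eqP => [/matrixP/(_ ord0 ord0) | h].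
  by rewrite !mxE => h; rewrite -[RHS]h; apply: eq_bigr => i _; rewrite mxE mulrC.
apply/matrixP => i j; rewrite !ord1 !mxE -[RHS]h.
by apply: eq_bigr => k _; rewrite mxE mulrC.
Qed.

(** Varying one factor shows that c kills its direction space, which by full dimension consists of
    all zero-sum vectors on S. *)
Lemma const_block S a b : S \in SS -> a \in S -> b \in S -> c ord0 a = c ord0 b.
Proof.
move=> hS aS bS; have [k Sk ck] := block_base hS.
have [_ [p [V [Pp Vp Vmin Vdim]]]] := PPok hS.
have VU : (V <= <<[seq delta_mx ord0 a - delta_mx ord0 b | a <- enum (S :\ b)]>>)%VS.
  apply: Vmin => x Px; apply: zero_sum_span => // [i iS|].
    by rewrite !mxE (Sk x Px) // (Sk p Pp) // subr0.
  by rewrite -scaleN1r coord_sumD coord_sumZ !ck //; ring.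
have VE : V = <<[seq delta_mx ord0 a - delta_mx ord0 b | a <- enum (S :\ b)]>>%VS.
  by apply/eqP; rewrite eqEdim VU zero_sum_dim // Vdim leqnn.
have [->//|ab] := eqVneq a b.
have: (delta_mx ord0 a - delta_mx ord0 b : 'rV[R]_n) \in V.
  by rewrite VE; apply: memv_span; apply/mapP; exists a; rewrite // mem_enum !inE ab.
have /subvP kV : (V <= kerc)%VS.
  apply: Vmin => x Px; rewrite kercP dotD dotN.
  have := cQ (replace_block hS Px Qx0) (replace_block hS Pp Qx0).
  by rewrite !dotD => h; apply/eqP; lra.
by move=> /kV; rewrite kercP dotD dotN !(dotC c) !dot_delta subr_eq0 => /eqP.
Qed.

Lemma const_T a : a \in T -> c ord0 a = 0.
Proof.
move=> aT; have [[[f [g [_ QE _]]] _] [p [V [Pp Vp Vmin Vdim]]]] := Q0ok.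
have Tc x : Q0 x -> in_coord T x by case/QE.
have VU : (V <= <<[seq delta_mx ord0 a | a <- enum T]>>)%VS.
  apply: Vmin => x Px; apply: in_coord_span => i iT.
  by rewrite !mxE (Tc x Px) // (Tc p Pp) // subr0.
have VE : V = <<[seq delta_mx ord0 a | a <- enum T]>>%VS.
  by apply/eqP; rewrite eqEdim VU coord_dim // Vdim leqnn.
have: (delta_mx ord0 a : 'rV[R]_n) \in V.
  by rewrite VE; apply: memv_span; apply/mapP; exists a; rewrite // mem_enum.
have /subvP kV : (V <= kerc)%VS.
  apply: Vmin => x Px; rewrite kercP dotD dotN.
  have := cQ (replace_T Px Qx0) (replace_T Pp Qx0).
  by rewrite !dotD => h; apply/eqP; lra.
by move=> /kV; rewrite kercP dotC dot_delta => /eqP.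
Qed.

End Constant.

Hypothesis ncr : noncrossing (T |: SS).
Hypothesis nsur : forall S, S \in SS -> ~ surrounds S T.

(** The partition conditions place i, j, k, l in one block, or in T together with 0;
    [interval_exchange] then applies inside that factor, the others being unchanged. *)
Lemma block_exchange z e (i j k l : 'I_n.+1) :
  (i < j)%N -> (j < k)%N -> (k < l)%N -> 0 < e -> Q z ->
  Q (z + e *: (hat i - hat k)) -> Q (z + e *: (hat k - hat i)) ->
  Q (z + e *: (hat j - hat l)) -> Q (z + e *: (hat l - hat j)) ->
  Q (z + e *: (hat i - hat j)) /\ Q (z + e *: (hat j - hat i)).
Proof.
move=> ij jk kl e0 Qz Q1 Q2 Q3 Q4.
(* The sum over a block is constant on Q, so a feasible exchange cannot cross its boundary. *)
have same S a b : S \in SS -> Q (z + e *: (hat a - hat b)) ->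
    (a \in upset S) = (b \in upset S).
  move=> hS Qab; have [c hc] := block_const hS.
  have := hc _ Qab; rewrite coord_sum_move (hc _ Qz).
  by case: (a \in _); case: (b \in _) => //= h; exfalso; lra.
have cover (a : 'I_n) : a \in T \/ exists2 S, S \in SS & a \in S.
  have [aT|aT] := boolP (a \in T); [by left | right].
  have : a \in cover SS by rewrite (cover_partition part) inE.
  by case/bigcupP => S hS aS; exists S.
have restr_move K x t a b : in_ext K a -> in_ext K b ->
    restr K (x + t *: (hat a - hat b)) = restr K x + t *: (hat a - hat b).
  move=> Ka Kb; rewrite restrD restrZ (@restr_id _ _ K (_ - _)) //.
  exact: hatB_in_coord.
have restr_off K K' x t a b : [disjoint K & K'] -> in_ext K a -> in_ext K b ->
    restr K' (x + t *: (hat a - hat b)) = restr K' x.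
  move=> dK Ka Kb; rewrite restrD restrZ (@restr_disjoint _ _ K K' (_ - _)) //.
    by rewrite scaler0 addr0.
  exact: hatB_in_coord.
have [j' jE] := up_pos ij; have [k' kE] := up_pos jk; have [l' lE] := up_pos kl.
have sSS S : S \in SS -> S \in T |: SS by move=> hS; rewrite inE hS orbT.
have TSS : T \in T |: SS by rewrite !inE eqxx.
have neT S : S \in SS -> S != T.
  move=> hS; apply/eqP => ST; have := block_disjointT hS; rewrite ST -setI_eq0 setIid.
  by apply/negP; rewrite -ST; apply: partition_neq0 part hS.
have notT S s : S \in SS -> s \in S -> s \in T -> False.
  by move=> hS sS sT; have := disjointFr (block_disjointT hS) sS; rewrite sT.
have inblock S : S \in SS -> i \in upset S -> j \in upset S ->
    Q (z + e *: (hat i - hat j)) /\ Q (z + e *: (hat j - hat i)).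
  move=> hS iS jS; have kS : k \in upset S by rewrite -(same S i k).
  have lS : l \in upset S by rewrite -(same S j l).
  have ex a : a \in upset S -> in_ext S a by rewrite /in_ext => ->; rewrite orbT.
  have [[[[f [g [_ PE PI]]] _] _] _] := PPok hS.
  have hp x : Q x -> gpoly_interval S f g (restr S x).
    by move=> /prodQ[/(_ S hS) /PI].
  move: (hp _ Q1) (hp _ Q2) (hp _ Q3) (hp _ Q4); rewrite !restr_move ?ex // => h1 h2 h3 h4.
  have hin : [&& in_ext S i, in_ext S j, in_ext S k & in_ext S l] by rewrite !ex.
  have [/PI r1 /PI r2] := interval_exchange ij jk kl hin e0 (hp _ Qz) h1 h2 h3 h4.
  have /prodQ[zS zT] := Qz.
  have fin a b : a \in upset S -> b \in upset S ->
      PP S (restr S z + e *: (hat a - hat b)) -> Q (z + e *: (hat a - hat b)).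
    move=> aS bS r; apply/prodQ; split=> [S' hS'|]; last first.
      by rewrite (restr_off S) ?ex // block_disjointT.
    have [->|ne] := eqVneq S' S; first by rewrite restr_move ?ex.
    by rewrite (restr_off S) ?ex //; [exact: zS | apply: block_disjoint; rewrite // eq_sym].
  by split; apply: fin.
have inblockT : in_ext T i -> j' \in T ->
    Q (z + e *: (hat i - hat j)) /\ Q (z + e *: (hat j - hat i)).
  move=> iT jT.
  have noS s a : in_ext T a -> Q (z + e *: (hat a - hat (up s))) -> s \in T.
    move=> aT Qa; case: (cover s) => // -[S hS sS].
    move: (same S _ _ hS Qa); rewrite mem_upset sS.
    case/orP: aT => [/eqP->|/imsetP[s' s'T ->]]; first by rewrite ord0_upset.
    by rewrite mem_upset => s'S; case: (notT S s').
  have ex s : s \in T -> in_ext T (up s) by rewrite /in_ext mem_upset => ->; rewrite orbT.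
  have jT' : in_ext T j by rewrite jE ex.
  have kT : in_ext T k by rewrite kE ex // (noS _ i) // -kE.
  have lT : in_ext T l by rewrite lE ex // (noS _ j) // -lE.
  have [[[f [g [_ PE PI]]] _] _] := Q0ok.
  have hp x : Q x -> gpoly_interval T f g (restr T x) by move=> /prodQ[_ /PI].
  move: (hp _ Q1) (hp _ Q2) (hp _ Q3) (hp _ Q4); rewrite !restr_move // => h1 h2 h3 h4.
  have hin : [&& in_ext T i, in_ext T j, in_ext T k & in_ext T l] by rewrite iT jT' kT.
  have [/PI r1 /PI r2] := interval_exchange ij jk kl hin e0 (hp _ Qz) h1 h2 h3 h4.
  have /prodQ[zS zT] := Qz.
  have fin a b : in_ext T a -> in_ext T b ->
      Q0 (restr T z + e *: (hat a - hat b)) -> Q (z + e *: (hat a - hat b)).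
    move=> aT bT r; apply/prodQ; split=> [S hS|]; last by rewrite restr_move.
    by rewrite (restr_off T) //; [exact: zS | rewrite disjoint_sym block_disjointT].
  by split; apply: fin.
have kT_i : k' \in T -> in_ext T i.
  move=> kT; rewrite /in_ext; case: (upP i) => [->|[i' iE]]; first by rewrite eqxx.
  rewrite iE mem_upset; case: (cover i') => [->|[S hS iS]]; first by rewrite orbT.
  have := same S i k hS Q1; rewrite iE kE !mem_upset iS => /esym kS.
  by case: (notT S k').
have up_i (i' : 'I_n) : i = up i' -> [/\ (i' < j')%N, (j' < k')%N & (k' < l')%N].
  by move=> iE; rewrite -(up_lt i') -(up_lt j') -(up_lt k') -iE -jE -kE -lE.
case: (cover j') => [jT | [S hS jS]].
  case: (cover k') => [kT | [S hS kS]]; first by apply: inblockT => //; apply: kT_i.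
  have iS : i \in upset S by rewrite (same S i k) // kE mem_upset.
  case/imsetP: iS => i' iS iE; have [h1 h2 h3] := up_i _ iE.
  have lT : l' \in T.
    case: (cover l') => // -[S' hS' lS'].
    have := same S' j l hS' Q3; rewrite jE lE !mem_upset lS' => jS'.
    by case: (notT S' j').
  case: (ncr (sSS _ hS) TSS (neT _ hS)); exists i', j', k', l'.
  by split.
have lS : l' \in S by move: (same S j l hS Q3); rewrite jE lE !mem_upset jS.
have jk' : (j' < k')%N by rewrite -up_lt -jE -kE.
have kl' : (k' < l')%N by rewrite -up_lt -kE -lE.
case: (cover k') => [kT | [S' hS' kS']]; last first.
  have iS' : i \in upset S' by rewrite (same S' i k) // kE mem_upset.
  have [SS'|ne] := eqVneq S S'.
    by apply: (inblock S) => //; rewrite ?SS' // -SS' jE mem_upset.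
  case/imsetP: iS' => i' iS iE; have [h1 h2 h3] := up_i _ iE.
  case: (ncr (sSS _ hS') (sSS _ hS)); first by rewrite eq_sym.
  by exists i', j', k', l'; split.
(* Here k in T lies between j and l in S. Cutting S at k shows that S surrounds T: an element of T
   on the wrong side of one of S would produce a crossing with k and one of j, l. *)
exfalso; apply: (nsur hS); split; first by apply/set0Pn; exists k'.
exists [set s in S | (s < k')%N], [set s in S | (k' < s)%N].
have neq s t : s \in S -> t \in T -> (s : nat) <> t.
  by move=> sS tT /val_inj st; apply: (notT S s); rewrite // st.
split.
- apply/setP => s; rewrite !inE -andb_orr; case: (boolP (s \in S)) => //= sS.
  by case: ltngtP => // sk; case: (neq s k').
- rewrite -setI_eq0; apply/eqP/setP => s; rewrite !inE.
  by case: (ltngtP s k') => _; rewrite ?andbF.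
- by split; apply/set0Pn; [exists j' | exists l']; rewrite inE ?jS ?lS.
- move=> s t; rewrite inE => /andP[sS sk] tT.
  case: (ltngtP s t) => // [ts | st]; last by case: (neq s t).
  case: (ncr TSS (sSS _ hS)); first by rewrite eq_sym neT.
  by exists t, s, k', l'; split.
move=> t s tT; rewrite inE => /andP[sS ks].
case: (ltngtP t s) => // [st | ts]; last by case: (neq s t).
case: (ncr (sSS _ hS) TSS (neT _ hS)).
by exists j', k', s, t; split.
Qed.

End Product.

(** The indicator of a block of one decomposition is constant on Q. So for the other decomposition
    it vanishes on T and is constant on blocks: each block is a union of blocks of the other, and
    conversely. *)
Lemma decomposition_unique (Q : 'rV[R]_n -> Prop) SS T SS' T' : (exists x, Q x) ->
  partition SS (~: T) -> decomposes Q SS T ->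
  partition SS' (~: T') -> decomposes Q SS' T' -> SS = SS' /\ T = T'.
Proof.
move=> [x0 Qx0] pS dS pS' dS'.
have dotE S x : dot (e_ R S) x = coord_sum x S.
  by rewrite coord_sumE; apply: eq_bigr => i _; rewrite e_E.
have step SS1 T1 SS2 T2 S a : partition SS1 (~: T1) -> decomposes Q SS1 T1 ->
    partition SS2 (~: T2) -> decomposes Q SS2 T2 -> S \in SS1 -> a \in S ->
    a \notin T2 /\ forall S', S' \in SS2 -> a \in S' -> S' \subset S.
  move=> p1 [P1 [Q1 [P1ok Q1ok prod1]]] p2 [P2 [Q2 [P2ok Q2ok prod2]]] hS aS.
  have cQ x y : Q x -> Q y -> dot (e_ R S) x = dot (e_ R S) y.
    rewrite !dotE; have [c hc] := block_const P1ok prod1 hS.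
    by move=> /hc -> /hc ->.
  split.
    apply/negP => aT; have := const_T p2 Q2ok prod2 cQ Qx0 aT.
    by rewrite e_E aS => /eqP; rewrite oner_eq0.
  move=> S' hS' aS'; apply/subsetP => b bS'.
  have := const_block p2 P2ok prod2 cQ Qx0 hS' aS' bS'.
  rewrite !e_E aS; case: (b \in S) => // /eqP; by rewrite oner_eq0.
have covered (SS1 : {set {set 'I_n}}) T1 a : partition SS1 (~: T1) -> a \notin T1 ->
    exists2 S, S \in SS1 & a \in S.
  move=> p1 aT; have : a \in cover SS1 by rewrite (cover_partition p1) inE.
  by case/bigcupP => S; exists S.
have subT SS1 T1 SS2 T2 : partition SS1 (~: T1) -> decomposes Q SS1 T1 ->
    partition SS2 (~: T2) -> decomposes Q SS2 T2 -> T2 \subset T1.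
  move=> p1 d1 p2 d2; apply/subsetP => a; apply: contraTT => aT.
  have [S hS aS] := covered _ _ _ p1 aT.
  by have [] := step _ _ _ _ _ _ p1 d1 p2 d2 hS aS.
have eT : T = T'.
  by apply/eqP; rewrite eqEsubset (subT _ _ _ _ pS' dS' pS dS) (subT _ _ _ _ pS dS pS' dS').
have subS SS1 T1 SS2 T2 S : partition SS1 (~: T1) -> decomposes Q SS1 T1 ->
    partition SS2 (~: T2) -> decomposes Q SS2 T2 -> S \in SS1 -> S \in SS2.
  move=> p1 d1 p2 d2 hS.
  have S0 := partition_neq0 p1 hS.
  have [a aS] := set0Pn _ S0; have [aT h] := step _ _ _ _ _ _ p1 d1 p2 d2 hS aS.
  have [S' hS' aS'] := covered _ _ _ p2 aT.
  have [_ h'] := step _ _ _ _ _ _ p2 d2 p1 d1 hS' aS'.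
  by have -> : S = S' by apply/eqP; rewrite eqEsubset h' // h.
split=> //; apply/setP => S; apply/idP/idP.
  exact: subS pS dS pS' dS'.
exact: subS pS' dS' pS dS.
Qed.

(** A face that contains the midpoint of a segment of Q contains the segment, so w is a third
    direction of F. *)
Lemma square_dim (Q F : 'rV[R]_n -> Prop) a b c d w : is_face Q F -> has_dim F 2 ->
  F a -> F b -> F c -> F d -> a + c = b + d ->
  Q (2^-1 *: (a + c) + 2^-1 *: w) -> Q (2^-1 *: (a + c) - 2^-1 *: w) ->
  \dim <<[:: a - b; a - d; w]>>%VS = 3 -> False.
Proof.
move=> [h hF] [p [V [Fp Vp _ dV]]] Fa Fb Fc Fd acbd Q1 Q2 d3.
have sub x y : F x -> F y -> x - y \in V.
  move=> /Vp hx /Vp hy; have -> : x - y = (x - p) - (y - p) by rewrite opprB addrA subrK.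
  exact: rpredB.
have [Qa ma] := (hF a).1 Fa; have [Qc mc] := (hF c).1 Fc.
have ac : dot h a = dot h c by apply/eqP; rewrite eq_le ma ?mc.
have h1 := ma _ Q1; have h2 := ma _ Q2.
rewrite !(dotD, dotN, dotZ) in h1 h2.
have F1 : F (2^-1 *: (a + c) + 2^-1 *: w).
  by apply/hF; split=> // y /ma; rewrite !(dotD, dotN, dotZ); lra.
have F2 : F (2^-1 *: (a + c) - 2^-1 *: w).
  by apply/hF; split=> // y /ma; rewrite !(dotD, dotN, dotZ); lra.
have wV : w \in V.
  have := sub _ _ F1 F2; congr (_ \in V).
  by apply/rowP => i; rewrite !mxE; field.
have : (<<[:: a - b; a - d; w]>> <= V)%VS.
  by apply/span_subvP => u; rewrite !inE => /or3P[]/eqP-> //; apply: sub.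
by move=> /dimvS; rewrite d3 dV.
Qed.

End Decomposition.

(** * Square faces of products *)

Section Squares.
Local Open Scope ring_scope.
Variables (R : realType) (n : nat).
Implicit Types (x y : 'rV[R]_n) (X J : {set 'I_n}) (Q : 'rV[R]_n -> Prop).
Local Notation "''d_' i" := (delta_mx ord0 i : 'rV[R]_n) (at level 8, i at level 2).
Local Notation up i := (lift (@ord0 n) i).

Lemma gpoly_midpoint S (f g : {set 'I_n} -> R) x y :
  gpoly S f g x -> gpoly S f g y -> gpoly S f g (2^-1 *: (x + y)).
Proof.
move=> [Sx hx] [Sy hy]; split=> [i iS|A AS]; first by rewrite !mxE Sx // Sy // addr0 mulr0.
by rewrite coord_sumZ coord_sumD; have := hx A AS; have := hy A AS; lra.
Qed.

Lemma e_U1 X i : i \notin X -> e_ R (X :|: [set i]) = e_ R X + 'd_i.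
Proof.
move=> iX; apply/rowP => l; rewrite mxE !e_E !inE mxE eqxx /=.
have [->|_] := eqVneq l i; first by rewrite (negPf iX) add0r.
by rewrite orbF addr0.
Qed.

Lemma e_U2 X i j : i \notin X -> j \notin X -> i != j ->
  e_ R (X :|: [set i; j]) = e_ R X + 'd_i + 'd_j.
Proof.
by move=> iX jX ij; rewrite setUA !e_U1 // !inE negb_or jX eq_sym.
Qed.

Lemma dim_span3 (v0 v1 v2 c0 c1 c2 : 'rV[R]_n) :
  [/\ dot c0 v0 = 1, dot c0 v1 = 0 & dot c0 v2 = 0] ->
  [/\ dot c1 v0 = 0, dot c1 v1 = 1 & dot c1 v2 = 0] ->
  [/\ dot c2 v0 = 0, dot c2 v1 = 0 & dot c2 v2 = 1] ->
  \dim <<[:: v0; v1; v2]>>%VS = 3.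
Proof.
move=> [h00 h01 h02] [h10 h11 h12] [h20 h21 h22].
have -> : [:: v0; v1; v2] = [seq nth 0 [:: v0; v1; v2] m | m <- [:: 0; 1; 2]%N] by [].
rewrite (@dim_dual _ _ _ _ _ (nth 0 [:: c0; c1; c2])) // => a b.
by rewrite !inE => /or3P[]/eqP-> /or3P[]/eqP->.
Qed.

Variables (Q : 'rV[R]_n -> Prop) (SS : {set {set 'I_n}}) (T : {set 'I_n}).
Hypothesis Qmid : forall x y, Q x -> Q y -> Q (2^-1 *: (x + y)).
Hypothesis ncp : noncrossing_partition SS T.
Hypothesis nsur : forall S, S \in SS -> ~ surrounds S T.
Hypothesis dec : decomposes Q SS T.

(** Allowing i to be 0 covers both forbidden shapes; the disjunction records which side runs along
    which exchange. *)
Lemma no_square a b c d (i j k l : 'I_n.+1) (F : 'rV[R]_n -> Prop) :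
  (i < j)%N -> (j < k)%N -> (k < l)%N -> is_face Q F -> has_dim F 2 ->
  F a -> F b -> F c -> F d -> a + c = b + d ->
  let u := unit_vec R i - unit_vec R k in let w := unit_vec R j - unit_vec R l in
  (a - b = u /\ a - d = w) \/ (a - b = w /\ a - d = - u) ->
  \dim <<[:: a - b; a - d; unit_vec R i - unit_vec R j]>>%VS = 3 -> False.
Proof.
move=> ij jk kl faceF dimF Fa Fb Fc Fd acbd u w uw.
have [part ncr] := ncp; have [PP [Q0 [PPok Q0ok prodQ]]] := dec.
have FQ x : F x -> Q x by case: faceF => h hF /hF[].
pose z := 2^-1 *: (a + c).
have Qz : Q z by apply: Qmid; apply: FQ.
(* The midpoint of a side is the centre displaced by half of an adjacent side, whence the step
   1/2. *)
have half x y v : F x -> F y -> x + y = a + c + v -> Q (z + 2^-1 *: v).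
  by move=> Fx Fy e; rewrite -scalerDr -e; apply: Qmid; apply: FQ.
have ab : Q (z + 2^-1 *: (a - b)).
  by apply: (half a d) => //; rewrite acbd; apply/rowP => s; rewrite !mxE; ring.
have ba : Q (z + 2^-1 *: - (a - b)).
  by apply: (half b c) => //; apply/rowP => s; rewrite !mxE; ring.
have ad : Q (z + 2^-1 *: (a - d)).
  by apply: (half a b) => //; rewrite acbd; apply/rowP => s; rewrite !mxE; ring.
have da : Q (z + 2^-1 *: - (a - d)).
  by apply: (half d c) => //; apply/rowP => s; rewrite !mxE; ring.
have [Q1 [Q2 [Q3 Q4]]] : Q (z + 2^-1 *: u) /\ Q (z + 2^-1 *: - u) /\
    Q (z + 2^-1 *: w) /\ Q (z + 2^-1 *: - w).
  by case: uw => [[<- <-] | [<- /eqP]] //; rewrite eq_sym eqr_oppLR => /eqP ->; rewrite opprK.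
rewrite !opprB in Q2 Q4; have e0 : 0 < 2^-1 :> R by rewrite invr_gt0.
have [R1 R2] := block_exchange part PPok Q0ok prodQ ncr nsur ij jk kl e0 Qz Q1 Q2 Q3 Q4.
apply: (square_dim faceF dimF Fa Fb Fc Fd acbd) => //.
by rewrite -scalerN opprB.
Qed.

Lemma face_vertices (L : seq {set 'I_n}) (F : 'rV[R]_n -> Prop) J :
  (forall v, is_vertex F v <-> exists2 J, J \in L & v = e_ R J) ->
  J \in L -> F (e_ R J).
Proof.
move=> hL JL; have [c hc] : is_vertex F (e_ R J) by apply/hL; exists J.
by have [] := (hc (e_ R J)).1 erefl.
Qed.

Lemma no_square3 X (i j k : 'I_n) :
  i \notin X -> j \notin X -> k \notin X -> (i < j)%N -> (j < k)%N ->
  ~ has_2face_with_vertices Q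
      [:: X :|: [set i; j]; X :|: [set j; k]; X :|: [set k]; X :|: [set i]].
Proof.
move=> iX jX kX ij jk [F [faceF dimF /face_vertices FL]].
have nij : i != j by rewrite neq_ltn ij.
have njk : j != k by rewrite neq_ltn jk.
have nik : i != k by rewrite neq_ltn (ltn_trans ij jk).
have Fa : F (e_ R (X :|: [set i; j])) by apply: FL; rewrite !inE eqxx ?orbT.
have Fb : F (e_ R (X :|: [set j; k])) by apply: FL; rewrite !inE eqxx ?orbT.
have Fc : F (e_ R (X :|: [set k])) by apply: FL; rewrite !inE eqxx ?orbT.
have Fd : F (e_ R (X :|: [set i])) by apply: FL; rewrite !inE eqxx ?orbT.
move: Fa Fb Fc Fd; rewrite !e_U2 // !e_U1 // => Fa Fb Fc Fd.
have ab : e_ R X + 'd_i + 'd_j - (e_ R X + 'd_j + 'd_k) = 'd_i - 'd_k.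
  by apply/rowP => s; rewrite !mxE; ring.
have ad : e_ R X + 'd_i + 'd_j - (e_ R X + 'd_i) = 'd_j.
  by apply/rowP => s; rewrite !mxE; ring.
apply: (@no_square _ _ _ _ ord0 (up i) (up j) (up k) F _ _ _ faceF dimF Fa Fb Fc Fd).
- by [].
- by rewrite up_lt.
- by rewrite up_lt.
- by apply/rowP => s; rewrite !mxE; ring.
- by right; rewrite !unit_vec_up unit_vec0 ab ad sub0r opprK.
rewrite ab ad unit_vec_up unit_vec0 sub0r.
(* Dual to ['d_i - 'd_k], ['d_j], [- 'd_i]; the last functional weighs i and k equally in order to
   kill the first vector. *)
apply: (@dim_span3 _ _ _ (-1 *: 'd_k) 'd_j (-1 *: ('d_i + 'd_k))).
all: rewrite ?dotZl ?dotDl !dotN ?dotD ?dotN !dot_delta !mxE !eqxx /=.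
all: rewrite ?(negPf nij) ?(negPf nik) ?(negPf njk).
all: rewrite ?(eq_sym k i) ?(eq_sym k j) ?(eq_sym j i) ?(negPf nij) ?(negPf nik) ?(negPf njk).
all: by split => /=; ring.
Qed.

Lemma no_square4 X (i j k l : 'I_n) :
  i \notin X -> j \notin X -> k \notin X -> l \notin X ->
  (i < j)%N -> (j < k)%N -> (k < l)%N ->
  ~ has_2face_with_vertices Q
      [:: X :|: [set i; j]; X :|: [set j; k]; X :|: [set k; l]; X :|: [set l; i]].
Proof.
move=> iX jX kX lX ij jk kl [F [faceF dimF /face_vertices FL]].
have nij : i != j by rewrite neq_ltn ij.
have njk : j != k by rewrite neq_ltn jk.
have nkl : k != l by rewrite neq_ltn kl.
have nik : i != k by rewrite neq_ltn (ltn_trans ij jk).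
have njl : j != l by rewrite neq_ltn (ltn_trans jk kl).
have nil : i != l by rewrite neq_ltn (ltn_trans ij (ltn_trans jk kl)).
have nli : l != i by rewrite eq_sym.
have Fa : F (e_ R (X :|: [set i; j])) by apply: FL; rewrite !inE eqxx ?orbT.
have Fb : F (e_ R (X :|: [set j; k])) by apply: FL; rewrite !inE eqxx ?orbT.
have Fc : F (e_ R (X :|: [set k; l])) by apply: FL; rewrite !inE eqxx ?orbT.
have Fd : F (e_ R (X :|: [set l; i])) by apply: FL; rewrite !inE eqxx ?orbT.
move: Fa Fb Fc Fd; rewrite !e_U2 // => Fa Fb Fc Fd.
have ab : e_ R X + 'd_i + 'd_j - (e_ R X + 'd_j + 'd_k) = 'd_i - 'd_k.
  by apply/rowP => s; rewrite !mxE; ring.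
have ad : e_ R X + 'd_i + 'd_j - (e_ R X + 'd_l + 'd_i) = 'd_j - 'd_l.
  by apply/rowP => s; rewrite !mxE; ring.
apply: (@no_square _ _ _ _ (up i) (up j) (up k) (up l) F _ _ _ faceF dimF Fa Fb Fc Fd).
- by rewrite up_lt.
- by rewrite up_lt.
- by rewrite up_lt.
- by apply/rowP => s; rewrite !mxE; ring.
- by left; rewrite !unit_vec_up ab ad.
rewrite ab ad !unit_vec_up.
(* Dual to ['d_i - 'd_k], ['d_j - 'd_l], ['d_i - 'd_j]. *)
apply: (@dim_span3 _ _ _ (-1 *: 'd_k) (-1 *: 'd_l) ('d_i + 'd_k)).
all: rewrite ?dotZl ?dotDl !dotD !dotN !dot_delta !mxE !eqxx /=.
all: rewrite ?(eq_sym k i) ?(eq_sym k j) ?(eq_sym j i) ?(eq_sym l i) ?(eq_sym l j) ?(eq_sym l k).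
all: rewrite ?(negPf nij) ?(negPf nik) ?(negPf njk) ?(negPf nkl) ?(negPf njl) ?(negPf nil).
all: by split => /=; ring.
Qed.

End Squares.

Theorem theorem3p16 (R : realType) (n : nat) (Q : 'rV[R]_n -> Prop)
    (hQ : gmatroid [set: 'I_n] Q) :
  (gpositroid [set: 'I_n] Q <->
    exists! ST : {set {set 'I_n}} * {set 'I_n},
      [/\ noncrossing_partition ST.1 ST.2,
          forall S, S \in ST.1 -> ~ surrounds S ST.2
        & decomposes Q ST.1 ST.2]) /\
  (gpositroid [set: 'I_n] Q <->
    (forall (X : {set 'I_n}) (i j k : 'I_n),
       i \notin X -> j \notin X -> k \notin X -> (i < j)%N -> (j < k)%N ->
       ~ has_2face_with_vertices Q
           [:: X :|: [set i; j]; X :|: [set j; k];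
               X :|: [set k]; X :|: [set i]]) /\
    (forall (X : {set 'I_n}) (i j k l : 'I_n),
       i \notin X -> j \notin X -> k \notin X -> l \notin X ->
       (i < j)%N -> (j < k)%N -> (k < l)%N ->
       ~ has_2face_with_vertices Q
           [:: X :|: [set i; j]; X :|: [set j; k];
               X :|: [set k; l]; X :|: [set l; i]])).
Proof.
have [[f [g [sp QE]]] V01] := hQ.
set sq := (X in _ /\ (_ <-> X)); set dc := (X in (_ <-> X) /\ _).
have Qmid x y : Q x -> Q y -> Q (2%:R^-1 *: (x + y))%R.
  by move=> /QE Qx /QE Qy; apply/QE; apply: gpoly_midpoint.
have QB x : Q x <-> in_base (lift_fun f g) (lift_pt x).
  by rewrite QE; apply: gpoly_base.
have [x0 Bx0] := lift_base_point sp.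
have pos_dc : gpositroid [set: 'I_n] Q -> dc.
  (* The blocks are built from the pair that comes with the interval description of Q. *)
  move=> [[f' [g' [sp' QE' QI']]] _].
  have [x0' Bx0'] := lift_base_point sp'.
  have [p [Bp _ symp]] := min_point Bx0'.
  have ncp := conn_noncrossing sp' QE' QI' Bp.
  have dec := conn_decomposes sp' QE' QI' V01 Bp symp.
  exists (conn_SS f' g' p, conn_T f' g' p); split; first split => //=.
    by move=> S; apply: (conn_surrounds sp' QE' QI' Bp).
  move=> [SS T] [/= [part _] _ dec'].
  have [|-> -> //] := @decomposition_unique R n Q _ _ _ _ _ ncp.1 dec part dec'.
  by exists x0; apply/QB.
have dc_sq : dc -> sq.
  move=> [[SS T] [[/= ncp nsur dec] _]]; split=> *.
    exact: (no_square3 Qmid ncp nsur dec).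
  exact: (no_square4 Qmid ncp nsur dec).
have sq_pos : sq -> gpositroid [set: 'I_n] Q.
  move=> [h3 h4]; split => //; exists f, g; split=> // x; rewrite QE.
  split; first exact: gpoly_gpoly_interval.
  move=> xI; apply/(gpoly_base sp).
  apply: (cyclic_inequalities (lift_fun0 sp) (lift_fun_sub sp)).
  - move=> y By cy; have yK : lift_pt (unlift_pt y) = y.
      by apply: unlift_ptK; rewrite By.2 lift_funT.
    have [] := square_face sp QB V01 (ex_intro _ (unlift_pt y) _).
    + by rewrite QB yK.
    + by move=> [X [i [j [k [iX jX kX /andP[ij jk]]]]]]; apply: h3.
    by move=> [X [i [j [k [l [iX jX [kX lX] /and3P[ij jk kl]]]]]]]; apply: h4.
  - by exists (lift_pt x0).
  - rewrite lift_funT // sm_lift !inE setCT /coord_sum big1 ?oppr0 // => i.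
    by rewrite !inE.
  by move=> G; apply: cyclic_interval_ineq.
by split; split; auto.
Qed.
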